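(* Let $m$ be a square-free positive integer, let $E=\mathbb{Q}(\sqrt{-m})$ with ring of integers $\mathfrak{O}$, and let $L$ be a $2$-universal quaternary Hermitian $\mathfrak{O}$-lattice which does not contain any $2$-universal ternary Hermitian $\mathfrak{O}$-lattice as a sublattice. Then one of the following holds: (i) $m=1$ and $L\cong\langle 1,1\rangle\perp\begin{pmatrix}2&1\\1&2\end{pmatrix}$; (ii) $m=2$ and $L\cong\langle 1,1\rangle\perp\begin{pmatrix}2&-1+\omega\\-1+\overline{\omega}&2\end{pmatrix}$ with $\omega=\sqrt{-2}$; (iii) $m=11$ and $L\cong\langle 1,1\rangle\perp\begin{pmatrix}2&\omega\\\overline{\omega}&2\end{pmatrix}$ with $\omega=\frac{1+\sqrt{-11}}{2}$.
   Context: A Hermitian $\mathfrak{O}$-lattice is a finitely generated $\mathfrak{O}$-submodule $L$ of a finite-dimensional $E$-vector space equipped with a form $H$ that is linear in the first variable, satisfies $H(x,y)=\overline{H(y,x)}$ (bar is complex conjugation), and has $H(L,L)\subseteq\mathfrak{O}$. Its rank is $\dim_E EL$; binary, ternary, quaternary mean rank 2, 3, 4. It need not be free. It is positive (definite) if $H(v):=H(v,v)>0$ for all $0\neq v\in L$; all lattices are assumed positive. The Gram matrix of a free lattice with basis $v_1,\dots,v_n$ is $M_L=(H(v_i,v_j))$, and a free lattice is identified with its Gram matrix; for a nonfree lattice, written $L=\mathfrak{O}w_1+\dots+\mathfrak{O}w_{n-1}+\mathfrak{O}\alpha w_n+\mathfrak{O}\beta w_n$, the formal Gram matrix $M_L$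 is the $(n+1)\times(n+1)$ matrix of values of $H$ on the generators $w_1,\dots,w_{n-1},\alpha w_n,\beta w_n$. $\langle a_1,\dots,a_n\rangle$ denotes the free lattice with diagonal Gram matrix with entries $a_1,\dots,a_n$, and $\perp$ denotes orthogonal sum. $L$ represents $\ell$ (written $\ell\to L$) if $M_\ell=XM_LX^*$ for some matrix $X$ over $\mathfrak{O}$, where $X^*$ is the conjugate transpose (equivalently, for positive lattices, there is an $\mathfrak{O}$-linear map $\ell\to L$ preserving $H$); two lattices are isometric ($\cong$) if they represent each other. A positive Hermitian $\mathfrak{O}$-lattice is $2$-universal if it represents all binary positive Hermitian $\mathfrak{O}$-lattices (free or not). *)

(* Defs.v *)
From HB Require Import structures.
From mathcomp Require Import all_boot all_order all_algebra all_field.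
From mathcomp Require Import ring.

Set Implicit Arguments.
Unset Strict Implicit.
Unset Printing Implicit Defensive.

Import Order.TTheory GRing.Theory Num.Theory.
Local Open Scope ring_scope.

Definition squarefree (m : nat) : Prop :=
  forall d : nat, (d ^ 2 %| m)%N -> d = 1%N.

(* The square root of -m in the upper half-plane. *)
Definition sqrtNC (m : nat) : algC := 'i * sqrtC m%:R.

Lemma sqrtNC_sqr m : sqrtNC m * sqrtNC m = - m%:R.
Proof. by rewrite -expr2 exprMn sqrCi sqrtCK mulN1r. Qed.

Lemma conj_sqrtNC m : (sqrtNC m)^* = - sqrtNC m.
Proof.
by rewrite /sqrtNC rmorphM /= conjCi mulNr (CrealP (ger0_real _)) // sqrtC_ge0 ler0n.
Qed.

(* Crat_span is the Q-linear span, so this is Q(sqrt(-m)) inside the complex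
   algebraic numbers. *)
Definition inQsqrtN (m : nat) : pred algC := Crat_span [:: 1; sqrtNC m].

Lemma inQsqrtNP m x :
  reflect (exists a b : rat, x = ratr a + ratr b * sqrtNC m)
          (x \in inQsqrtN m).
Proof.
apply: (iffP (Crat_spanP _ _)) => [[a ->]|[a [b ->]]].
  exists (a ord0), (a (lift ord0 ord0)).
  by rewrite !big_ord_recl big_ord0 addr0 mulr1.
exists [ffun i : 'I_2 => if i == ord0 then a else b].
by rewrite !big_ord_recl big_ord0 addr0 !ffunE /= mulr1.
Qed.

Lemma inQsqrtN_conj m x : x \in inQsqrtN m -> x^* \in inQsqrtN m.
Proof.
move=> /inQsqrtNP[a [b ->]]; apply/inQsqrtNP; exists a, (- b).
by rewrite rmorphD /= fmorph_rat rmorphM /= fmorph_rat conj_sqrtNC mulrN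
           rmorphN mulNr.
Qed.

Fact inQsqrtN_divring m : divring_closed (inQsqrtN m).
Proof.
have QM x y : x \in inQsqrtN m -> y \in inQsqrtN m -> x * y \in inQsqrtN m.
  move=> /inQsqrtNP[a [b ->]] /inQsqrtNP[c [d ->]]; apply/inQsqrtNP.
  exists (a * c - b * d * m%:R), (a * d + b * c).
  rewrite rmorphB !rmorphD !rmorphM /= ratr_nat.
  by have s2 := sqrtNC_sqr m; ring: s2.
split=> [|x y|x y Qx].
- by apply: mem_Crat_span; rewrite inE eqxx.
- move=> /inQsqrtNP[a [b ->]] /inQsqrtNP[c [d ->]]; apply/inQsqrtNP.
  by exists (a - c), (b - d); rewrite !rmorphB /= mulrBl opprD addrACA.
move=> Qy; have /inQsqrtNP[a [b Dy]] := Qy; apply: (QM) => //.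
have conj_y : y^* = ratr a - ratr b * sqrtNC m.
  by rewrite Dy rmorphD /= fmorph_rat rmorphM /= fmorph_rat conj_sqrtNC mulrN.
have norm_y : y * y^* = ratr (a ^+ 2 + b ^+ 2 * m%:R).
  rewrite conj_y Dy rmorphD rmorphM !rmorphXn /= ratr_nat.
  by have s2 := sqrtNC_sqr m; ring: s2.
have [->|nz_y] := eqVneq y 0.
  by rewrite invr0; apply/inQsqrtNP; exists 0, 0; rewrite rmorph0 mul0r addr0.
have -> : y^-1 = y^* / (y * y^*).
  by rewrite invfM mulrCA divff ?mulr1 // conjC_eq0.
apply: QM; rewrite ?inQsqrtN_conj // norm_y.
apply/inQsqrtNP; exists (a ^+ 2 + b ^+ 2 * m%:R)^-1, 0.
by rewrite fmorphV rmorph0 mul0r addr0.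
Qed.

HB.instance Definition _ m :=
  GRing.isDivringClosed.Build algC (inQsqrtN m) (inQsqrtN_divring m).

Definition QsqrtN (m : nat) : Type := {x : algC | x \in inQsqrtN m}.
HB.instance Definition _ m := SubChoice.on (QsqrtN m).
HB.instance Definition _ m :=
  [SubChoice_isSubIntegralDomain of QsqrtN m by <:].
HB.instance Definition _ m :=
  [SubIntegralDomain_isSubField of QsqrtN m by <:].

Definition sqrtN (m : nat) : QsqrtN m :=
  Sub (sqrtNC m) (mem_Crat_span (mem_last 1 [:: sqrtNC m])).

Definition Qconj (m : nat) (x : QsqrtN m) : QsqrtN m :=
  Sub (val x)^* (inQsqrtN_conj (valP x)).

Fact Qconj_zmod_morphism m : zmod_morphism (@Qconj m).
Proof. by move=> x y; apply: val_inj; rewrite /= rmorphB. Qed.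

Fact Qconj_monoid_morphism m : monoid_morphism (@Qconj m).
Proof.
by split=> [|x y]; apply: val_inj; rewrite /= ?rmorph1 ?rmorphM.
Qed.

Fact QconjK m : involutive (@Qconj m).
Proof. by move=> x; apply: val_inj; rewrite /= conjCK. Qed.

HB.instance Definition _ m :=
  GRing.isZmodMorphism.Build (QsqrtN m) (QsqrtN m) (@Qconj m)
    (@Qconj_zmod_morphism m).
HB.instance Definition _ m :=
  GRing.isMonoidMorphism.Build (QsqrtN m) (QsqrtN m) (@Qconj m)
    (@Qconj_monoid_morphism m).
HB.instance Definition _ m :=
  isInvolutive.Build (QsqrtN m) (@Qconj m) (@QconjK m).

Definition ring_of_integers (m : nat) : pred (QsqrtN m) := [pred x | val x \in Aint].

Arguments ring_of_integers m : clear implicits.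

(* `Qconj` is the restriction of complex conjugation, so `hform` is linear in
   its first argument and hform x y = Qconj (hform y x).  The ambient form is
   not required to be definite: definiteness is a property of lattices. *)
Record hermSpace (m : nat) := HermSpace {
  hspace :> vectType (QsqrtN m);
  hform : {hermitian_sym hspace for @Qconj m}
}.

Definition Ospan m (V : hermSpace m) n (v : 'I_n -> V) (x : V) : Prop :=
  exists2 c : 'I_n -> QsqrtN m,
    forall i, c i \in ring_of_integers m & x = \sum_i c i *: v i.

(* Positive Hermitian lattices in V.  The order on algC satisfies
   0 < z iff z is real and positive. *)
Record hermLattice m (V : hermSpace m) := HermLattice {
  lcarrier :> V -> Prop;
  lattice_fg : exists n (v : 'I_n -> V), forall x, lcarrier x <-> Ospan v x;
  lattice_integral :
    forall x y, lcarrier x -> lcarrier y -> hform V x y \in ring_of_integers m;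
  lattice_pos : forall x, lcarrier x -> x != 0 -> 0 < val (hform V x x)
}.

(* The E-span EL of L, as the least subspace containing L, has dimension n. *)
Definition has_rank m (V : hermSpace m) (L : hermLattice V) (n : nat) : Prop :=
  exists U : {vspace V},
    [/\ forall x, L x -> x \in U,
        forall W : {vspace V}, (forall x, L x -> x \in W) -> (U <= W)%VS
      & \dim U = n].

Definition sublattice m (V : hermSpace m) (M L : hermLattice V) : Prop :=
  forall x, M x -> L x.

(* M -> L: an O-linear, form-preserving map from M to L, given by a function on the
   ambient space of M; its values outside of M are irrelevant. *)
Definition represents m (V W : hermSpace m)
    (L : hermLattice V) (M : hermLattice W) : Prop :=
  exists f : W -> V,
    [/\ forall x, M x -> L (f x),
        forall x y, M x -> M y -> f (x + y) = f x + f y,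
        forall a x, a \in ring_of_integers m -> M x -> f (a *: x) = a *: f x
      & forall x y, M x -> M y -> hform V (f x) (f y) = hform W x y].

Definition isometric m (V W : hermSpace m)
    (L : hermLattice V) (M : hermLattice W) : Prop :=
  represents L M /\ represents M L.

Definition two_universal m (V : hermSpace m) (L : hermLattice V) : Prop :=
  forall (W : hermSpace m) (M : hermLattice W), has_rank M 2 -> represents L M.

Definition has_gram m (V : hermSpace m) (L : hermLattice V)
    n (G : 'M[QsqrtN m]_n) : Prop :=
  exists v : 'I_n -> V,
    [/\ forall x, L x <-> Ospan v x,
        forall c : 'I_n -> QsqrtN m, (forall i, c i \in ring_of_integers m) ->
          \sum_i c i *: v i = 0 -> forall i, c i = 0
      & forall i j, hform V (v i) (v j) = G i j].

(* A Gram matrix G stands for any free lattice having a basis with Gram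
   matrix G; all of these are isometric. *)
Definition isometric_gram m (V : hermSpace m) (L : hermLattice V)
    n (G : 'M[QsqrtN m]_n) : Prop :=
  exists (W : hermSpace m) (M : hermLattice W), has_gram M G /\ isometric L M.

Definition diag_gram (R : nzRingType) (s : seq R) : 'M[R]_(size s) :=
  diag_mx (\row_i s`_i).

Definition binary_gram (R : nzRingType) (a b c d : R) : 'M[R]_2 :=
  \matrix_(i, j)
    if i == ord0 then (if j == ord0 then a else b)
    else (if j == ord0 then c else d).

Definition orthosum_gram (R : nzRingType) n p (A : 'M[R]_n) (B : 'M[R]_p) :
    'M[R]_(n + p) := block_mx A 0 0 B.

(* Main.v *)
(* The binary lattice <1,1> is represented, so L contains orthonormal vectors
   e1, e2, and other binary lattices decide what their orthogonal complement is.

   If m = 1, 2 (mod 4), m >= 2, or m = 3 (mod 8), m >= 11, there is a unimodular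
   lattice B = [2, b; b^, d] without vectors of norm 1.  Such vectors are
   orthogonal to B, hence L = <1,1> _|_ B.  This settles m = 2 and m = 11; for
   larger m any two vectors of norm 2 in L have even product, and
   A2 = [2, 1; 1, 2] is not represented.  If m = 7 (mod 8) and m >= 15, the same
   happens with a nonfree lattice p^-1 u1 + p^-1 u2, where p lies above 2 and
   H(u1) = H(u2) = 2, in place of B.

   If m = 1 or 7 (m = 3), a vector of norm 1 (1 or 2) orthogonal to e1 and e2
   yields a sublattice <1,1,c> with c = 1 (c = 1 or 2), which is 2-universal.
   Without such a vector <1,2> is not represented when m = 3, and for m = 1 and 7
   the lattice A2 lies in the complement, so L = <1,1> _|_ A2 because 3 is inert;
   when m = 7 this L does not represent [3, omega - 2; omega^ - 2, 3].

   The lattices <1,1,c> are 2-universal because E is Euclidean and every binary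
   lattice l has an orthogonal sum l _|_ <k> of determinant c N(delta); it is
   enlarged one prime divisor of delta at a time, by dividing a vector in the
   radical modulo that prime, until the determinant is c.  Hermite reduction then
   leaves only <1,1,c>, and for m = 7 also the Barnes lattice. *)

Require Import Defs.
From HB Require Import structures.
From mathcomp Require Import all_boot all_order all_algebra all_field.
From mathcomp Require Import ring lra zify.
From Stdlib Require Import Classical_Prop.

Set Implicit Arguments.
Unset Strict Implicit.
Unset Printing Implicit Defensive.

Import Order.TTheory GRing.Theory Num.Theory.
Local Open Scope ring_scope.

(** The summand is taken with k = c det(l), so that the determinant is c N(det l). A vector v of the
    radical modulo pi can be divided by pi only if N(pi) divides H(v, v), while the radical yields
    no more than pi. As H(v, v) is rational, the two differ for inert pi = t alone. There t^2
    divides the determinant, which produces a second vector y of the radical modulo t, and a v + y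
    has norm 0 modulo t^2 for a suitable a: a norm equation modulo t, solvable because x^2 + m y^2
    takes all residues.

    The reduction uses a bound rho for the norm of the difference to a nearest integer: 1/2, 7/16,
    4/7 for m = 1, 3, 7. The first minimum a satisfies (1 - rho)^3 a^3 <= c, hence a <= 2; for m = 1
    and 7, a = 2 survives only when all three vectors have norm 2, and parity then excludes m = 1.

    For large m the impossibility proofs rest on a scarcity: integers of small norm are rational, so
    the coordinates of short vectors of L are rational integers and a finite check on integral
    quadratic forms remains. *)

Section FieldIdentities.
Variable F : fieldType.
Implicit Types x y p P q Q t u v r : F.

Lemma divr_mulK x p q : q != 0 -> x / (p * q) * q = x / p.
Proof. by move=> q0; rewrite invfM mulrA divfK. Qed.

Lemma divr_chain x p t : p != 0 -> x / t = x / p * (p / t).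
Proof. by move=> p0; rewrite mulrA divfK. Qed.

Lemma divr_ratio x p t : t != 0 -> x / p = x / t * (p / t)^-1.
Proof. by move=> t0; rewrite invf_div mulrA divfK. Qed.

Lemma divr_sandwich x p t : p != 0 -> t != 0 -> x = x / p * (p / t) * t.
Proof. by move=> p0 t0; rewrite -divr_chain // divfK. Qed.

Lemma bezout_quotient x p u v : u * x + v * p != 0 -> p != 0 ->
  (x * (u / (u * x + v * p)) - 1) / p = - v / (u * x + v * p).
Proof. by move=> g0 p0; field; rewrite g0. Qed.

Lemma quotient_norm c x Q' q Q : q != 0 -> Q != 0 ->
  c * (x * Q') = q * Q * (c * (x / q * (Q' / Q))).
Proof. by move=> q0 Q0; field; rewrite q0 Q0. Qed.

Lemma divr_norm_ratio r p P t : p != 0 -> P != 0 -> t != 0 ->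
  r / (p * P) = r / (t * t) * (t / p * (t / P)).
Proof. by move=> p0 P0 t0; field; rewrite p0 P0 t0. Qed.

End FieldIdentities.

(** * The field Q(sqrt(-m)) and its integers *)

Definition rQ m (q : rat) : QsqrtN m := ratr q.
Arguments rQ m q : clear implicits.

Lemma val_rQ m q : val (rQ m q) = ratr q.
Proof. exact: fmorph_rat. Qed.

Fact rQ_zmod_morphism m : zmod_morphism (rQ m).
Proof.
move=> x y; apply: val_inj; rewrite val_rQ rmorphB /=.
by rewrite -(val_rQ m x) -(val_rQ m y).
Qed.

Fact rQ_monoid_morphism m : monoid_morphism (rQ m).
Proof.
split=> [|x y]; apply: val_inj; rewrite val_rQ; first by rewrite rmorph1.
by rewrite rmorphM /= -(val_rQ m x) -(val_rQ m y).
Qed.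

HB.instance Definition _ m :=
  GRing.isZmodMorphism.Build rat (QsqrtN m) (rQ m) (@rQ_zmod_morphism m).
HB.instance Definition _ m :=
  GRing.isMonoidMorphism.Build rat (QsqrtN m) (rQ m) (@rQ_monoid_morphism m).

Fact ring_of_integers_subring m : subring_closed (ring_of_integers m).
Proof.
split=> [|x y|x y]; rewrite !inE /=; first exact: Aint1.
  exact: rpredB.
exact: rpredM.
Qed.

HB.instance Definition _ m :=
  GRing.isSubringClosed.Build (QsqrtN m) (ring_of_integers m)
    (@ring_of_integers_subring m).

Section Scalars.
Variable m : nat.
Local Notation E := (QsqrtN m).
Local Notation O := (ring_of_integers m).
Local Notation cj := (@Qconj m).
Local Notation s := (sqrtN m).
Implicit Types x y : E.

Lemma cjD x y : cj (x + y) = cj x + cj y. Proof. exact: rmorphD. Qed.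
Lemma cjB x y : cj (x - y) = cj x - cj y. Proof. exact: rmorphB. Qed.
Lemma cjN x : cj (- x) = - cj x. Proof. exact: rmorphN. Qed.
Lemma cjM x y : cj (x * y) = cj x * cj y. Proof. exact: rmorphM. Qed.
Lemma cjV x : cj x^-1 = (cj x)^-1. Proof. exact: fmorphV. Qed.
Lemma cjn n : cj n%:R = n%:R. Proof. exact: rmorph_nat. Qed.
Lemma cj0 : cj 0 = 0. Proof. exact: rmorph0. Qed.
Lemma cj1 : cj 1 = 1. Proof. exact: rmorph1. Qed.
Lemma cjz (n : int) : cj n%:~R = n%:~R. Proof. exact: rmorph_int. Qed.

Lemma cj_s : cj s = - s.
Proof. by apply: val_inj; rewrite /= conj_sqrtNC. Qed.
Lemma s_sqr : s * s = - m%:R.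
Proof. by apply: val_inj; rewrite rmorphN rmorph_nat; apply: sqrtNC_sqr. Qed.
Lemma cj_rQ q : cj (rQ m q) = rQ m q.
Proof. exact: fmorph_rat. Qed.

Lemma coordP x : exists a b, x = rQ m a + rQ m b * s.
Proof.
have /inQsqrtNP[a [b Dx]] := valP x.
by exists a, b; apply: val_inj; rewrite Dx rmorphD rmorphM /= -(val_rQ m a) -(val_rQ m b).
Qed.

Lemma natE_neq0 n : n.+1%:R != 0 :> E.
Proof. by rewrite -(rmorph_nat (rQ m)) fmorph_eq0 pnatr_eq0. Qed.

Lemma rQ_inj : injective (rQ m). Proof. exact: fmorph_inj. Qed.

(** The norm takes values in [rat], where the order and the arithmetic tactics are available;
    [getCrat] inverts [ratr] on rational algebraic numbers. *)
Definition nrm x : rat := getCrat (val (x * cj x)).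

Lemma nrm_coord a b x : x = rQ m a + rQ m b * s -> nrm x = a ^+ 2 + m%:R * b ^+ 2.
Proof.
move=> Dx; apply: (canLR ratCK); rewrite -(val_rQ m); congr (val _).
have s2 := s_sqr; rewrite Dx cjD cjM cj_s !cj_rQ.
rewrite rmorphD rmorphM !rmorphXn /= rmorph_nat.
by ring: s2.
Qed.

Lemma nrmE x : rQ m (nrm x) = x * cj x.
Proof.
have [a [b Dx]] := coordP x; rewrite (nrm_coord Dx).
have s2 := s_sqr; rewrite Dx cjD cjM cj_s !cj_rQ.
rewrite rmorphD rmorphM !rmorphXn /= rmorph_nat.
by ring: s2.
Qed.

Lemma nrm_ge0 x : 0 <= nrm x.
Proof.
have [a [b /nrm_coord->]] := coordP x.
by rewrite addr_ge0 ?sqr_ge0 // mulr_ge0 ?sqr_ge0 ?ler0n.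
Qed.

Lemma nrmM x y : nrm (x * y) = nrm x * nrm y.
Proof. by apply: rQ_inj; rewrite rmorphM /= !nrmE cjM; ring. Qed.

Lemma nrm_cj x : nrm (cj x) = nrm x.
Proof. by apply: rQ_inj; rewrite !nrmE QconjK mulrC. Qed.

Lemma nrmN x : nrm (- x) = nrm x.
Proof. by apply: rQ_inj; rewrite !nrmE cjN; ring. Qed.

Lemma nrm_rQ q : nrm (rQ m q) = q ^+ 2.
Proof. by apply: rQ_inj; rewrite nrmE cj_rQ rmorphXn. Qed.

Lemma nrm0 : nrm 0 = 0.
Proof. by rewrite -(rmorph0 (rQ m)) nrm_rQ expr0n. Qed.
Lemma nrm1 : nrm 1 = 1.
Proof. by rewrite -(rmorph1 (rQ m)) nrm_rQ expr1n. Qed.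
Lemma nrmn n : nrm n%:R = n%:R ^+ 2.
Proof. by rewrite -(rmorph_nat (rQ m)) nrm_rQ. Qed.
Lemma nrmz (n : int) : nrm n%:~R = n%:~R ^+ 2.
Proof. by rewrite -(rmorph_int (rQ m)) nrm_rQ. Qed.

Lemma cj_eq0 x : (cj x == 0) = (x == 0).
Proof. exact: fmorph_eq0. Qed.

Lemma nrm_eq0 x : (nrm x == 0) = (x == 0).
Proof.
by rewrite -(fmorph_eq0 (rQ m)) /= nrmE mulf_eq0 cj_eq0 orbb.
Qed.

Lemma nrm_gt0 x : (0 < nrm x) = (x != 0).
Proof. by rewrite lt0r nrm_eq0 nrm_ge0 andbT. Qed.

Lemma nrmV x : nrm x^-1 = (nrm x)^-1.
Proof.
have [->|x0] := eqVneq x 0; first by rewrite invr0 nrm0 invr0.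
apply: (mulfI (x := nrm x)); first by rewrite nrm_eq0.
by rewrite -nrmM !mulfV ?nrm1 // nrm_eq0.
Qed.

Lemma real_rQ x : cj x = x -> exists q, x = rQ m q.
Proof.
have [a [b Dx]] := coordP x; rewrite {1}Dx cjD cjM cj_s !cj_rQ => e.
exists a; have : (x + x) = rQ m a + rQ m a.
  by rewrite -{1}e Dx; ring.
by move=> h; apply: (mulfI (natE_neq0 1)); ring: h.
Qed.

Lemma cjO x : (cj x \in O) = (x \in O).
Proof.
suff h z : z \in O -> cj z \in O.
  by apply/idP/idP => [/h|/h //]; rewrite QconjK.
by rewrite !inE /= Aint_aut.
Qed.

Lemma rQ_O q : (rQ m q \in O) = (q \is a Num.int).
Proof.
rewrite -[LHS]/(val (rQ m q) \in Aint) val_rQ; apply/idP/idP => [h|/intrP[n ->]].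
  by rewrite -Cint_rat Cint_rat_Aint ?Crat_rat.
by rewrite rmorph_int Aint_int.
Qed.

Lemma nrm_int x : x \in O -> nrm x \is a Num.int.
Proof. by move=> xO; rewrite -rQ_O nrmE rpredM ?cjO. Qed.

Lemma nrm_nat x : x \in O -> exists n : nat, nrm x = n%:R.
Proof.
by move=> xO; apply/natrP; rewrite -intrEge0 ?nrm_ge0 ?nrm_int.
Qed.

Lemma real_int x : x \in O -> cj x = x -> exists n : int, x = n%:~R.
Proof.
move=> xO /real_rQ[q Dq]; move: xO; rewrite Dq rQ_O => /intrP[n ->].
by exists n; rewrite rmorph_int.
Qed.

Lemma trace_int x : x \in O -> exists n : int, x + cj x = n%:~R.
Proof.
by move=> xO; apply: real_int; rewrite ?rpredD ?cjO // cjD QconjK addrC.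
Qed.

Lemma quadratic_O x (t n : int) :
  x + cj x = t%:~R -> x * cj x = n%:~R -> x \in O.
Proof.
move=> Dt Dn; rewrite inE /=.
pose p : {poly algC} := 'X^2 - t%:~R%:P * 'X + n%:~R%:P.
have Dp : p = Poly [:: n%:~R; - t%:~R; 1].
  rewrite /p; apply/polyP=> i; rewrite coef_Poly !coefE.
  by case: i => [|[|[|i]]] /=; rewrite ?(mulr1, mulr0, oppr0, subr0, sub0r, add0r, addr0, nth_nil).

have sp : p = [:: n%:~R; - t%:~R; 1] :> seq _.
  by rewrite Dp (PolyK (c := 0)) //= oner_eq0.
apply: (@root_monic_Aint p).
- have e : val x ^+ 2 - t%:~R * val x + n%:~R = 0.
    rewrite -!(rmorph_int (val : E -> algC)) -Dt -Dn -rmorphXn -rmorphM.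
    rewrite -rmorphB -rmorphD -[RHS](rmorph0 (val : E -> algC)).
    by congr (val _); ring.
  by rewrite /root /p !hornerE; apply/eqP.
- by rewrite monicE lead_coefE sp.
- by apply/polyOverP=> i; rewrite sp; case: i => [|[|[|i]]] /=;
    rewrite ?rpredN ?rpred_int ?rpred1 ?nth_nil ?rpred0.
Qed.

Lemma coord_O (p q : int) : (4 %| p * p + m%:Z * q * q)%Z ->
  rQ m (p%:~R / 2) + rQ m (q%:~R / 2) * s \in O.
Proof.
move=> /dvdzP[n Dn]; apply: (@quadratic_O _ p n).
  rewrite cjD cjM cj_s !cj_rQ -(rmorph_int (rQ m)).
  transitivity (rQ m (p%:~R / 2 + p%:~R / 2)); first by rewrite rmorphD /=; ring.
  by congr (rQ m _); field.
rewrite -nrmE (nrm_coord (erefl _)) -(rmorph_int (rQ m)); congr (rQ m _).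
have : (p * p + m%:Z * q * q)%:~R = (n * 4)%:~R :> rat by rewrite Dn.
rewrite !rmorphD !rmorphM /= => h.
have -> : (m%:R : rat) = m%:Z%:~R by [].
by lra.
Qed.

(** For x = a + b s, the trace shows that 2 a is an integer; then m (2 b)^2 = 4 N(x) - (2 a)^2 is
    one, so the squared denominator of 2 b divides m and squarefreeness makes it 1. *)
Lemma Ocoord x : squarefree m -> (0 < m)%N -> x \in O ->
  exists p q : int, [/\ x = rQ m (p%:~R / 2) + rQ m (q%:~R / 2) * s,
    (4 %| p * p + m%:Z * q * q)%Z & nrm x = (p * p + m%:Z * q * q)%:~R / 4].
Proof.
move=> sqf m0 xO; have [a [b Dx]] := coordP x.
have [n Dn] := nrm_nat xO; have Dn' := nrm_coord Dx; rewrite Dn in Dn'.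
have [p Dp] := trace_int xO.
have {}Dp : a = p%:~R / 2.
  have : 2 * a = p%:~R.
    apply: rQ_inj; rewrite !rmorphM /= !rmorph_int -Dp rmorph_nat Dx cjD cjM cj_s !cj_rQ.
    by ring.
  by lra.
have [q Dq] : exists q : int, b = q%:~R / 2.
  suff : (2 * b) \is a Num.int by case/intrP => q h; exists q; lra.
  set c := 2 * b; have hc : m%:R * c ^+ 2 = (4 * n%:Z - p * p)%:~R :> rat.
    rewrite rmorphB !rmorphM /= /c; have -> : (n%:Z%:~R : rat) = n%:R by [].
    by rewrite Dn' Dp; field.
  have d0 : (denq c)%:~R != 0 :> rat by rewrite intr_eq0 denq_eq0.
  have hd : m%:Z * (numq c * numq c) = (4 * n%:Z - p * p) * (denq c * denq c).
    apply/eqP; rewrite -(eqr_int rat) !rmorphM /= -hc.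
    rewrite -{3}(divq_num_den c); apply/eqP; have -> : (m%:Z%:~R : rat) = m%:R by [].
    by field.
  have : (`|denq c| ^ 2 %| m)%N.
    rewrite -(@Gauss_dvdl _ _ (`|numq c| ^ 2)); last first.
      by rewrite coprimeXl // coprimeXr // coprime_sym coprime_num_den.
    have := congr1 (fun z => `|z|%N) hd; rewrite !abszM absz_nat !mulnn => ->.
    exact: dvdn_mull.
  move/sqf => e; rewrite Qint_def; have := denq_gt0 c; move: e; lia.
exists p, q; rewrite Dx Dp Dq; split=> //.
  apply/dvdzP; exists n%:Z; apply/eqP; rewrite -(eqr_int rat) !rmorphD !rmorphM /=.
  have -> : (n%:Z%:~R : rat) = n%:R by [].
  have -> : (m%:Z%:~R : rat) = m%:R by [].
  by apply/eqP; rewrite Dn' Dp Dq; field.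
rewrite (nrm_coord (erefl _)) !rmorphD !rmorphM /=.
have -> : (m%:Z%:~R : rat) = m%:R by [].
by field.
Qed.

End Scalars.

(** Strong induction on the value, with excluded middle at each stage because [P] is any
    proposition. Prime divisors, greatest common divisors, reduced bases and bases of binary
    lattices are all found as minima of this kind. *)
Lemma exists_min (T : Type) (P : T -> Prop) (f : T -> rat) :
    (forall x, P x -> f x \is a Num.nat) -> (exists x, P x) ->
  exists x, P x /\ forall y, P y -> f x <= f y.
Proof.
move=> fN [x0 Px0]; have /natrP[n] := fN _ Px0.
elim/ltn_ind: n x0 Px0 => n IH x Px Dx.
have [[y Py lt_yx]|no] := classic (exists2 y, P y & f y < f x).
  have /natrP[k Dk] := fN _ Py; apply: (IH k _ y) => //.
  by move: lt_yx; rewrite Dx Dk ltr_nat.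
exists x; split=> // y Py; rewrite leNgt; apply/negP=> lt_yx.
by apply: no; exists y.
Qed.

(** Pigeonhole: for odd p and 0 <= x, y <= (p - 1)/2, the values x^2 and k - d y^2 form two sets of
    (p + 1)/2 residues each, so they meet. *)
Lemma sum_two_squares_modp (p k d : nat) : prime p -> ~~ (p %| d)%N ->
  exists x y : nat, x ^ 2 + d * y ^ 2 = k %[mod p].
Proof.
move=> pp pd; have p0 := prime_gt0 pp.
have [p2|podd] := even_prime pp.
  exists (odd k : nat), 0%N; rewrite exp0n // muln0 addn0 p2 !modn2.
  by case: (odd k).
have cF : #|'F_p| = p by rewrite card_Fp.
have chF := pchar_Fp pp.
have dF : d%:R != 0 :> 'F_p by rewrite -(dvdn_pcharf chF).
pose h (i : 'I_p./2.+1) : 'F_p := i%:R ^+ 2.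
have h_inj : injective h.
  move=> i j /eqP; rewrite /h eqf_sqr => eij; apply: val_inj => /=.
  have hp : (p = p./2.*2 + 1)%N by rewrite -{1}(odd_double_half p) podd addnC.
  have [li lj] := (ltn_ord i, ltn_ord j).
  case/orP: eij => [|]; last first.
    rewrite -subr_eq0 opprK -natrD -(dvdn_pcharf chF) => /dvdnP[[|q]]; nia.
  wlog le_ij : i j li lj / (i <= j)%N => [W|].
    have [/W|/ltnW/W] := leqP i j; first by apply.
    by rewrite [_%:R == _]eq_sym => h1 /h1 ->.
  rewrite eq_sym -subr_eq0 -natrB // -(dvdn_pcharf chF) => /dvdnP[[|q]]; nia.
pose g j : 'F_p := k%:R - d%:R * h j.
have g_inj : injective g by move=> i j /addrI/oppr_inj/(mulfI dF)/h_inj.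
have [/eqP|[z]] := set_0Vmem ([set h x | x : 'I_p./2.+1] :&: [set g x | x : 'I_p./2.+1]).
  rewrite setI_eq0 => dis; have /eqP := cardsU [set h x | x : 'I_p./2.+1] [set g x | x : 'I_p./2.+1].
  rewrite disjoint_setI0 // cards0 subn0 !card_imset // !card_ord => /eqP e.
  have := max_card ([set h x | x : 'I_p./2.+1] :|: [set g x | x : 'I_p./2.+1]).
  have hp : (p = p./2.*2 + 1)%N by rewrite -{1}(odd_double_half p) podd addnC.
  rewrite e cF; lia.
rewrite inE => /andP[/imsetP[x _ ->] /imsetP[y _ e]].
exists x, y; have : (x ^ 2 + d * y ^ 2)%:R = k%:R :> 'F_p.
  by rewrite natrD natrM !natrX -[_ ^+ 2]/(h x) e /g subrK.
by move/(congr1 val); rewrite /= !val_Fp_nat.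
Qed.

(** * Prime elements and Euclidean division *)

Section Arith.
Variable m : nat.
Local Notation E := (QsqrtN m).
Local Notation O := (ring_of_integers m).
Local Notation cj := (@Qconj m).
Local Notation s := (sqrtN m).
Implicit Types x y a b : E.

Lemma sO : s \in O.
Proof.
apply: (@quadratic_O _ _ 0 m%:Z); first by rewrite cj_s subrr.
by rewrite cj_s mulrN s_sqr opprK.
Qed.

Lemma nat_O n : n%:R \in O. Proof. exact: rpred_nat. Qed.
Lemma int_O (n : int) : n%:~R \in O. Proof. exact: rpred_int. Qed.

Lemma unit_inv_O x : x \in O -> nrm x = 1 -> x^-1 \in O.
Proof.
move=> xO nx; suff -> : x^-1 = cj x by rewrite cjO.
have x0 : x != 0 by rewrite -nrm_eq0 nx oner_eq0.
by apply: (mulfI x0); rewrite mulfV // -nrmE nx rmorph1.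
Qed.

Lemma nrm_natP x : x \in O -> nrm x \is a Num.nat.
Proof. by move=> /nrm_nat[n ->]; rewrite natr_nat. Qed.

Lemma nrm_ge1 x : x \in O -> x != 0 -> 1 <= nrm x.
Proof.
move=> xO; rewrite -nrm_gt0; have [n ->] := nrm_nat xO.
by rewrite ltr0n ler1n.
Qed.

(** Irreducibility, units being the elements of norm 1; it implies primality ([prime_mul]) once
    division with remainder is available. *)
Definition prime_elt x := [/\ x \in O, x != 0, nrm x <> 1
  & forall a b, a \in O -> b \in O -> x = a * b -> nrm a = 1 \/ nrm b = 1].

(** A divisor of least norm among those that are not units cannot factor further. *)
Lemma prime_divisor x : x \in O -> x != 0 -> nrm x <> 1 ->
  exists2 p, prime_elt p & x / p \in O.
Proof.
move=> xO x0 nx.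
pose P (p : E) := [/\ p \in O, nrm p <> 1, p != 0 & x / p \in O].
have [||p [[pO np p0 xp] pmin]] := @exists_min _ P (@nrm m).
- by move=> p [/nrm_natP].
- by exists x; split; rewrite // divff ?rpred1.
exists p => //; split=> // a b aO bO Dp.
have [na|/eqP na] := eqVneq (nrm a) 1; [by left | right].
have [a0 b0] : a != 0 /\ b != 0 by apply/andP; rewrite -negb_or -mulf_eq0 -Dp.
have : nrm p <= nrm a.
  apply: pmin; split=> //.
  have -> : x / a = x / p * b by rewrite Dp divr_mulK.
  exact: rpredM.
rewrite Dp nrmM; have := nrm_ge1 bO b0; have := nrm_ge1 aO a0; nra.
Qed.

Section Euclid.
Hypothesis euc : forall x, exists2 q, q \in O & nrm (x - q) < 1.

(** The nonzero combination [g] of least norm divides every combination, since a nonzero remainder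
    modulo [g] would be a smaller one. *)
Lemma bezout x y : x \in O -> y \in O -> y != 0 ->
  exists u v, [/\ u \in O, v \in O, u * x + v * y != 0,
    x / (u * x + v * y) \in O & y / (u * x + v * y) \in O].
Proof.
move=> xO yO y0.
pose P (g : E) := g != 0 /\ exists u v, [/\ u \in O, v \in O & g = u * x + v * y].
have PO (g : E) : P g -> g \in O.
  by move=> [_ [u [v [uO vO ->]]]]; rewrite rpredD ?rpredM.
have [||g [[g0 [u [v [uO vO Dg]]]] gmin]] := @exists_min _ P (@nrm m).
- by move=> g /PO/nrm_natP.
- exists y; split=> //; exists 0, 1; split; rewrite ?rpred0 ?rpred1 //.
  by rewrite mul0r mul1r add0r.
have dv (z : E) : (exists u v, [/\ u \in O, v \in O & z = u * x + v * y]) -> z / g \in O.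
  move=> [u1 [v1 [u1O v1O Dz]]]; have [q qO lt1] := euc (z / g).
  suff : z / g - q = 0 by move/(canRL (subrK _)); rewrite add0r => ->.
  have [//|nz] := eqVneq (z / g - q) 0.
  have : nrm g <= nrm (z - q * g).
    apply: gmin; split.
      by have -> : z - q * g = (z / g - q) * g; [rewrite mulrBl divfK | rewrite mulf_neq0].
    exists (u1 - q * u), (v1 - q * v); split; try by rewrite rpredB ?rpredM.
    by rewrite Dz Dg; ring.
  have -> : z - q * g = (z / g - q) * g by rewrite mulrBl divfK.
  by rewrite nrmM leNgt gtr_pMl ?nrm_gt0 // lt1.
exists u, v; rewrite -Dg; split=> //; apply: dv.
  by exists 1, 0; rewrite rpred0 rpred1 mul1r mul0r addr0.
by exists 0, 1; rewrite rpred0 rpred1 mul1r mul0r add0r.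
Qed.

Lemma prime_inv p x : prime_elt p -> x \in O -> x / p \notin O ->
  exists2 y, y \in O & (x * y - 1) / p \in O.
Proof.
move=> [pO p0 np pp] xO xp.
have [u [v [uO vO]]] := bezout xO pO p0.
set g := _ + _ => g0 xg pg.
have gO : g \in O by rewrite rpredD ?rpredM.
have Dp : p = g * (p / g) by rewrite mulrC divfK.
have ng : nrm g = 1.
  have [//|npg] := pp _ _ gO pg Dp; case/negP: xp.
  have -> : x / p = (x / g) * (p / g)^-1 by exact: divr_ratio.
  by rewrite rpredM // unit_inv_O.
have gV := unit_inv_O gO ng.
exists (u / g); first by rewrite rpredM.
have -> : (x * (u / g) - 1) / p = - v / g by exact: bezout_quotient.
by rewrite rpredM ?rpredN.
Qed.

Lemma prime_mul p x y : prime_elt p -> x \in O -> y \in O ->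
  x * y / p \in O -> x / p \in O \/ y / p \in O.
Proof.
move=> pp xO yO xyp; have [|xp] := boolP (x / p \in O); [by left | right].
have [_ p0 _ _] := pp.
have [z zO h] := prime_inv pp xO xp.
have -> : y / p = z * (x * y / p) - y * ((x * z - 1) / p) by field.
by apply: rpredB; apply: rpredM.
Qed.

(* The only obstruction to [N(pi) | r] when [pi | r] is that [pi] is inert. *)
Lemma prime_rational p (r : int) : prime_elt p -> r%:~R / p \in O ->
    r%:~R / nrm p \isn't a Num.int ->
  exists t : nat, [/\ prime_elt t%:R, t%:R / p \in O & p / t%:R \in O].
Proof.
move=> [pO p0 np pp] rp; set c := r%:~R / nrm p => cZ.
have n0 : nrm p != 0 by rewrite nrm_eq0.
have hc : rQ m c * cj p \in O.
  have -> : rQ m c * cj p = r%:~R / p; last by [].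
  rewrite /c rmorphM fmorphV /= nrmE rmorph_int.
  by rewrite divr_mulK // cj_eq0.
have [t Dt] : exists t : nat, denq c = t%:Z.
  by exists `|denq c|%N; rewrite gez0_abs ?denq_ge0.
have t1 : (1 < t)%N.
  by move: cZ; rewrite Qint_def Dt; move: (denq_gt0 c); rewrite Dt; case: (t) => [|[]].
have t0 : t%:R != 0 :> E by case: (t) t1 => // ? _; apply: natE_neq0.
have [u [v Duv]] : exists u v : int, u * numq c + v * t%:Z = 1.
  have : coprimez (numq c) t%:Z by rewrite -Dt /coprimez -[gcdz _ _]/(_%:Z) (eqP (coprime_num_den c)).
  by move/coprimezP => [[u v] /= e]; exists u, v.
(* [t] > 1 is the denominator of c = r / N(p). Both c * cj p = r / p and cj p are integral, so 1 = u
   numq c + v t shows that [t] divides [cj p], and hence [p]. *)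
have hp : cj p / t%:R \in O.
  have -> : cj p / t%:R = u%:~R * (rQ m c * cj p) + v%:~R * cj p.
    have -> : rQ m c = (numq c)%:~R / t%:R.
      by rewrite -{1}(divq_num_den c) Dt rmorphM fmorphV /= !rmorph_int.
    have : (u * numq c + v * t%:Z)%:~R = 1 :> E by rewrite Duv.
    rewrite rmorphD !rmorphM /= => h.
    apply: (mulIf t0); rewrite divfK //; move: (divfK t0 (numq c)%:~R) h.
    by move: (_ / _) => w <-; rewrite -pmulrn => h; rewrite -[LHS]mulr1 -{1}h; ring.
  by apply: rpredD; apply: rpredM; rewrite ?int_O ?cjO.
have hpt : p / t%:R \in O by rewrite -cjO cjM cjV cjn.
have Dp : p = t%:R * (p / t%:R) by field.
have nt : nrm (t%:R : E) <> 1.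
  rewrite nrmn => /eqP; rewrite sqrf_eq1 => /orP[/eqP h|/eqP h].
    by have : (t%:R : rat) <> 1%:R; [apply/eqP; rewrite eqr_nat; lia | rewrite h].
  by have := ler0n rat t; rewrite h.
have nh : nrm (p / t%:R) = 1 by have [/nt|] := pp _ _ (nat_O t) hpt Dp.
have tp : t%:R / p \in O by rewrite -[_ / _]invf_div unit_inv_O.
exists t; split=> //; split=> //; first exact: nat_O.
move=> a b aO bO Dab; have := pp (a * (p / t%:R)) b; rewrite nrmM nh mulr1.
by apply=> //; [rewrite rpredM | rewrite mulrAC -Dab mulrC divfK].
Qed.

Lemma prime_elt_nat (t : nat) : prime_elt (t%:R) -> prime t.
Proof.
move=> [_ t0 nt pt].
have n1 (a : nat) : nrm (a%:R : E) = 1 -> a = 1%N.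
  by rewrite nrmn -natrX => /eqP; rewrite pnatr_eq1; case: a => [|[|a]].
have t1 : t != 1%N by apply/eqP => e; apply: nt; rewrite e nrm1.
have t2 : t != 0%N by apply: contraNneq t0 => ->.
apply/primeP; split; first by move: t1 t2; case: (t) => [|[]].
move=> d /dvdnP[e De].
have := pt e%:R d%:R (nat_O _) (nat_O _); rewrite De natrM => /(_ erefl)[/n1->|/n1->].
  by rewrite mul1n eqxx orbT.
by rewrite eqxx.
Qed.

Lemma dvd_nat_O (t : nat) (k : int) : t != 0%N -> (k%:~R / t%:R \in O) = (t %| `|k|)%N.
Proof.
move=> t0; have tE : t%:R != 0 :> E by case: (t) t0 => // ? _; apply: natE_neq0.
apply/idP/idP.
  rewrite -[k%:~R](rmorph_int (rQ m)) -[t%:R](rmorph_nat (rQ m)) -fmorphV -rmorphM /= rQ_O.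
  move=> /intrP[q Dq]; have : k%:~R = (q * t%:Z)%:~R :> rat.
    rewrite rmorphM /= -Dq; have -> : (t%:Z%:~R : rat) = t%:R by [].
    by rewrite divfK // pnatr_eq0.
  by move/eqP; rewrite eqr_int => /eqP->; rewrite abszM absz_nat dvdn_mull.
rewrite -[t]absz_nat -[(_ %| _)%N]/(_ %| _)%Z => /dvdzP[q ->].
by rewrite rmorphM /= mulfK ?int_O.
Qed.

Hypothesis (sqf : squarefree m) (m0 : (0 < m)%N).

(** If t divided m, it would divide s^2 and hence s, and the integer N(s / t) = m / t^2 would
    contradict squarefreeness. *)
Lemma inert_coprime (t : nat) : prime_elt (t%:R) -> ~~ (t %| m)%N.
Proof.
move=> tp; have pt := prime_elt_nat tp; have [_ t0 _ _] := tp.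
apply/negP=> /dvdnP[q Dq].
have st : s / t%:R \in O.
  have mE : m%:R = q%:R * t%:R :> E by rewrite -natrM; congr (_%:R).
  have h : s * s / t%:R \in O by rewrite s_sqr mulNr mE mulfK // rpredN nat_O.
  by have [] := prime_mul tp sO sO h.
have := nrm_int st; rewrite nrmM nrmV nrmn (@nrm_coord _ 0 1); last first.
  by rewrite rmorph0 rmorph1 mul1r add0r.
rewrite expr0n expr1n add0r mulr1 => /intrP[k].
have tq : t%:R != 0 :> rat by rewrite pnatr_eq0 -lt0n prime_gt0.
move=> h; have : m%:R = k%:~R * t%:R ^+ 2 :> rat by rewrite -h divfK ?expf_neq0.
rewrite -natrX -[(t ^ 2)%N%:R]/((t ^ 2)%N%:Z%:~R) -[m%:R]/(m%:Z%:~R) -rmorphM /=.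
move/eqP; rewrite eqr_int => /eqP e.
have t1 : t = 1%N by apply: sqf; rewrite -[m]absz_nat e abszM absz_nat dvdn_mull.
by rewrite t1 in pt.
Qed.

Lemma nrm_surj_modp (t : nat) (k : int) : prime_elt (t%:R) ->
  exists a n, a \in O /\ nrm a = (k + t%:Z * n)%:~R.
Proof.
move=> tp; have pt := prime_elt_nat tp; have cm := inert_coprime tp.
have t0 := prime_gt0 pt.
have [x [y hxy]] := sum_two_squares_modp `|(k %% t%:Z)%Z|%N pt cm.
exists (x%:R + y%:R * s).
have : (x ^ 2 + m * y ^ 2)%N%:Z = k %[mod t%:Z]%Z.
  by rewrite modz_nat hxy -modz_nat gez0_abs ?modz_mod // modz_ge0; lia.
move/eqP; rewrite eqz_mod_dvd => /dvdzP[n Dn].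
exists n; split; first by rewrite rpredD ?rpredM ?sO ?nat_O.
rewrite (@nrm_coord _ x%:R y%:R); last by rewrite !rmorph_nat.
have -> : k + t%:Z * n = (x ^ 2 + m * y ^ 2)%N%:Z by move: Dn; lia.
by rewrite -[RHS]/((x ^ 2 + m * y ^ 2)%N%:R) natrD natrM !natrX.
Qed.

(** Completing the square: k1 times the expression is N(k1 a + cj b) - (N(b) - k1 k2). So a0 is
    chosen with norm N(b) - k1 k2 modulo t, and k1 a + cj b = a0 is solved for a, with u the inverse
    of k1 modulo t. *)
Lemma isotropic_modp (t : nat) (k1 k2 : int) b : prime_elt (t%:R) -> b \in O ->
    k1%:~R / t%:R \notin O ->
  exists2 a, a \in O & (k2%:~R + a * cj a * k1%:~R + (a * b + cj (a * b))) / t%:R \in O.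
Proof.
move=> tp bO k1t; have pt := prime_elt_nat tp; have [_ t0 _ _] := tp.
have [u [v Duv]] : exists u v : int, u * k1 + v * t%:Z = 1.
  have : coprimez k1 t%:Z.
    rewrite coprimezE absz_nat coprime_sym prime_coprime //.
    by rewrite -dvd_nat_O // -lt0n prime_gt0.
  by move/coprimezP => [[u v] /= e]; exists u, v.
have [nb Dnb] := intrP (nrm_int bO).
have [a0 [n [aO Dn]]] := nrm_surj_modp (nb - k1 * k2) tp.
exists (u%:~R * (a0 - cj b)); first by rewrite rpredM ?rpredB ?int_O ?cjO.
have e1 : a0 * cj a0 = (nb - k1 * k2)%:~R + t%:R * n%:~R.
  by rewrite -nrmE Dn rmorph_int rmorphD rmorphM.
have e2 : b * cj b = nb%:~R by rewrite -nrmE Dnb rmorph_int.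
have e3 : u%:~R * k1%:~R = 1 - v%:~R * t%:R :> E.
  have : (u * k1 + v * t%:Z)%:~R = 1 :> E by rewrite Duv.
  by rewrite rmorphD !rmorphM /= -pmulrn => /(canRL (addrK _)).
have -> : (k2%:~R + u%:~R * (a0 - cj b) * cj (u%:~R * (a0 - cj b)) * k1%:~R +
  (u%:~R * (a0 - cj b) * b + cj (u%:~R * (a0 - cj b) * b))) / t%:R =
  k2%:~R * v%:~R + u%:~R * n%:~R - v%:~R * u%:~R * ((a0 - cj b) * cj (a0 - cj b)).
  apply: (mulIf t0); rewrite divfK // !(cjM, cjB, QconjK, cjz).
  move: e1; rewrite rmorphB rmorphM /= => e1.
  move: e1 e2 e3; move: (u%:~R) (k1%:~R) (k2%:~R) (v%:~R) (nb%:~R) (n%:~R) (t%:R) => U K1 K2 V NB N T.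
  move=> /eqP; rewrite -subr_eq0 => /eqP e1 /eqP; rewrite -subr_eq0 => /eqP e2 /eqP.
  rewrite -subr_eq0 => /eqP e3; apply/eqP; rewrite -subr_eq0; apply/eqP.
  transitivity ((U * ((a0 - cj b) * (cj a0 - b)) - K2) * (U * K1 - (1 - V * T))
    + U * (a0 * cj a0 - (NB - K1 * K2 + T * N)) - U * (b * cj b - NB)); first by ring.
  by rewrite e1 e2 e3 !mulr0 subr0 addr0.
rewrite rpredB ?rpredD ?rpredM ?int_O ?cjO ?rpredB ?cjO //.
Qed.

End Euclid.
End Arith.

(** * Radicals modulo a prime *)

Section Divisibility.
Variable m : nat.
Local Notation E := (QsqrtN m).
Local Notation O := (ring_of_integers m).
Implicit Types x y p a b : E.

Definition dvO p x := x / p \in O.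

Lemma dvO0 p : dvO p 0. Proof. by rewrite /dvO mul0r rpred0. Qed.
Lemma dvOD p x y : dvO p x -> dvO p y -> dvO p (x + y).
Proof. by rewrite /dvO mulrDl; apply: rpredD. Qed.
Lemma dvON p x : dvO p (- x) = dvO p x.
Proof. by rewrite /dvO mulNr rpredN. Qed.
Lemma dvOB p x y : dvO p x -> dvO p y -> dvO p (x - y).
Proof. by rewrite /dvO mulrBl; apply: rpredB. Qed.
Lemma dvOMl p a x : a \in O -> dvO p x -> dvO p (a * x).
Proof. by rewrite /dvO -mulrA; apply: rpredM. Qed.
Lemma dvOMr p a x : a \in O -> dvO p x -> dvO p (x * a).
Proof. by rewrite mulrC; apply: dvOMl. Qed.

Hypothesis euc : forall x, exists2 q, q \in O & nrm (x - q) < 1.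

Section PrimeKernel.
Variable p : E.
Hypothesis pp : prime_elt p.

Lemma dvO_prime x y : x \in O -> y \in O ->
  ~~ dvO p x -> ~~ dvO p y -> ~~ dvO p (x * y).
Proof.
by move=> xO yO px py; apply/negP=> /(prime_mul euc pp xO yO)[]; apply/negP.
Qed.

(** The rows (a, b, c) that annihilate the matrix modulo [p]; for a Gram matrix they are the
    coordinates of the vectors in the radical modulo [p]. *)
Definition kernel3 (r11 r12 r13 r21 r22 r23 r31 r32 r33 a b c : E) :=
  [/\ [/\ a \in O, b \in O & c \in O], dvO p (a * r11 + b * r21 + c * r31),
    dvO p (a * r12 + b * r22 + c * r32) & dvO p (a * r13 + b * r23 + c * r33)].

Definition det3 (r11 r12 r13 r21 r22 r23 r31 r32 r33 : E) :=
  r11 * r22 * r33 + r12 * r23 * r31 + r13 * r21 * r32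
  - r11 * r23 * r32 - r12 * r21 * r33 - r13 * r22 * r31.

(** Elimination without division. The [u]'s are the 2x2 minors through the pivot; the row built from
    them kills two columns exactly, and the remaining one gives r11 D up to sign because u22 u33 -
    u23 u32 = r11 D. If u22 and u23 both vanish modulo [p], the first two rows are already
    proportional. *)
Lemma kernel3_pivot r11 r12 r13 r21 r22 r23 r31 r32 r33 :
    [/\ r11 \in O, r12 \in O & r13 \in O] ->
    [/\ r21 \in O, r22 \in O & r23 \in O] ->
    [/\ r31 \in O, r32 \in O & r33 \in O] ->
    dvO p (det3 r11 r12 r13 r21 r22 r23 r31 r32 r33) -> ~~ dvO p r11 ->
  exists a b c, kernel3 r11 r12 r13 r21 r22 r23 r31 r32 r33 a b c /\
    (~~ dvO p b || ~~ dvO p c).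
Proof.
move=> [O11 O12 O13] [O21 O22 O23] [O31 O32 O33] dD n11.
set D := det3 _ _ _ _ _ _ _ _ _ in dD.
have minorO u v w z : u \in O -> v \in O -> w \in O -> z \in O -> u * v - w * z \in O.
  by move=> *; rewrite rpredB ?rpredM.
pose u22 := r11 * r22 - r21 * r12; pose u23 := r11 * r23 - r21 * r13.
pose u32 := r11 * r32 - r31 * r12; pose u33 := r11 * r33 - r31 * r13.
have [Ou22 Ou23 Ou32 Ou33] : [/\ u22 \in O, u23 \in O, u32 \in O & u33 \in O].
  by split; apply: minorO.
have [d22|n22] := boolP (dvO p u22); last first.
  exists (- u32 * r21 + u22 * r31), (u32 * r11), (- u22 * r11); split; last first.
    by apply/orP; right; rewrite mulNr dvON dvO_prime.
  split; first by rewrite rpredD ?rpredM ?rpredN.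
  - by rewrite [X in dvO p X](_ : _ = 0) ?dvO0 //; ring.
  - by rewrite [X in dvO p X](_ : _ = 0) ?dvO0 // /u22 /u32; ring.
  rewrite [X in dvO p X](_ : _ = - r11 * D); last by rewrite /D /det3 /u22 /u32; ring.
  by rewrite dvOMl ?rpredN.
have [d23|n23] := boolP (dvO p u23).
  exists (- r21), r11, 0; split; last by rewrite n11.
  split; first by rewrite rpredN rpred0.
  - by rewrite [X in dvO p X](_ : _ = 0) ?dvO0 //; ring.
  - by rewrite [X in dvO p X](_ : _ = u22) // /u22; ring.
  - by rewrite [X in dvO p X](_ : _ = u23) // /u23; ring.
exists (- u33 * r21 + u23 * r31), (u33 * r11), (- u23 * r11); split; last first.
  by apply/orP; right; rewrite mulNr dvON dvO_prime.
split; first by rewrite rpredD ?rpredM ?rpredN.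
- by rewrite [X in dvO p X](_ : _ = 0) ?dvO0 //; ring.
- rewrite [X in dvO p X](_ : _ = r11 * D); last by rewrite /D /det3 /u23 /u33; ring.
  exact: dvOMl.
by rewrite [X in dvO p X](_ : _ = 0) ?dvO0 // /u23 /u33; ring.
Qed.

Lemma kernel3_row r11 r12 r13 r21 r22 r23 r31 r32 r33 :
    [/\ r11 \in O, r12 \in O & r13 \in O] ->
    [/\ r21 \in O, r22 \in O & r23 \in O] ->
    [/\ r31 \in O, r32 \in O & r33 \in O] ->
    dvO p (det3 r11 r12 r13 r21 r22 r23 r31 r32 r33) ->
    ~~ [&& dvO p r11, dvO p r12 & dvO p r13] ->
  exists a b c, kernel3 r11 r12 r13 r21 r22 r23 r31 r32 r33 a b c /\
    (~~ dvO p b || ~~ dvO p c).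
Proof.
move=> [O11 O12 O13] [O21 O22 O23] [O31 O32 O33] dD.
rewrite !negb_and => /or3P[n|n|n].
- exact: kernel3_pivot.
- have [//|//|//||//|a [b [c [[h h1 h2 h3] h4]]]] := @kernel3_pivot r12 r11 r13 r22 r21 r23 r32 r31 r33.
    by rewrite [X in dvO p X](_ : _ = - det3 r11 r12 r13 r21 r22 r23 r31 r32 r33) ?dvON // /det3; ring.
  by exists a, b, c.
have [//|//|//||//|a [b [c [[h h1 h2 h3] h4]]]] := @kernel3_pivot r13 r11 r12 r23 r21 r22 r33 r31 r32.
  by rewrite [X in dvO p X](_ : _ = det3 r11 r12 r13 r21 r22 r23 r31 r32 r33) // /det3; ring.
by exists a, b, c.
Qed.

(** A kernel row that is nonzero in the residue field can be scaled. Making one coefficient exactly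
    1, rather than 1 modulo [p], turns the vector into a member of a basis, which is what allows it
    to be divided. *)
Lemma kernel3_exists r11 r12 r13 r21 r22 r23 r31 r32 r33 :
    [/\ r11 \in O, r12 \in O & r13 \in O] ->
    [/\ r21 \in O, r22 \in O & r23 \in O] ->
    [/\ r31 \in O, r32 \in O & r33 \in O] ->
    dvO p (det3 r11 r12 r13 r21 r22 r23 r31 r32 r33) ->
  exists a b c, kernel3 r11 r12 r13 r21 r22 r23 r31 r32 r33 a b c /\
    [\/ a = 1, b = 1 | c = 1].
Proof.
move=> O1 O2 O3 dD.
have [a [b [c [[[aO bO cO] h1 h2 h3] h]]]] : exists a b c,
    kernel3 r11 r12 r13 r21 r22 r23 r31 r32 r33 a b c /\
    [\/ ~~ dvO p a, ~~ dvO p b | ~~ dvO p c].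
  have [/and3P[d1 d2 d3]|n1] := boolP [&& dvO p r11, dvO p r12 & dvO p r13].
    have [pO p0 np _] := pp.
    exists 1, 0, 0; split; last first.
      constructor 1; apply/negP=> h; apply: np.
      have : nrm (1 / p) \is a Num.nat by rewrite nrm_natP.
      rewrite mul1r nrmV => /natrP[k hk]; have [n hn] := nrm_nat pO.
      have : nrm p * (nrm p)^-1 = 1 by rewrite divff // nrm_eq0.
      rewrite hk hn -natrM => /eqP; rewrite pnatr_eq1 muln_eq1 => /andP[/eqP-> _].
      by [].
    by split; rewrite ?rpred0 ?rpred1 // mul1r !mul0r !addr0.
  have [a [b [c [h1 /orP h2]]]] := kernel3_row O1 O2 O3 dD n1.
  by exists a, b, c; split=> //; case: h2 => ?; [constructor 2|constructor 3].
have [[O11 O12 O13] [O21 O22 O23] [O31 O32 O33]] := And3 O1 O2 O3.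
case: h => n.
- have [y yO hy] := prime_inv euc pp aO n.
  exists 1, (y * b), (y * c); split; last by constructor 1.
  have sh r1 r2 r3 : r1 \in O -> dvO p (a * r1 + b * r2 + c * r3) ->
      dvO p (1 * r1 + y * b * r2 + y * c * r3).
    move=> r1O hr; rewrite [X in dvO p X](_ : _ = y * (a * r1 + b * r2 + c * r3)
      - (a * y - 1) * r1); last by ring.
    by apply: dvOB; [apply: dvOMl | apply: dvOMr].
  by split; [split; rewrite ?rpred1 ?rpredM | exact: sh..].
- have [y yO hy] := prime_inv euc pp bO n.
  exists (y * a), 1, (y * c); split; last by constructor 2.
  have sh r1 r2 r3 : r2 \in O -> dvO p (a * r1 + b * r2 + c * r3) ->
      dvO p (y * a * r1 + 1 * r2 + y * c * r3).
    move=> r1O hr; rewrite [X in dvO p X](_ : _ = y * (a * r1 + b * r2 + c * r3)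
      - (b * y - 1) * r2); last by ring.
    by apply: dvOB; [apply: dvOMl | apply: dvOMr].
  by split; [split; rewrite ?rpred1 ?rpredM | exact: sh..].
have [y yO hy] := prime_inv euc pp cO n.
exists (y * a), (y * b), 1; split; last by constructor 3.
have sh r1 r2 r3 : r3 \in O -> dvO p (a * r1 + b * r2 + c * r3) ->
    dvO p (y * a * r1 + y * b * r2 + 1 * r3).
  move=> r1O hr; rewrite [X in dvO p X](_ : _ = y * (a * r1 + b * r2 + c * r3)
    - (c * y - 1) * r3); last by ring.
  by apply: dvOB; [apply: dvOMl | apply: dvOMr].
by split; [split; rewrite ?rpred1 ?rpredM | exact: sh..].
Qed.

End PrimeKernel.
End Divisibility.

(** * Ternary lattices and their overlattices *)

Section Herm.
Variables (m : nat) (V : hermSpace m).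
Local Notation E := (QsqrtN m).
Local Notation O := (ring_of_integers m).
Local Notation cj := (@Qconj m).
Local Notation H := (hform V).
Implicit Types (x y z v : V) (a b c : E).

Lemma HDl x y z : H (x + y) z = H x z + H y z. Proof. exact: linearDl. Qed.
Lemma HDr x y z : H x (y + z) = H x y + H x z. Proof. exact: linearDr. Qed.
Lemma HBl x y z : H (x - y) z = H x z - H y z. Proof. exact: linearBl. Qed.
Lemma HBr x y z : H x (y - z) = H x y - H x z. Proof. exact: linearBr. Qed.
Lemma HNl x z : H (- x) z = - H x z. Proof. exact: linearNl. Qed.
Lemma HNr x z : H x (- z) = - H x z. Proof. exact: linearNr. Qed.
Lemma HZl a x y : H (a *: x) y = a * H x y. Proof. exact: linearZl_LR. Qed.
Lemma HZr a x y : H x (a *: y) = cj a * H x y. Proof. exact: linearZr_LR. Qed.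
Lemma H0l y : H 0 y = 0. Proof. exact: linear0l. Qed.
Lemma H0r y : H y 0 = 0. Proof. exact: linear0r. Qed.
Lemma HC x y : H x y = cj (H y x).
Proof. by rewrite (@hermC _ _ (@Qconj m)) /= expr0 mul1r. Qed.

Definition HE := (HDl, HDr, HBl, HBr, HNl, HNr, HZl, HZr, H0l, H0r).

Definition hn v : rat := getCrat (val (H v v)).

Lemma hnE v : H v v = rQ m (hn v).
Proof.
have [q Dq] := real_rQ (esym (HC v v)).
by rewrite /hn Dq val_rQ ratCK.
Qed.

Lemma hn_uniq v q : H v v = rQ m q -> hn v = q.
Proof. by rewrite hnE => /rQ_inj. Qed.

Lemma hnZ a v : hn (a *: v) = nrm a * hn v.
Proof. by apply: hn_uniq; rewrite !HE rmorphM /= nrmE -hnE; ring. Qed.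

Lemma val_hn v : (0 < val (H v v)) = (0 < hn v).
Proof. by rewrite hnE val_rQ ltr0q. Qed.

Definition cb3 x1 x2 x3 a b c : V := a *: x1 + b *: x2 + c *: x3.

Lemma cb3D x1 x2 x3 a b c a' b' c' :
  cb3 x1 x2 x3 a b c + cb3 x1 x2 x3 a' b' c' = cb3 x1 x2 x3 (a + a') (b + b') (c + c').
Proof. by rewrite /cb3 !scalerDl addrACA; congr (_ + _); rewrite addrACA. Qed.

Lemma cb3Z x1 x2 x3 k a b c :
  k *: cb3 x1 x2 x3 a b c = cb3 x1 x2 x3 (k * a) (k * b) (k * c).
Proof. by rewrite /cb3 !scalerDr !scalerA. Qed.

Lemma cb3_1 x1 x2 x3 : x1 = cb3 x1 x2 x3 1 0 0.
Proof. by rewrite /cb3 scale1r !scale0r !addr0. Qed.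
Lemma cb3_2 x1 x2 x3 : x2 = cb3 x1 x2 x3 0 1 0.
Proof. by rewrite /cb3 scale1r !scale0r add0r addr0. Qed.
Lemma cb3_3 x1 x2 x3 : x3 = cb3 x1 x2 x3 0 0 1.
Proof. by rewrite /cb3 scale1r !scale0r !add0r. Qed.

Lemma Hcb3l x1 x2 x3 a b c y :
  H (cb3 x1 x2 x3 a b c) y = a * H x1 y + b * H x2 y + c * H x3 y.
Proof. by rewrite /cb3 !HE. Qed.
Lemma Hcb3r x1 x2 x3 a b c y :
  H y (cb3 x1 x2 x3 a b c) = cj a * H y x1 + cj b * H y x2 + cj c * H y x3.
Proof. by rewrite /cb3 !HE. Qed.

Definition span3 x1 x2 x3 v := exists a b c,
  [/\ a \in O, b \in O, c \in O & v = cb3 x1 x2 x3 a b c].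

Definition integral3 x1 x2 x3 :=
  [/\ [/\ H x1 x1 \in O, H x1 x2 \in O & H x1 x3 \in O],
      [/\ H x2 x1 \in O, H x2 x2 \in O & H x2 x3 \in O] &
      [/\ H x3 x1 \in O, H x3 x2 \in O & H x3 x3 \in O]].

Definition gdet x1 x2 x3 :=
  det3 (H x1 x1) (H x1 x2) (H x1 x3) (H x2 x1) (H x2 x2) (H x2 x3)
       (H x3 x1) (H x3 x2) (H x3 x3).

(** The lattice of the [y]'s is the larger one. *)
Definition refines y1 y2 y3 x1 x2 x3 :=
  [/\ span3 y1 y2 y3 x1, span3 y1 y2 y3 x2 & span3 y1 y2 y3 x3].

Lemma span3_trans y1 y2 y3 x1 x2 x3 v :
  refines y1 y2 y3 x1 x2 x3 -> span3 x1 x2 x3 v -> span3 y1 y2 y3 v.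
Proof.
move=> [[a1 [b1 [c1 [? ? ? e1]]]] [a2 [b2 [c2 [? ? ? e2]]]]].
move=> [a3 [b3 [c3 [? ? ? e3]]]] [a [b [c [? ? ? ->]]]].
exists (a * a1 + b * a2 + c * a3), (a * b1 + b * b2 + c * b3),
  (a * c1 + b * c2 + c * c3).
split; try by rewrite !rpredD ?rpredM.
by rewrite {1}/cb3 e1 e2 e3 !cb3Z !cb3D.
Qed.

Lemma refines_trans y1 y2 y3 x1 x2 x3 z1 z2 z3 :
  refines z1 z2 z3 y1 y2 y3 -> refines y1 y2 y3 x1 x2 x3 ->
  refines z1 z2 z3 x1 x2 x3.
Proof. by move=> h [h1 h2 h3]; split; apply: (span3_trans h). Qed.

Lemma span3_1 x1 x2 x3 : span3 x1 x2 x3 x1.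
Proof. by exists 1, 0, 0; rewrite -cb3_1 rpred0 rpred1. Qed.
Lemma span3_2 x1 x2 x3 : span3 x1 x2 x3 x2.
Proof. by exists 0, 1, 0; rewrite -cb3_2 rpred0 rpred1. Qed.
Lemma span3_3 x1 x2 x3 : span3 x1 x2 x3 x3.
Proof. by exists 0, 0, 1; rewrite -cb3_3 rpred0 rpred1. Qed.

Lemma refines_refl x1 x2 x3 : refines x1 x2 x3 x1 x2 x3.
Proof. by split; [apply: span3_1 | apply: span3_2 | apply: span3_3]. Qed.

Lemma refines_swap12 x1 x2 x3 : refines x1 x2 x3 x2 x1 x3.
Proof. by split; [apply: span3_2 | apply: span3_1 | apply: span3_3]. Qed.
Lemma refines_swap13 x1 x2 x3 : refines x1 x2 x3 x3 x2 x1.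
Proof. by split; [apply: span3_3 | apply: span3_2 | apply: span3_1]. Qed.
Lemma refines_swap23 x1 x2 x3 : refines x1 x2 x3 x1 x3 x2.
Proof. by split; [apply: span3_1 | apply: span3_3 | apply: span3_2]. Qed.

Lemma integral_swap12 x1 x2 x3 : integral3 x1 x2 x3 -> integral3 x2 x1 x3.
Proof. by case=> [[? ? ?] [? ? ?] [? ? ?]]. Qed.
Lemma integral_swap13 x1 x2 x3 : integral3 x1 x2 x3 -> integral3 x3 x2 x1.
Proof. by case=> [[? ? ?] [? ? ?] [? ? ?]]. Qed.
Lemma integral_swap23 x1 x2 x3 : integral3 x1 x2 x3 -> integral3 x1 x3 x2.
Proof. by case=> [[? ? ?] [? ? ?] [? ? ?]]. Qed.

Lemma gdet_swap12 x1 x2 x3 : gdet x2 x1 x3 = gdet x1 x2 x3.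
Proof. by rewrite /gdet /det3; ring. Qed.
Lemma gdet_swap13 x1 x2 x3 : gdet x3 x2 x1 = gdet x1 x2 x3.
Proof. by rewrite /gdet /det3; ring. Qed.
Lemma gdet_swap23 x1 x2 x3 : gdet x1 x3 x2 = gdet x1 x2 x3.
Proof. by rewrite /gdet /det3; ring. Qed.

Lemma gdet_shear x1 x2 x3 b c : gdet (cb3 x1 x2 x3 1 b c) x2 x3 = gdet x1 x2 x3.
Proof. by rewrite /gdet /det3 !(Hcb3l, Hcb3r) cj1; ring. Qed.

Lemma gdet_scale x1 x2 x3 a : gdet (a *: x1) x2 x3 = a * cj a * gdet x1 x2 x3.
Proof. by rewrite /gdet /det3 !HE; ring. Qed.

(** Having coefficient 1 at [x1], [v] may replace it in the basis without changing the determinant;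
    dividing by [q] then divides the determinant by N(q). The self-product of v / q is H(v, v) /
    N(q), hence the stronger divisibility required of H(v, v). *)
Lemma overlattice_fst x1 x2 x3 b c q (v := cb3 x1 x2 x3 1 b c) :
    integral3 x1 x2 x3 -> b \in O -> c \in O -> q \in O -> q != 0 ->
    dvO q (H v x2) -> dvO q (H v x3) -> dvO (q * cj q) (H v v) ->
  [/\ integral3 (q^-1 *: v) x2 x3, refines (q^-1 *: v) x2 x3 x1 x2 x3 &
      q * cj q * gdet (q^-1 *: v) x2 x3 = gdet x1 x2 x3].
Proof.
move=> [[O11 O12 O13] [O21 O22 O23] [O31 O32 O33]] bO cO qO q0 d2 d3 dv.
have i2 : H (q^-1 *: v) x2 \in O by rewrite HZl mulrC.
have i3 : H (q^-1 *: v) x3 \in O by rewrite HZl mulrC.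
split.
- have ivv : H (q^-1 *: v) (q^-1 *: v) \in O.
    rewrite HZl HZr cjV [X in X \in _](_ : _ = H v v / (q * cj q)) //.
    by rewrite invfM mulrA mulrC.
  by split; split=> //; rewrite HC cjO.
- split; [|exact: span3_2|exact: span3_3].
  exists q, (- b), (- c); rewrite !rpredN; split=> //.
  rewrite {1}/cb3 scalerA divff // scale1r /v.
  by rewrite /cb3 scale1r !scaleNr addrAC !addrK.
rewrite gdet_scale gdet_shear cjV; field; rewrite cj_eq0 q0 //.
Qed.

Definition has_one a b c := [\/ a = 1, b = 1 | c = 1].

(* The larger lattice is obtained by adjoining [v / q], as [v] is part of a basis. *)
Lemma overlattice x1 x2 x3 a b c q (v := cb3 x1 x2 x3 a b c) :
    integral3 x1 x2 x3 -> [/\ a \in O, b \in O & c \in O] -> has_one a b c ->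
    q \in O -> q != 0 ->
    [/\ dvO q (H v x1), dvO q (H v x2) & dvO q (H v x3)] ->
    dvO (q * cj q) (H v v) ->
  exists y1 y2 y3, [/\ integral3 y1 y2 y3, refines y1 y2 y3 x1 x2 x3 &
      q * cj q * gdet y1 y2 y3 = gdet x1 x2 x3].
Proof.
move=> ix [aO bO cO] h1 qO q0 [d1 d2 d3] dv.
case: h1 => e.
- exists (q^-1 *: v), x2, x3; rewrite /v e in d1 d2 d3 dv *.
  exact: overlattice_fst.
- have Dv : v = cb3 x2 x1 x3 1 a c by rewrite /v /cb3 e [_ + 1 *: _]addrC.
  have [||//|//|//|//|//||i r g] := @overlattice_fst x2 x1 x3 a c q; rewrite -?Dv //.
    exact: integral_swap12.
  exists (q^-1 *: v), x1, x3; rewrite Dv g gdet_swap12; split=> //.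
  exact: refines_trans r (refines_swap12 _ _ _).
have Dv : v = cb3 x3 x2 x1 1 b a.
  by rewrite /v /cb3 e [LHS]addrC addrA [in LHS]addrAC.
have [||//|//|//|//|//||i r g] := @overlattice_fst x3 x2 x1 b a q; rewrite -?Dv //.
  exact: integral_swap13.
exists (q^-1 *: v), x2, x1; rewrite Dv g gdet_swap13; split=> //.
exact: refines_trans r (refines_swap13 _ _ _).
Qed.

End Herm.

(** * Enlarging a ternary lattice at one prime *)

Section Descent.
Variables (m : nat) (V : hermSpace m).
Local Notation E := (QsqrtN m).
Local Notation O := (ring_of_integers m).
Local Notation cj := (@Qconj m).
Local Notation H := (hform V).
Implicit Types (x y z v : V) (a b c d : E).
Hypothesis euc : forall a, exists2 q, q \in O & nrm (a - q) < 1.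
Hypothesis (sqf : squarefree m) (m0 : (0 < m)%N).

Lemma dvOM2 p q a b : dvO p a -> dvO q b -> dvO (p * q) (a * b).
Proof. by rewrite /dvO => h1 h2; rewrite invfM mulrACA rpredM. Qed.

Lemma dvO_nat_cj (t : nat) a : dvO t%:R (cj a) = dvO t%:R a.
Proof. by rewrite /dvO -[LHS]cjO cjM cjV cjn QconjK. Qed.

(** Let H(x1, x1) = t k1 with t not dividing k1. In the determinant, all terms other than H(x1, x1)
    D are divisible by t^2, and so is the total; hence t divides the determinant D of the block of
    x2, x3. This block has its own radical vector y, with H(y, y) = t k2, and H(a x1 + y, a x1 + y)
    / t is the expression that [isotropic_modp] makes divisible by t. *)
Lemma inert_step (t c : nat) (e : E) x1 x2 x3 :
    prime_elt (t%:R : E) -> e \in O -> integral3 x1 x2 x3 ->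
    gdet x1 x2 x3 = c%:R * ((t%:R * e) * cj (t%:R * e)) ->
    [/\ dvO t%:R (H x1 x1), dvO t%:R (H x1 x2) & dvO t%:R (H x1 x3)] ->
    ~~ dvO (t%:R * t%:R) (H x1 x1) ->
  exists y1 y2 y3, [/\ integral3 y1 y2 y3, refines y1 y2 y3 x1 x2 x3 &
      t%:R * cj t%:R * gdet y1 y2 y3 = gdet x1 x2 x3].
Proof.
move=> tp eO ix Dg [d11 d12 d13] nd11; have [_ t0 nt _] := tp.
have [[O11 O12 O13] [O21 O22 O23] [O31 O32 O33]] := ix.
have d21 : dvO t%:R (H x2 x1) by rewrite HC dvO_nat_cj.
have d31 : dvO t%:R (H x3 x1) by rewrite HC dvO_nat_cj.
have [k1 Dk1] : exists k : int, H x1 x1 = t%:R * k%:~R.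
  have [|k Dk] := @real_int m (H x1 x1 / t%:R) d11.
    by rewrite cjM -HC cjV cjn.
  by exists k; rewrite -Dk mulrC divfK.
have nk1 : k1%:~R / t%:R \notin O.
  by apply: contra nd11; rewrite /dvO Dk1 -mulf_div divff // mul1r.
pose D := H x2 x2 * H x3 x3 - H x2 x3 * H x3 x2.
have OD : D \in O by rewrite rpredB ?rpredM.
have dD : dvO t%:R D.
  have h : dvO (t%:R * t%:R) (H x1 x1 * D).
    have -> : H x1 x1 * D = gdet x1 x2 x3
       - (H x1 x2 * H x3 x1) * H x2 x3 - (H x1 x3 * H x2 x1) * H x3 x2
       + (H x1 x2 * H x2 x1) * H x3 x3 + (H x1 x3 * H x3 x1) * H x2 x2.
      by rewrite /gdet /det3 /D; ring.
    apply: dvOD; last by apply: dvOMr => //; apply: dvOM2.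
    apply: dvOD; last by apply: dvOMr => //; apply: dvOM2.
    apply: dvOB; last by apply: dvOMr => //; apply: dvOM2.
    apply: dvOB; last by apply: dvOMr => //; apply: dvOM2.
    rewrite Dg cjM cjn /dvO.
    have -> : c%:R * (t%:R * e * (t%:R * cj e)) / (t%:R * t%:R) = c%:R * (e * cj e).
      by field.
    by rewrite !rpredM ?cjO ?nat_O.
  move: h; rewrite /dvO Dk1 -mulrA -mulf_div divff // mul1r => h.
  by have [h1|//] := prime_mul euc tp (int_O _ _) OD h; rewrite h1 in nk1.
(* The 2x2 block is bordered by a 1 to reuse the 3x3 lemma: the last coefficient [f] is then
   divisible by [t], so the coefficient equal to 1 is [b] or [c']. *)
have [||||b [c' [f [[[bO cO fO] h1 h2 h3] h4]]]] :=
   @kernel3_exists m euc t%:R tp (H x2 x2) (H x2 x3) 0 (H x3 x2) (H x3 x3) 0 0 0 1.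
- by rewrite rpred0.
- by rewrite rpred0.
- by rewrite rpred0 rpred1.
- by rewrite [X in dvO _ X](_ : _ = D) // /det3 /D; ring.
move: h1 h2 h3; rewrite !mulr0 !addr0 add0r mulr1 => h1 h2 h3.
have {h4 h3 f fO} hbc : b = 1 \/ c' = 1.
  case: h4 => [||e1]; [by left | by right |].
  have := dvO_nat_cj; rewrite e1 /dvO mul1r in h3.
  case: nt; have [k Dk] := nrm_nat h3; have [n Dn] := nrm_nat (nat_O m t).
  have : nrm (t%:R : E) * nrm (t%:R^-1 : E) = 1 by rewrite -nrmM divff // nrm1.
  by rewrite Dk Dn -natrM => /eqP; rewrite pnatr_eq1 muln_eq1 => /andP[/eqP-> _].
have {h1} h1 : dvO t%:R (H (cb3 x1 x2 x3 0 b c') x2).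
  by rewrite Hcb3l mul0r add0r.
have {h2} h2 : dvO t%:R (H (cb3 x1 x2 x3 0 b c') x3).
  by rewrite Hcb3l mul0r add0r.
set y := cb3 x1 x2 x3 0 b c' in h1 h2.
have h3 : dvO t%:R (H y x1).
  by rewrite Hcb3l mul0r add0r; apply: dvOD; apply: dvOMl.
have hyy : dvO t%:R (H y y).
  rewrite {2}/y Hcb3r; apply: dvOD; [apply: dvOD|]; apply: dvOMl => //;
  by rewrite cjO ?rpred0.
have [k2 Dk2] : exists k : int, H y y = t%:R * k%:~R.
  have [|k Dk] := @real_int m (H y y / t%:R) hyy.
    by rewrite cjM -HC cjV cjn.
  by exists k; rewrite -Dk mulrC divfK.
have h4 : H x1 y / t%:R \in O by rewrite HC -/(dvO _ _) dvO_nat_cj.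
have [a aO ha] := isotropic_modp euc sqf m0 k2 tp h4 nk1.
have Dz : cb3 x1 x2 x3 a b c' = a *: x1 + y by rewrite /y /cb3 scale0r add0r addrA.
clearbody y.
apply: (@overlattice _ _ x1 x2 x3 a b c' t%:R) => //.
- by case: hbc => ?; [constructor 2 | constructor 3].
- exact: nat_O.
- by rewrite Dz !HDl !HZl; split; apply: dvOD => //; apply: dvOMl.
rewrite Dz !(HDl, HDr, HZl, HZr) cjn.
rewrite [X in dvO _ X](_ : _ = t%:R * (k2%:~R + a * cj a * k1%:~R
    + (a * (H x1 y / t%:R) + cj (a * (H x1 y / t%:R))))).
  by rewrite /dvO -mulf_div divff // mul1r.
rewrite cjM cjM cjV cjn -HC Dk1 Dk2; move: t0 (H x1 y) (H y x1).
move: (t%:R : E) (k1%:~R : E) (k2%:~R : E) => T K1 K2 t0 h h'.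
by field.
Qed.

(** Let [v] be in the radical modulo a prime p dividing d, and r = H(v, v). If N(p) divides r, then
    v / p is adjoined. Otherwise p is an associate of a rational prime t whose square does not
    divide r, and [inert_step] applies to a basis that begins with v. *)
Lemma descent_step (c : nat) (d : E) x1 x2 x3 :
    d \in O -> d != 0 -> nrm d <> 1 -> integral3 x1 x2 x3 ->
    gdet x1 x2 x3 = c%:R * (d * cj d) ->
  exists d' y1 y2 y3, [/\ [/\ d' \in O, d' != 0 & nrm d' < nrm d],
    integral3 y1 y2 y3, refines y1 y2 y3 x1 x2 x3 &
    gdet y1 y2 y3 = c%:R * (d' * cj d')].
Proof.
move=> dO d0 nd ix Dg.
have [p pp dp] := prime_divisor dO d0 nd; have [pO p0 np _] := pp.
have finish q : q \in O -> q != 0 -> nrm q <> 1 -> d / q \in O ->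
    (exists y1 y2 y3, [/\ integral3 y1 y2 y3, refines y1 y2 y3 x1 x2 x3 &
      q * cj q * gdet y1 y2 y3 = gdet x1 x2 x3]) ->
  exists d' y1 y2 y3, [/\ [/\ d' \in O, d' != 0 & nrm d' < nrm d],
    integral3 y1 y2 y3, refines y1 y2 y3 x1 x2 x3 &
    gdet y1 y2 y3 = c%:R * (d' * cj d')].
  move=> qO q0 nq dq [y1 [y2 [y3 [i r g]]]].
  exists (d / q), y1, y2, y3; split=> //.
    split=> //; first by rewrite mulf_neq0 ?invr_eq0.
    rewrite nrmM nrmV gtr_pMr ?nrm_gt0 // invf_lt1 ?nrm_gt0 //.
    by rewrite lt_neqAle nrm_ge1 // andbT eq_sym; apply/eqP.
  apply: (mulfI (x := q * cj q)); first by rewrite mulf_neq0 ?cj_eq0.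
  by rewrite g Dg cjM cjV; apply: quotient_norm; rewrite ?cj_eq0.
have [[O11 O12 O13] [O21 O22 O23] [O31 O32 O33]] := ix.
have [||||a [b [e [[[aO bO eO] h1 h2 h3] h4]]]] :=
   @kernel3_exists m euc p pp (H x1 x1) (H x1 x2) (H x1 x3)
     (H x2 x1) (H x2 x2) (H x2 x3) (H x3 x1) (H x3 x2) (H x3 x3) => //.
  rewrite -/(gdet x1 x2 x3) Dg; apply: dvOMl; first exact: nat_O.
  by apply: dvOMr => //; rewrite cjO.
rewrite -!Hcb3l in h1 h2 h3; set v := cb3 x1 x2 x3 a b e in h1 h2 h3.
have dvv : dvO p (H v v).
  by rewrite {2}/v Hcb3r; apply: dvOD; [apply: dvOD|]; apply: dvOMl => //; rewrite cjO.
have Ovv : H v v \in O by have := dvOMl pO dvv; rewrite /dvO mulrAC divff // mul1r.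
have [r Dr] := real_int Ovv (esym (HC v v)).
have [rZ|rZ] := boolP (r%:~R / nrm p \is a Num.int).
  apply: (finish p) => //; apply: (@overlattice _ _ x1 x2 x3 a b e p) => //.
  by rewrite -/v /dvO Dr -nrmE -[r%:~R](rmorph_int (rQ m)) -fmorph_div rQ_O.
rewrite Dr in dvv.
have [t [tp tdp pdt]] := prime_rational pp dvv rZ; have [tO t0 nt _] := tp.
have dt : d / t%:R \in O.
  have -> : d / t%:R = (d / p) * (p / t%:R) by exact: divr_chain.
  exact: rpredM.
have tr w : dvO p w -> dvO t%:R w.
  move=> h; have -> : w = w / p * (p / t%:R) * t%:R by exact: divr_sandwich.
  by rewrite /dvO mulfK // rpredM.
have nvv : ~~ dvO (t%:R * t%:R) (H v v).
  apply: contra rZ; rewrite Dr => h; rewrite -(@rQ_O m) fmorph_div rmorph_int /= nrmE.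
  have -> : r%:~R / (p * cj p) = r%:~R / (t%:R * t%:R) * ((t%:R / p) * cj (t%:R / p)).
    by rewrite cjM cjV cjn; apply: divr_norm_ratio; rewrite ?cj_eq0.
  by apply: rpredM => //; apply: rpredM; rewrite ?cjO.
apply: (finish t%:R) => //.
have Dg' : gdet x1 x2 x3 = c%:R * (t%:R * (d / t%:R) * cj (t%:R * (d / t%:R))).
  by rewrite Dg mulrC [t%:R * _]mulrC divfK // mulrC.
have first_case w1 w2 w3 b' e' : integral3 w1 w2 w3 ->
    gdet w1 w2 w3 = gdet x1 x2 x3 -> b' \in O -> e' \in O ->
    v = cb3 w1 w2 w3 1 b' e' -> dvO p (H v w2) -> dvO p (H v w3) ->
    refines w1 w2 w3 x1 x2 x3 ->
    exists y1 y2 y3, [/\ integral3 y1 y2 y3, refines y1 y2 y3 x1 x2 x3 &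
      t%:R * cj t%:R * gdet y1 y2 y3 = gdet x1 x2 x3].
  move=> iw gw b'O e'O Dv d2 d3 rw.
  (* With q = 1 this is a mere change of basis that puts [v] first. *)
  have [|||i r' g] := @overlattice_fst _ _ w1 w2 w3 b' e' 1 iw b'O e'O (rpred1 _) (oner_neq0 _).
  - by rewrite -Dv /dvO divr1; have := dvOMl pO d2; rewrite /dvO mulrAC divff // mul1r.
  - by rewrite -Dv /dvO divr1; have := dvOMl pO d3; rewrite /dvO mulrAC divff // mul1r.
  - by rewrite -Dv /dvO cj1 mulr1 divr1.
  rewrite -Dv invr1 scale1r cj1 !mul1r in i r' g.
  have [|||y1 [y2 [y3 [iy ry gy]]]] := @inert_step t c (d / t%:R) v w2 w3 tp dt i.
  - by rewrite g gw.
  - by split; apply: tr => //; rewrite Dr.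
  - by [].
  exists y1, y2, y3; split=> //; last by rewrite gy g gw.
  exact: refines_trans ry (refines_trans r' rw).
case: h4 => e1.
- apply: (first_case x1 x2 x3 b e) => //; last exact: refines_refl.
  by rewrite /v e1.
- apply: (first_case x2 x1 x3 a e) => //; try exact: refines_swap12.
  + by apply: integral_swap12 || apply: gdet_swap12.
  by rewrite /v /cb3 e1 [_ + 1 *: _]addrC.
apply: (first_case x3 x2 x1 b a) => //; try exact: refines_swap13.
+ by apply: integral_swap13 || apply: gdet_swap13.
by rewrite /v /cb3 e1 [LHS]addrC addrA [in LHS]addrAC.
Qed.

Theorem descent (c : nat) (d : E) x1 x2 x3 :
    d \in O -> d != 0 -> integral3 x1 x2 x3 ->
    gdet x1 x2 x3 = c%:R * (d * cj d) ->
  exists y1 y2 y3, [/\ integral3 y1 y2 y3, refines y1 y2 y3 x1 x2 x3 &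
    gdet y1 y2 y3 = c%:R].
Proof.
move=> dO; have [n Dn] := nrm_nat dO.
elim/ltn_ind: n d dO Dn x1 x2 x3 => n IH d dO Dn x1 x2 x3 d0 ix Dg.
have [nd|/eqP nd] := eqVneq (nrm d) 1.
  exists x1, x2, x3; split=> //; first exact: refines_refl.
  by rewrite Dg -nrmE nd rmorph1 mulr1.
have [d' [y1 [y2 [y3 [[d'O d'0 lt] iy ry gy]]]]] := descent_step dO d0 nd ix Dg.
have [k Dk] := nrm_nat d'O.
have ltk : (k < n)%N by move: lt; rewrite Dn Dk ltr_nat.
have [z1 [z2 [z3 [iz rz gz]]]] := IH k ltk d' d'O Dk y1 y2 y3 d'0 iy gy.
by exists z1, z2, z3; split=> //; apply: refines_trans rz ry.
Qed.

End Descent.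

(** * Hermite reduction *)

Section Reduction.
Variables (m : nat) (V : hermSpace m).
Local Notation E := (QsqrtN m).
Local Notation O := (ring_of_integers m).
Local Notation cj := (@Qconj m).
Local Notation H := (hform V).
Implicit Types (x y z v : V) (a b c d : E).
Hypothesis posd : forall v, v != 0 -> 0 < hn v.

(** For nonzero determinant, inclusion and equal determinants force equality, so these are the bases
    of one and the same lattice. *)
Definition superlattice x1 x2 x3 y1 y2 y3 :=
  [/\ integral3 y1 y2 y3, refines y1 y2 y3 x1 x2 x3 &
      gdet y1 y2 y3 = gdet x1 x2 x3].

Lemma superlattice_refl x1 x2 x3 :
  integral3 x1 x2 x3 -> superlattice x1 x2 x3 x1 x2 x3.
Proof. by split=> //; apply: refines_refl. Qed.

Lemma superlattice_swap12 x1 x2 x3 y1 y2 y3 :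
  superlattice x1 x2 x3 y1 y2 y3 -> superlattice x1 x2 x3 y2 y1 y3.
Proof.
move=> [i r g]; split; first exact: integral_swap12.
  exact: refines_trans (refines_swap12 _ _ _) r.
by rewrite gdet_swap12.
Qed.

Lemma superlattice_swap23 x1 x2 x3 y1 y2 y3 :
  superlattice x1 x2 x3 y1 y2 y3 -> superlattice x1 x2 x3 y1 y3 y2.
Proof.
move=> [i r g]; split; first exact: integral_swap23.
  exact: refines_trans (refines_swap23 _ _ _) r.
by rewrite gdet_swap23.
Qed.

Lemma superlattice_shear1 x1 x2 x3 y1 y2 y3 b c : b \in O -> c \in O ->
  superlattice x1 x2 x3 y1 y2 y3 ->
  superlattice x1 x2 x3 (y1 + b *: y2 + c *: y3) y2 y3.
Proof.
move=> bO cO [i r g].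
have iv y : H (cb3 y1 y2 y3 1 b c) y = H y1 y + b * H y2 y + c * H y3 y.
  by rewrite Hcb3l mul1r.
have [[? ? ?] [? ? ?] [? ? ?]] := i.
have [|||] := @overlattice_fst _ _ y1 y2 y3 b c 1 i bO cO (rpred1 _) (oner_neq0 _).
- by rewrite /dvO divr1 iv !rpredD ?rpredM.
- by rewrite /dvO divr1 iv !rpredD ?rpredM.
- rewrite /dvO cj1 mulr1 divr1 iv !Hcb3r cj1 !mul1r.
  by rewrite !(rpredD, rpredM) ?cjO.
rewrite invr1 scale1r cj1 !mul1r /cb3 scale1r => i' r' g'.
by split; rewrite ?g' //; apply: refines_trans r' r.
Qed.

Lemma superlattice_shear2 x1 x2 x3 y1 y2 y3 q : q \in O ->
  superlattice x1 x2 x3 y1 y2 y3 ->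
  superlattice x1 x2 x3 y1 (y2 - q *: y1) y3.
Proof.
move=> qO /superlattice_swap12 h; apply: superlattice_swap12.
have nqO : - q \in O by rewrite rpredN.
by have := superlattice_shear1 nqO (rpred0 _) h; rewrite scale0r addr0 scaleNr.
Qed.

Lemma superlattice_shear31 x1 x2 x3 y1 y2 y3 q : q \in O ->
  superlattice x1 x2 x3 y1 y2 y3 ->
  superlattice x1 x2 x3 y1 y2 (y3 - q *: y1).
Proof.
move=> qO /superlattice_swap23 h; apply: superlattice_swap23.
exact: superlattice_shear2.
Qed.

Lemma superlattice_shear32 x1 x2 x3 y1 y2 y3 q : q \in O ->
  superlattice x1 x2 x3 y1 y2 y3 ->
  superlattice x1 x2 x3 y1 y2 (y3 - q *: y2).
Proof.
move=> qO /superlattice_swap12 h; apply: superlattice_swap12.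
exact: superlattice_shear31.
Qed.

(** The form on the projections orthogonal to [y1], times H(y1, y1) to keep its values integral;
    [proj_norm] is also the Gram determinant of [y1], [y]. *)
Definition proj_form y1 y z : E := H y1 y1 * H y z - H y y1 * H y1 z.
Definition proj_norm y1 y : rat := hn y1 * hn y - nrm (H y y1).

Lemma proj_normE y1 y : rQ m (proj_norm y1 y) = proj_form y1 y y.
Proof. by rewrite /proj_norm rmorphB rmorphM /= nrmE -!hnE -HC. Qed.

Lemma proj_form_shearl y1 y z q : proj_form y1 (y - q *: y1) z = proj_form y1 y z.
Proof. by rewrite /proj_form !HE; ring. Qed.
Lemma proj_form_shearr y1 y z q : proj_form y1 y (z - q *: y1) = proj_form y1 y z.
Proof. by rewrite /proj_form !HE; ring. Qed.
Lemma proj_norm_shear y1 y q : proj_norm y1 (y - q *: y1) = proj_norm y1 y.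
Proof. by apply: (@rQ_inj m); rewrite !proj_normE proj_form_shearl proj_form_shearr. Qed.

Lemma proj_formC y1 y z : cj (proj_form y1 y z) = proj_form y1 z y.
Proof. by rewrite /proj_form cjB !cjM -!HC mulrC [X in _ - X]mulrC mulrC. Qed.

(** The Desnanot-Jacobi identity for the Gram determinant. *)
Lemma gdet_proj y1 y2 y3 :
  H y1 y1 * gdet y1 y2 y3 = proj_form y1 y2 y2 * proj_form y1 y3 y3
    - proj_form y1 y2 y3 * proj_form y1 y3 y2.
Proof. by rewrite /gdet /det3 /proj_form; ring. Qed.

Lemma gdet_eq0 y2 y3 : gdet 0 y2 y3 = 0.
Proof. by rewrite /gdet /det3 !HE; ring. Qed.

Lemma hn_gt0_gdet y1 y2 y3 : gdet y1 y2 y3 != 0 -> 0 < hn y1.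
Proof. by move=> g; apply: posd; apply: contraNneq g => ->; rewrite gdet_eq0. Qed.

(** [u] is the component of [y2] orthogonal to [y1]; it is nonzero because replacing [y2] by it
    preserves the determinant. *)
Lemma proj_norm_gt0 y1 y2 y3 : gdet y1 y2 y3 != 0 -> 0 < proj_norm y1 y2.
Proof.
move=> g; have a0 := hn_gt0_gdet g.
have h0 : H y1 y1 != 0 by rewrite hnE fmorph_eq0 gt_eqF.
pose u := cb3 y2 y1 y3 1 (- (H y2 y1 / H y1 y1)) 0.
have gu : gdet u y1 y3 != 0 by rewrite gdet_shear gdet_swap12.
have -> : proj_norm y1 y2 = hn y1 * hn u.
  apply: (@rQ_inj m); rewrite proj_normE rmorphM /= -!hnE /proj_form.
  rewrite Hcb3l !Hcb3r cjN cjM cjV -!HC cj0 cj1; field.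
  exact: h0.
by rewrite mulr_gt0 // (hn_gt0_gdet gu).
Qed.

Lemma hn_nat v : H v v \in O -> hn v \is a Num.nat.
Proof.
rewrite hnE rQ_O => h; rewrite -intrEge0 //.
have [->|/posd/ltW//] := eqVneq v 0; rewrite (@hn_uniq _ _ _ 0) //.
by rewrite H0l rmorph0.
Qed.

Section Reduced.
Variables (rho : rat) (D : nat).
Hypothesis euc : forall a, exists2 q, q \in O & nrm (a - q) <= rho.

Lemma approx (h : E) (k : rat) : 0 < k ->
  exists2 q, q \in O & nrm (h - q * rQ m k) <= rho * k ^+ 2.
Proof.
move=> k0; have [q qO hq] := euc (h / rQ m k); exists q => //.
have k0' : rQ m k != 0 by rewrite fmorph_eq0 gt_eqF.
have -> : h - q * rQ m k = (h / rQ m k - q) * rQ m k by rewrite mulrBl divfK.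
by rewrite nrmM nrm_rQ ler_wpM2r // sqr_ge0.
Qed.

(** [hn y1] is minimized over all bases, then [proj_norm y1 y2] over those with this [hn y1]; the
    inequalities between norms come from comparison with permuted bases. The third vector is rounded
    against the second before any rounding along [y1], since shears along [y1] leave [proj_form] and
    [proj_norm] alone. The final equation is [gdet_proj]. *)
Lemma reduced_triple x1 x2 x3 : integral3 x1 x2 x3 ->
    gdet x1 x2 x3 = D%:R -> (0 < D)%N ->
  exists y1 y2 y3, superlattice x1 x2 x3 y1 y2 y3 /\
    [/\ [/\ 0 < hn y1, hn y1 <= hn y2 & hn y1 <= hn y3],
      nrm (H y2 y1) <= rho * hn y1 ^+ 2, nrm (H y3 y1) <= rho * hn y1 ^+ 2,
      nrm (proj_form y1 y3 y2) <= rho * proj_norm y1 y2 ^+ 2 &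
      [/\ 0 < proj_norm y1 y2, proj_norm y1 y2 <= proj_norm y1 y3 &
      proj_norm y1 y2 * proj_norm y1 y3 - nrm (proj_form y1 y3 y2) = hn y1 * D%:R]].
Proof.
move=> ix Dg D0.
pose P1 (y : V * V * V) := superlattice x1 x2 x3 y.1.1 y.1.2 y.2.
have gN y1 y2 y3 : superlattice x1 x2 x3 y1 y2 y3 -> gdet y1 y2 y3 != 0.
  by move=> [_ _ ->]; rewrite Dg; case: (D) D0 => // ? _; apply: natE_neq0.
have [||[[y1 y2] y3] [P1y min1]] := @exists_min _ P1 (fun y : V * V * V => hn y.1.1).
- by move=> [[z1 z2] z3] [/= [[? _ _] _ _] _ _]; apply: hn_nat.
- by exists (x1, x2, x3); apply: superlattice_refl.
pose P2 (y : V * V * V) := P1 y /\ hn y.1.1 = hn y1.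
have pnN z1 z2 z3 : superlattice x1 x2 x3 z1 z2 z3 -> proj_norm z1 z2 \is a Num.nat.
  move=> h; have [[[? ? _] [? ? _] _] _ _] := h.
  rewrite -intrEge0; last by rewrite ltW // (proj_norm_gt0 (gN _ _ _ h)).
  by rewrite -(@rQ_O m) proj_normE rpredB ?rpredM.
have [||[[z1 z2] z3] [[P1z e1] min2]] := @exists_min _ P2 (fun y : V * V * V => proj_norm y.1.1 y.1.2).
- by move=> [[z1 z2] z3] [/pnN].
- by exists (y1, y2, y3).
rewrite /= in P1z e1 min2 min1.
have pz := proj_norm_gt0 (gN _ _ _ P1z); have hz := hn_gt0_gdet (gN _ _ _ P1z).
have [q qO hq] := approx (proj_form z1 z3 z2) pz.
have P1a := superlattice_shear32 qO P1z.
have [r rO hr] := approx (H z2 z1) hz.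
have P1b := superlattice_shear2 rO P1a.
have [t tO ht] := approx (H (z3 - q *: z2) z1) hz.
have P1c := superlattice_shear31 tO P1b.
exists z1, (z2 - r *: z1), (z3 - q *: z2 - t *: z1); split=> //.
rewrite !proj_norm_shear proj_form_shearl proj_form_shearr.
have min1' w1 w2 w3 : superlattice x1 x2 x3 w1 w2 w3 -> hn z1 <= hn w1.
  by move=> h; rewrite e1; apply: (min1 (w1, w2, w3)).
split.
- split=> //; first exact: min1' (superlattice_swap12 P1c).
  exact: min1' (superlattice_swap12 (superlattice_swap23 P1c)).
- by rewrite HBl HZl hnE.
- by rewrite HBl HZl hnE.
- suff -> : proj_form z1 (z3 - q *: z2) z2 = proj_form z1 z3 z2 - q * rQ m (proj_norm z1 z2).
    exact: hq.
  by rewrite proj_normE /proj_form !HE; ring.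
split=> //.
  by apply: (min2 (z1, z3 - q *: z2, z2)); split=> //; apply: superlattice_swap23.
apply: (@rQ_inj m); rewrite rmorphB !rmorphM /= !proj_normE nrmE proj_formC rmorph_nat.
rewrite -Dg; have [_ _ <-] := P1a; rewrite -hnE gdet_proj; ring.
Qed.

(** The products with [y1] have norm at most rho < 1 and vanish. With A = hn y2 <= B = hn y3, the
    relation A B - C = D and C <= rho A^2 give (1 - rho) A^2 <= D, so that D < 4 (1 - rho) leaves A
    = 1. *)
Lemma reduced_diag y1 y2 y3 : 0 <= rho -> rho < 1 -> (0 < D)%N -> D%:R < 4 * (1 - rho) ->
    integral3 y1 y2 y3 -> hn y1 = 1 ->
    nrm (H y2 y1) <= rho * hn y1 ^+ 2 -> nrm (H y3 y1) <= rho * hn y1 ^+ 2 ->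
    nrm (proj_form y1 y3 y2) <= rho * proj_norm y1 y2 ^+ 2 ->
    0 < proj_norm y1 y2 -> proj_norm y1 y2 <= proj_norm y1 y3 ->
    proj_norm y1 y2 * proj_norm y1 y3 - nrm (proj_form y1 y3 y2) = hn y1 * D%:R ->
  [/\ [/\ H y1 y1 = 1, H y2 y2 = 1 & H y3 y3 = D%:R],
    H y2 y1 = 0, H y3 y1 = 0 & H y3 y2 = 0].
Proof.
move=> r0 r1 D0 Dr iy e1; rewrite e1 expr1n mulr1 => h21 h31 h32 p0 p23 gd.
have [[? ? ?] [O21 O22 ?] [O31 O32 O33]] := iy.
have z (h : E) : h \in O -> nrm h < 1 -> h = 0.
  move=> hO; have [n Dn] := nrm_nat hO; rewrite Dn (ltr_nat rat n 1) ltnS leqn0 => /eqP n0.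
  by apply/eqP; rewrite -nrm_eq0 Dn n0.
have {h21} h21 : H y2 y1 = 0 by apply: z => //; apply: le_lt_trans h21 r1.
have {h31} h31 : H y3 y1 = 0 by apply: z => //; apply: le_lt_trans h31 r1.
have p2 : proj_norm y1 y2 = hn y2 by rewrite /proj_norm e1 h21 nrm0 mul1r subr0.
have p3 : proj_norm y1 y3 = hn y3 by rewrite /proj_norm e1 h31 nrm0 mul1r subr0.
have H11 : H y1 y1 = 1 by rewrite hnE e1 rmorph1.
have p32 : proj_form y1 y3 y2 = H y3 y2 by rewrite /proj_form h31 mul0r subr0 H11 mul1r.
rewrite p2 p3 p32 mul1r in h32 p0 p23 gd.
have /natrP[n2 Dn2] := hn_nat O22.
have n2E : hn y2 = 1.
  rewrite Dn2; case: n2 Dn2 => [|[|n2]] // Dn2; first by rewrite Dn2 ltxx in p0.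
  have : 2 <= hn y2 by rewrite Dn2 -natr1 -natr1; have := ler0n rat n2; lra.
  move: r0 r1 Dr h32 p0 p23 gd; move: (hn y2) (hn y3) (nrm _) (D%:R : rat) => A B C DD.
  clear => r0 r1 Dr hC p0 AB gd A2.
  have h1 : 0 <= (A - 2) * (A + 2) * (1 - rho) by rewrite !mulr_ge0 //; lra.
  have h2 : 0 <= A * (B - A) by rewrite mulr_ge0 //; lra.
  by nra.
rewrite n2E expr1n mulr1 in h32.
have {h32} h32 : H y3 y2 = 0 by apply: z => //; apply: le_lt_trans h32 r1.
move: gd; rewrite n2E h32 nrm0 subr0 mul1r => n3E.
by split=> //; split=> //; rewrite hnE ?n2E ?n3E ?rmorph1 ?rmorph_nat.
Qed.

End Reduced.
End Reduction.

(** * Euclidean constants for m = 1, 3, 7 *)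

Lemma round_rat (a : rat) : exists n : int, - (1 / 2) <= a - n%:~R <= 1 / 2.
Proof.
exists (Num.floor (a + 1 / 2)); have := floor_itv (a + 1 / 2).
rewrite intrD; lra.
Qed.

Lemma coord_sub m (a b c d : rat) :
  rQ m a + rQ m b * sqrtN m - (rQ m c + rQ m d * sqrtN m) =
  rQ m (a - c) + rQ m (b - d) * sqrtN m.
Proof. by rewrite !rmorphB /=; ring. Qed.

Lemma euclid1 (x : QsqrtN 1) :
  exists2 q, q \in ring_of_integers 1 & nrm (x - q) <= 1 / 2.
Proof.
have [a [b Dx]] := coordP x.
have [p hp] := round_rat a; have [q hq] := round_rat b.
exists (rQ 1 ((p * 2)%:~R / 2) + rQ 1 ((q * 2)%:~R / 2) * sqrtN 1).
  by apply: coord_O; apply/dvdzP; exists (p * p + q * q); ring.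
rewrite (@nrm_coord _ (a - (p * 2)%:~R / 2) (b - (q * 2)%:~R / 2)); last first.
  by rewrite Dx coord_sub.
rewrite !rmorphM /= !mulfK //.
by move: (a - p%:~R) (b - q%:~R) hp hq => u v hp hq; nra.
Qed.

Lemma dvd4_parity (k : nat) (p q r : int) : (k %% 4 = 3)%N ->
  (4 %| (2 * p + q) * (2 * p + q) + k%:Z * q * q)%Z.
Proof.
move=> hk; rewrite (divn_eq k 4) hk.
apply/dvdzP; exists (p * p + p * q + q * q + (k %/ 4)%N%:Z * q * q).
by rewrite PoszD PoszM; ring.
Qed.

(** 7/16 = (1/2)^2 + 3 (1/4)^2 results from rounding the coefficient of sqrt(-3) to a multiple of
    1/2 and then the rational part. *)
Lemma euclid3 (x : QsqrtN 3) :
  exists2 q, q \in ring_of_integers 3 & nrm (x - q) <= 7 / 16.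
Proof.
have [a [b Dx]] := coordP x.
have [q hq] := round_rat (2 * b); have [p hp] := round_rat (a - q%:~R / 2).
exists (rQ 3 ((2 * p + q)%:~R / 2) + rQ 3 (q%:~R / 2) * sqrtN 3).
  exact/coord_O/dvd4_parity.
rewrite (@nrm_coord _ (a - (2 * p + q)%:~R / 2) (b - q%:~R / 2)); last first.
  by rewrite Dx coord_sub.
have -> : a - (2 * p + q)%:~R / 2 = (a - q%:~R / 2) - p%:~R.
  by rewrite rmorphD rmorphM /=; field.
have -> : b - q%:~R / 2 = (2 * b - q%:~R) / 2 by field.
by move: (_ - p%:~R) (2 * b - q%:~R) hp hq => u v hp hq; nra.
Qed.

(* In [Z[(1+sqrt(-7))/2]] rounding one coordinate after the other is not enough:
   the second candidate is the other vertex of the Voronoi cell. *)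
Lemma euclid7 (x : QsqrtN 7) :
  exists2 q, q \in ring_of_integers 7 & nrm (x - q) <= 4 / 7.
Proof.
have [a [b Dx]] := coordP x.
have [q hq] := round_rat (2 * b); have [p hp] := round_rat (a - q%:~R / 2).
set u := a - q%:~R / 2 - p%:~R in hp; set v := 2 * b - q%:~R in hq.
have main (i j : int) : (u - i%:~R - j%:~R / 2) ^+ 2 + 7 * ((v - j%:~R) / 2) ^+ 2 <= 4 / 7 ->
    exists2 q, q \in ring_of_integers 7 & nrm (x - q) <= 4 / 7.
  move=> h; exists (rQ 7 ((2 * (p + i) + (q + j))%:~R / 2) + rQ 7 ((q + j)%:~R / 2) * sqrtN 7).
    exact/coord_O/dvd4_parity.
  rewrite (@nrm_coord _ (a - (2 * (p + i) + (q + j))%:~R / 2) (b - (q + j)%:~R / 2)); last first.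
    by rewrite Dx coord_sub.
  move: h; rewrite /u /v !(rmorphD, rmorphM) /=; set A := (X in X <= _ -> _).
  by move=> h; rewrite [X in X <= _](_ : _ = A) // /A; field.
have [h|h] := lerP (u ^+ 2 + 7 * (v / 2) ^+ 2) (4 / 7).
  by apply: (main 0 0); rewrite !mul0r !subr0.
move: main; clear -hp hq h; move: u v hp hq h => u v hp hq h main.
have [u0|u0] := lerP 0 u; have [v0|v0] := lerP 0 v.
- by apply: (main 0 1); rewrite subr0; nra.
- by apply: (main 1 (-1)); rewrite rmorphN /=; nra.
- by apply: (main (-1) 1); rewrite rmorphN /=; nra.
by apply: (main 0 (-1)); rewrite rmorphN /= subr0; nra.
Qed.

(** * Reduced ternary lattices of determinant 1 or 2 *)

Definition orthobasis m (V : hermSpace m) (c : nat) (y1 y2 y3 : V) :=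
  [/\ [/\ hform V y1 y1 = 1, hform V y2 y2 = 1 & hform V y3 y3 = c%:R],
      hform V y2 y1 = 0, hform V y3 y1 = 0 & hform V y3 y2 = 0].

Lemma nat_rat_le (k n : nat) (r : rat) : r = n%:R -> r < k.+1%:R -> (n <= k)%N.
Proof. by move=> ->; rewrite ltr_nat ltnS. Qed.

(** Here a, b, c are the norms of a reduced basis, n21 and n31 the norms of the products with the
    first vector, n that of [proj_form]. With A = a b - n21 one has 3/7 a^2 <= A and 3/7 A^2 <= a,
    so a^3 <= (7/3)^3 and a <= 2. If a = 2, then A^2 <= 14/3 forces b = n21 = 2, and 4 c = 2 n31 + n
    + 2 with n31, n <= 2 forces the rest. *)
Lemma reduced_unimodular_nat (rho : rat) (a b c n21 n31 n : nat) :
    0 <= rho -> rho <= 4 / 7 -> 0 < a%:R :> rat ->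
    a%:R <= b%:R :> rat -> a%:R <= c%:R :> rat ->
    n21%:R <= rho * a%:R ^+ 2 -> n31%:R <= rho * a%:R ^+ 2 ->
    n%:R <= rho * (a%:R * b%:R - n21%:R) ^+ 2 ->
    0 < a%:R * b%:R - n21%:R :> rat ->
    a%:R * b%:R - n21%:R <= a%:R * c%:R - n31%:R :> rat ->
    (a%:R * b%:R - n21%:R) * (a%:R * c%:R - n31%:R) - n%:R = a%:R :> rat ->
  a = 1%N \/ [/\ [/\ a = 2, b = 2 & c = 2]%N, n21 = 2%N, n31 = 2%N & n = 2%N].
Proof.
move=> rho0 rho1 a0 ab ac h21 h31 h32 p0 p23.
move=> gd; have {}h21 : n21%:R <= 4 / 7 * a%:R ^+ 2 :> rat by nra.
have {}h31 : n31%:R <= 4 / 7 * a%:R ^+ 2 :> rat by nra.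
have {}h32 : n%:R <= 4 / 7 * (a%:R * b%:R - n21%:R) ^+ 2 :> rat.
  by apply: le_trans h32 _; rewrite ler_wpM2r // sqr_ge0.
have k1 : 3 / 7 * a%:R ^+ 2 <= a%:R * b%:R - n21%:R :> rat by nra.
have k2 : (a%:R * b%:R - n21%:R) ^+ 2 * (3 / 7) <= a%:R :> rat.
  move: h32 p23 gd p0; set A := _ - _; set B := _ - n31%:R => h32 p23 gd p0.
  have : 0 <= A * (B - A) by rewrite mulr_ge0 //; lra.
  nra.
have a2 : (a <= 2)%N.
  rewrite leqNgt; apply/negP=> a3; have {}a3 : 3 <= a%:R :> rat by rewrite ler_nat.
  have h : (3 / 7 * a%:R ^+ 2) ^+ 2 <= (a%:R * b%:R - n21%:R) ^+ 2 :> rat.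
    by rewrite ler_sqr // ?nnegrE; nra.
  have : 9 * 3 <= a%:R ^+ 3 :> rat by nra.
  nra.
have [ea|[ea|ea]] : a = 0%N \/ a = 1%N \/ a = 2%N by clear -a2; lia.
- by rewrite ea ltxx in a0.
- by left.
subst a; right; have n21_2 : (n21 <= 2)%N by apply: (nat_rat_le (erefl n21%:R)); clear -h21; lra.
have n31_2 : (n31 <= 2)%N by apply: (nat_rat_le (erefl n31%:R)); clear -h31; lra.
have b2 : (2 <= b)%N by rewrite -(ler_nat rat).
have c2 : (2 <= c)%N by rewrite -(ler_nat rat).
have {k2} k2 : 2%:R * b%:R - n21%:R < 3 :> rat by nra.
have [eb en21] : b = 2%N /\ n21 = 2%N.
  have : (2 * b < 3 + n21)%N by rewrite -(ltr_nat rat) natrM natrD; clear -k2; lra.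
  by clear -b2 n21_2; lia.
rewrite eb en21 in ab h21 h32 p0 p23 gd k1 k2 *.
have n_2 : (n <= 2)%N by apply: (nat_rat_le (erefl n%:R)); clear -h32; lra.
have [ec en31] : c = 2%N /\ n31 = 2%N.
  have : (2 * (2 * c) = 2 * n31 + n + 2)%N.
    by apply/eqP; rewrite -(eqr_nat rat) !(natrD, natrM); apply/eqP; clear -gd; lra.
  by clear -c2 n31_2 n_2; lia.
have en : n = 2%N.
  by rewrite ec en31 in gd; apply/eqP; rewrite -(eqr_nat rat); apply/eqP; clear -gd; lra.
by split; [split| | |].
Qed.

Section Unimodular.
Variables (m : nat) (V : hermSpace m).
Local Notation E := (QsqrtN m).
Local Notation O := (ring_of_integers m).
Local Notation cj := (@Qconj m).
Local Notation H := (hform V).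
Hypothesis posd : forall v : V, v != 0 -> 0 < hn v.
Variable rho : rat.
Hypothesis rho0 : 0 <= rho.

Lemma reduced_nats (y1 y2 y3 : V) : integral3 y1 y2 y3 ->
  exists a b c n21 n31 : nat, [/\ hn y1 = a%:R, hn y2 = b%:R, hn y3 = c%:R &
    nrm (H y2 y1) = n21%:R /\ nrm (H y3 y1) = n31%:R].
Proof.
move=> [[O11 _ _] [O21 O22 _] [O31 _ O33]].
have [/natrP[a Da] /natrP[b Db] /natrP[c Dc]] := And3 (hn_nat posd O11) (hn_nat posd O22) (hn_nat posd O33).
have [[n Dn] [k Dk]] := conj (nrm_nat O21) (nrm_nat O31).
by exists a, b, c, n, k.
Qed.

Lemma proj_formO (y1 y2 y3 : V) : integral3 y1 y2 y3 -> proj_form y1 y3 y2 \in O.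
Proof. by move=> [[? ? ?] [? ? ?] [? ? ?]]; rewrite rpredB ?rpredM. Qed.

Lemma reduced_unimodular (y1 y2 y3 : V) : rho <= 4 / 7 ->
    integral3 y1 y2 y3 ->
    [/\ [/\ 0 < hn y1, hn y1 <= hn y2 & hn y1 <= hn y3],
      nrm (H y2 y1) <= rho * hn y1 ^+ 2, nrm (H y3 y1) <= rho * hn y1 ^+ 2,
      nrm (proj_form y1 y3 y2) <= rho * proj_norm y1 y2 ^+ 2 &
      [/\ 0 < proj_norm y1 y2, proj_norm y1 y2 <= proj_norm y1 y3 &
      proj_norm y1 y2 * proj_norm y1 y3 - nrm (proj_form y1 y3 y2) = hn y1 * 1%:R]] ->
  hn y1 = 1 \/ [/\ [/\ hn y1 = 2, hn y2 = 2 & hn y3 = 2], nrm (H y2 y1) = 2,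
     nrm (H y3 y1) = 2 & nrm (proj_form y1 y3 y2) = 2].
Proof.
move=> rho1 iy [[a0 ab ac] h21 h31 h32 [p0 p23]].
have [n Dn] := nrm_nat (proj_formO iy).
have [a [b [c [n21 [n31 [Da Db Dc [Dn21 Dn31]]]]]]] := reduced_nats iy.
rewrite /proj_norm Da Db Dc Dn Dn21 Dn31 mulr1 in a0 ab ac h21 h31 h32 p0 p23 *.
move=> gd; have [->|[[-> -> ->] -> -> ->]] :=
    reduced_unimodular_nat rho0 rho1 a0 ab ac h21 h31 h32 p0 p23 gd; [by left | by right].
Qed.

End Unimodular.

Lemma trace_even1 (x : QsqrtN 1) : x \in ring_of_integers 1 ->
  exists k : int, x + Qconj x = (2 * k)%:~R.
Proof.
move=> xO; have [|//|p [q [Dx h _]]] := Ocoord _ _ xO.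
  by move=> d; rewrite dvdn1 => /eqP; case: d => [|[]].
exists (p %/ 2)%Z; have -> : 2 * (p %/ 2)%Z = p.
  move/dvdzP: h => [n h]; suff : (p %% 2 = 0)%Z by lia.
  have := divz_eq p 2; have := divz_eq q 2; have := modz_ge0 p (d := 2) isT.
  have := ltz_pmod p (d := 2) isT; have := modz_ge0 q (d := 2) isT; have := ltz_pmod q (d := 2) isT.
  set p1 := (p %/ 2)%Z; set q1 := (q %/ 2)%Z => *.
  nia.
rewrite Dx cjD cjM cj_s !cj_rQ -(rmorph_int (rQ 1)).
transitivity (rQ 1 (p%:~R / 2 + p%:~R / 2)); first by rewrite rmorphD /=; ring.
by congr (rQ 1 _); field.
Qed.

(** The exceptional case of [reduced_unimodular] has an even determinant: besides even integers,
    only the trace of a product of three entries occurs in it, and traces in Z[i] are even. *)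
Theorem unimodular_ternary1 (V : hermSpace 1) (x1 x2 x3 : V) :
    (forall v : V, v != 0 -> 0 < hn v) -> integral3 x1 x2 x3 ->
    gdet x1 x2 x3 = 1%:R ->
  exists y1 y2 y3, orthobasis 1 y1 y2 y3 /\ refines y1 y2 y3 x1 x2 x3.
Proof.
move=> posd ix gx.
have [y1 [y2 [y3 [[iy ry gy] red]]]] := reduced_triple posd euclid1 ix gx isT.
exists y1, y2, y3; split=> //.
have [r0 r1 r2 r3] : [/\ 0 <= 1 / 2 :> rat, 1 / 2 <= 4 / 7 :> rat, 1 / 2 < 1 :> rat
   & 1%:R < 4 * (1 - 1 / 2) :> rat] by split; lra.
have [e|[[e1 e2 e3] n21 n31 _]] := reduced_unimodular posd r0 r1 iy red.
  have [_ h21 h31 h32 [p0 p23 gd]] := red.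
  exact: (@reduced_diag _ _ posd (1 / 2) 1 _ _ _ r0 r2 isT r3 iy e h21 h31 h32 p0 p23 gd).
have [[_ O12 O13] [O21 _ O23] [O31 O32 _]] := iy.
have [k Dk] := trace_even1 (rpredM (rpredM O12 O23) O31).
have [n Dn] := nrm_nat O32.
have N21 : hform V y1 y2 * hform V y2 y1 = 2.
  by rewrite (HC y1 y2) mulrC -nrmE n21 rmorph_nat.
have N31 : hform V y1 y3 * hform V y3 y1 = 2.
  by rewrite (HC y1 y3) mulrC -nrmE n31 rmorph_nat.
have N32 : hform V y2 y3 * hform V y3 y2 = n%:R.
  by rewrite (HC y2 y3) mulrC -nrmE Dn rmorph_nat.
have T : hform V y1 y3 * hform V y2 y1 * hform V y3 y2 = (2 * k)%:~R
   - hform V y1 y2 * hform V y2 y3 * hform V y3 y1.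
  by rewrite -Dk !cjM -!HC; ring.
have H1 : hform V y1 y1 = 2 by rewrite hnE e1 rmorph_nat.
have H2 : hform V y2 y2 = 2 by rewrite hnE e2 rmorph_nat.
have H3 : hform V y3 y3 = 2 by rewrite hnE e3 rmorph_nat.
have : (1%:R : rat) = (2 * (k - n%:Z))%:~R.
  apply: (@rQ_inj 1); rewrite rmorph_nat rmorph_int -gx -gy /gdet /det3 H1 H2 H3.
  move: T; rewrite !rmorphM rmorphB /= -pmulrn => T.
  rewrite T; move: N21 N31 N32; move: (hform V y1 y2) (hform V y2 y1) (hform V y1 y3).
  move: (hform V y3 y1) (hform V y2 y3) (hform V y3 y2) => h31 h23 h32 h12 h21 h13 N21 N31 N32.
  transitivity (8 + 2 * k%:~R - 2 * (h23 * h32) - 2 * (h12 * h21) - 2 * (h13 * h31)).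
    by ring.
  by rewrite N21 N31 N32; ring.
by rewrite -[1%:R]/((1 : int)%:~R) => /eqP; rewrite eqr_int => /eqP; clear; lia.
Qed.

(** For a = hn y1 the bounds give (9/16)^3 a^3 <= 2, so a <= 2. If a = 2, the norm of H(y2, y1) is
    at most 7/4, hence at most 1, so [proj_norm y1 y2] is at least 3; but 9/16 of its square is at
    most 2 a = 4. *)
Theorem ternary3 (V : hermSpace 3) (c : nat) (x1 x2 x3 : V) :
    (forall v : V, v != 0 -> 0 < hn v) -> (0 < c <= 2)%N ->
    integral3 x1 x2 x3 -> gdet x1 x2 x3 = c%:R ->
  exists y1 y2 y3, orthobasis c y1 y2 y3 /\ refines y1 y2 y3 x1 x2 x3.
Proof.
move=> posd /andP[c0 c2] ix gx.
have [y1 [y2 [y3 [[iy ry gy] red]]]] := reduced_triple posd euclid3 ix gx c0.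
exists y1, y2, y3; split=> //.
have [[a0 ab ac] h21 h31 h32 [p0 p23 gd]] := red.
have c2' : c%:R <= 2 :> rat by rewrite ler_nat.
suff e : hn y1 = 1.
  have [r0 r1 r2] : [/\ 0 <= 7 / 16 :> rat, 7 / 16 < 1 :> rat
   & c%:R < 4 * (1 - 7 / 16) :> rat] by split; clear -c2'; lra.
  exact: (reduced_diag posd r0 r1 c0 r2 iy e h21 h31 h32 p0 p23 gd).
have [a [b [b3 [n21 [n31 [Da Db Db3 [Dn21 Dn31]]]]]]] := reduced_nats posd iy.
have [n Dn] := nrm_nat (proj_formO iy).
rewrite /proj_norm Da Db Db3 Dn Dn21 Dn31 in a0 ab ac h21 h31 h32 p0 p23 gd *.
have k2 : (a%:R * b%:R - n21%:R) ^+ 2 * (9 / 16) <= a%:R * c%:R :> rat.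
  move: h32 p23 gd p0; set A := _ - _; set B := _ - n31%:R => h32 p23 gd p0.
  have : 0 <= A * (B - A) by rewrite mulr_ge0 //; lra.
  nra.
have {}k2 : (a%:R * b%:R - n21%:R) ^+ 2 * (9 / 16) <= a%:R * 2 :> rat by nra.
have k1 : 9 / 16 * a%:R ^+ 2 <= a%:R * b%:R - n21%:R :> rat by nra.
have a2 : (a <= 2)%N.
  rewrite leqNgt; apply/negP=> a3; have {}a3 : 3 <= a%:R :> rat by rewrite ler_nat.
  have h : (9 / 16 * a%:R ^+ 2) ^+ 2 <= (a%:R * b%:R - n21%:R) ^+ 2 :> rat.
    by rewrite ler_sqr // ?nnegrE; nra.
  have : 9 * 3 <= a%:R ^+ 3 :> rat by nra.
  nra.
have [ea|[ea|ea]] : a = 0%N \/ a = 1%N \/ a = 2%N by clear -a2; lia.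
- by rewrite ea ltxx in a0.
- by rewrite ea.
rewrite {}ea in a0 ab ac h21 h31 h32 p0 p23 gd k1 k2 *.
have n21_1 : (n21 <= 1)%N by apply: (nat_rat_le (erefl n21%:R)); clear -h21; lra.
have {}n21_1 : n21%:R <= 1 :> rat by rewrite (ler_nat rat n21 1).
clear -n21_1 ab k2; nra.
Qed.

(** * Integers of the field for m = 3 modulo 4 *)

Definition omega (m : nat) : QsqrtN m := (1 + sqrtN m) / 2.

Section Omega.
Variable m : nat.
Hypotheses (sqf : squarefree m) (m4 : (m %% 4 = 3)%N).
Local Notation E := (QsqrtN m).
Local Notation O := (ring_of_integers m).
Local Notation cj := (@Qconj m).
Local Notation w := (omega m).

Lemma two_neq0 : 2 != 0 :> E. Proof. exact: (natE_neq0 m 1). Qed.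

Lemma omega_coord : w = rQ m (1 / 2) + rQ m (1 / 2) * sqrtN m.
Proof.
rewrite /omega.
by have h2 := two_neq0; rewrite !fmorph_div !rmorph1 !rmorph_nat; field.
Qed.

Lemma cj_omega : cj w = 1 - w.
Proof. by have h2 := two_neq0; rewrite /omega cjM cjV cjD cj1 cj_s cjn; field. Qed.

Lemma omegaO : w \in O.
Proof.
rewrite omega_coord; apply: (@coord_O m 1 1); rewrite (divn_eq m 4) m4.
by apply/dvdzP; exists ((m %/ 4)%N%:Z + 1); rewrite PoszD PoszM; ring.
Qed.

Lemma omega_sqr : w * w = w - ((m + 1) %/ 4)%N%:R.
Proof.
have h4 : (4 * ((m + 1) %/ 4) = m + 1)%N by lia.
have h2 := two_neq0; apply: (mulfI (x := 4)); first exact: (natE_neq0 m 3).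
rewrite mulrBr -natrM h4 natrD /omega; have s2 := s_sqr m.
have -> : 4 * ((1 + sqrtN m) / 2 * ((1 + sqrtN m) / 2)) = (1 + sqrtN m) * (1 + sqrtN m) by field.
have -> : 4 * ((1 + sqrtN m) / 2) = 2 * (1 + sqrtN m) by field.
by ring: s2.
Qed.

Lemma O_omega x : x \in O -> exists a b : int, x = a%:~R + b%:~R * w /\
  4 * nrm x = ((2 * a + b) ^+ 2 + m%:Z * b ^+ 2)%:~R.
Proof.
have m0 : (0 < m)%N by lia.
move=> xO; have [p [q [Dx h Dn]]] := Ocoord sqf m0 xO.
have [k Dk] : exists k : int, p = q + 2 * k.
  exists ((p - q) %/ 2)%Z; move/dvdzP: h => [n].
  rewrite (divn_eq m 4) m4 PoszD PoszM.
  have := divz_eq p 2; have := divz_eq q 2; have := modz_ge0 p (d := 2) isT.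
  have := ltz_pmod p (d := 2) isT; have := modz_ge0 q (d := 2) isT; have := ltz_pmod q (d := 2) isT.
  set p1 := (p %/ 2)%Z; set q1 := (q %/ 2)%Z => h1 h2 h3 h4 h5 h6 h7.
  suff : (p %% 2 = q %% 2)%Z by lia.
  nia.
exists k, q; split.
  have e1 : rQ m (p%:~R / 2) = k%:~R + q%:~R * rQ m (1 / 2).
    have -> : p%:~R / 2 = k%:~R + q%:~R * (1 / 2) :> rat.
      by rewrite Dk rmorphD rmorphM /=; field.
    by rewrite rmorphD rmorphM /= !rmorph_int.
  have e2 : rQ m (q%:~R / 2) = q%:~R * rQ m (1 / 2).
    have -> : q%:~R / 2 = q%:~R * (1 / 2) :> rat by field.
    by rewrite rmorphM /= !rmorph_int.
  by rewrite Dx omega_coord e1 e2; ring.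
rewrite Dn mulrC divfK //; congr (_%:~R); rewrite Dk; ring.
Qed.

End Omega.

(** * The Barnes lattice *)

Section Barnes.
Local Notation E := (QsqrtN 7).
Local Notation O := (ring_of_integers 7).
Local Notation cj := (@Qconj 7).
Local Notation al := (omega 7).
Variable V : hermSpace 7.
Local Notation H := (hform V).

Lemma squarefree7 : squarefree 7.
Proof.
move=> d h; have : (d ^ 2 <= 7)%N by apply: dvdn_leq.
by case: d h => [|[|[|[|d]]]] //=; lia.
Qed.

Let al2 : al * al = al - 2. Proof. by rewrite omega_sqr. Qed.
Let cal : cj al = 1 - al. Proof. exact: cj_omega. Qed.
Let alO : al \in O. Proof. exact: omegaO. Qed.
Let al0 : al != 0.
Proof. by apply: contra_eq_neq al2 => ->; rewrite mul0r sub0r eq_sym oppr_eq0 two_neq0. Qed.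

Definition barnes (y1 y2 y3 : V) :=
  [/\ [/\ H y1 y1 = 2, H y2 y2 = 2 & H y3 y3 = 2],
    H y2 y1 = al, H y3 y1 = 1 - al & H y3 y2 = -1].

Definition residue (t1 t2 t3 : bool) (c1 c2 c3 : E) :=
  t1%:R * c1 + t2%:R * c2 + t3%:R * c3.

(** [t] is a functional modulo [al], and the v_i are orthogonal vectors of norm 2 such that H(x,
    v_i) is congruent to t(x) for every x: this is H(y_j, v_i) = t_j + al w_ij. The equations that
    follow say that y_j = sum_i (H(y_j, v_i) / 2) v_i and give the Gram matrix of the v_i. As N(al /
    2) = 1/2, the vectors z_i = (al / 2) v_i are orthonormal, and x = sum_i (H(x, v_i) / al) z_i has
    integral coefficients as soon as t(x) = 0. *)
Lemma frame (t1 t2 t3 : bool)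
    (u11 u12 u13 u21 u22 u23 u31 u32 u33 : E)
    (w11 w12 w13 w21 w22 w23 w31 w32 w33 : E) (y1 y2 y3 : V)
    (v1 := cb3 y1 y2 y3 u11 u12 u13) (v2 := cb3 y1 y2 y3 u21 u22 u23)
    (v3 := cb3 y1 y2 y3 u31 u32 u33) (T := fun (t : bool) w => t%:R + al * w) :
    [/\ w11 \in O, w12 \in O & w13 \in O] ->
    [/\ w21 \in O, w22 \in O & w23 \in O] ->
    [/\ w31 \in O, w32 \in O & w33 \in O] ->
    [/\ H y1 v1 = T t1 w11, H y2 v1 = T t2 w12 & H y3 v1 = T t3 w13] ->
    [/\ H y1 v2 = T t1 w21, H y2 v2 = T t2 w22 & H y3 v2 = T t3 w23] ->
    [/\ H y1 v3 = T t1 w31, H y2 v3 = T t2 w32 & H y3 v3 = T t3 w33] ->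
    [/\ T t1 w11 * u11 + T t1 w21 * u21 + T t1 w31 * u31 = 2,
        T t1 w11 * u12 + T t1 w21 * u22 + T t1 w31 * u32 = 0 &
        T t1 w11 * u13 + T t1 w21 * u23 + T t1 w31 * u33 = 0] ->
    [/\ T t2 w12 * u11 + T t2 w22 * u21 + T t2 w32 * u31 = 0,
        T t2 w12 * u12 + T t2 w22 * u22 + T t2 w32 * u32 = 2 &
        T t2 w12 * u13 + T t2 w22 * u23 + T t2 w32 * u33 = 0] ->
    [/\ T t3 w13 * u11 + T t3 w23 * u21 + T t3 w33 * u31 = 0,
        T t3 w13 * u12 + T t3 w23 * u22 + T t3 w33 * u32 = 0 &
        T t3 w13 * u13 + T t3 w23 * u23 + T t3 w33 * u33 = 2] ->
    [/\ u11 * T t1 w11 + u12 * T t2 w12 + u13 * T t3 w13 = 2,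
        u21 * T t1 w21 + u22 * T t2 w22 + u23 * T t3 w23 = 2 &
        u31 * T t1 w31 + u32 * T t2 w32 + u33 * T t3 w33 = 2] ->
    [/\ u21 * T t1 w11 + u22 * T t2 w12 + u23 * T t3 w13 = 0,
        u31 * T t1 w11 + u32 * T t2 w12 + u33 * T t3 w13 = 0 &
        u31 * T t1 w21 + u32 * T t2 w22 + u33 * T t3 w23 = 0] ->
  exists z1 z2 z3, orthobasis 1 z1 z2 z3 /\
    forall c1 c2 c3, c1 \in O -> c2 \in O -> c3 \in O ->
      dvO al (residue t1 t2 t3 c1 c2 c3) -> span3 z1 z2 z3 (cb3 y1 y2 y3 c1 c2 c3).
Proof.
move=> [? ? ?] [? ? ?] [? ? ?] [h11 h12 h13] [h21 h22 h23] [h31 h32 h33].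
move=> [p11 p12 p13] [p21 p22 p23] [p31 p32 p33] [q11 q22 q33] [q21 q31 q32].
have h2 := two_neq0 7; pose k := al / 2.
have kk : k * cj k = 1 / 2.
  rewrite /k cjM cjV cjn cal; apply: (mulfI h2); apply: (mulfI h2).
  have -> : 2 * (2 * (al / 2 * ((1 - al) / 2))) = al - al * al by field.
  by rewrite al2; field.
exists (k *: v1), (k *: v2), (k *: v3); split.
  have sc x y : H (k *: x) (k *: y) = 1 / 2 * H x y by rewrite HZl HZr mulrA kk.
  have g x (a b c : E) : H (cb3 y1 y2 y3 a b c) x = a * H y1 x + b * H y2 x + c * H y3 x.
    exact: Hcb3l.
  split; first split; rewrite sc ?[H v1 v1]g ?[H v2 v2]g ?[H v3 v3]g
    ?[H v2 v1]g ?[H v3 v1]g ?[H v3 v2]g.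
  - by rewrite h11 h12 h13 q11; field.
  - by rewrite h21 h22 h23 q22; field.
  - by rewrite h31 h32 h33 q33; field.
  - by rewrite h11 h12 h13 q21 mulr0.
  - by rewrite h11 h12 h13 q31 mulr0.
  - by rewrite h21 h22 h23 q32 mulr0.
move=> c1 c2 c3 c1O c2O c3O; set r := residue t1 t2 t3 c1 c2 c3; rewrite /dvO => rO.
have Dr : r = al * (r / al) by rewrite mulrC divfK.
pose e wa wb wc := r / al + (c1 * wa + c2 * wb + c3 * wc).
exists (e w11 w12 w13), (e w21 w22 w23), (e w31 w32 w33).
split; try by rewrite /e rpredD ?rO // !(rpredD, rpredM).
have ke wa wb wc : e wa wb wc * k = (c1 * T t1 wa + c2 * T t2 wb + c3 * T t3 wc) / 2.
  rewrite /e /k mulrA; congr (_ / 2); rewrite mulrDl divfK // /r /residue /T; ring.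
rewrite {2}/cb3 !scalerA !ke /v1 /v2 /v3 !cb3Z !cb3D.
have fin (A1 A2 A3 B1 B2 B3 C1 C2 C3 D1 D2 D3 x : E) :
   c1 * (A1 * D1 + B1 * D2 + C1 * D3) + c2 * (A2 * D1 + B2 * D2 + C2 * D3)
   + c3 * (A3 * D1 + B3 * D2 + C3 * D3) = 2 * x ->
   x = (c1 * A1 + c2 * A2 + c3 * A3) / 2 * D1 + (c1 * B1 + c2 * B2 + c3 * B3) / 2 * D2
     + (c1 * C1 + c2 * C2 + c3 * C3) / 2 * D3.
  by move=> hx; apply: (mulfI h2); rewrite -hx; field.
congr cb3; apply: fin.
- by rewrite p11 p21 p31; ring.
- by rewrite p12 p22 p32; ring.
- by rewrite p13 p23 p33; ring.
Qed.

Ltac frame_tac G :=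
  lazymatch goal with
  | |- and3 (is_true (_ \in _)) _ _ =>
      split; do ?[exact: alO | exact: rpred0 | exact: rpred1 | rewrite rpredN | apply: rpredB | apply: rpredD]
  | |- _ => split; rewrite ?Hcb3r ?(cjB, cjD, cjN, cjM, cal, cj0, cj1, cjn) /=;
      rewrite ?G;
      move: al2; generalize al; intros a a2; ring: a2
  end.

(** An explicit frame for each of the seven nonzero functionals: nine coordinates [u] of the frame
    vectors, then the nine quotients [w]. *)
Lemma barnes_frames (y1 y2 y3 : V) (t1 t2 t3 : bool) : barnes y1 y2 y3 ->
    t1 || t2 || t3 ->
  exists z1 z2 z3, orthobasis 1 z1 z2 z3 /\
    forall c1 c2 c3, c1 \in O -> c2 \in O -> c3 \in O ->
      dvO al (residue t1 t2 t3 c1 c2 c3) -> span3 z1 z2 z3 (cb3 y1 y2 y3 c1 c2 c3).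
Proof.
move=> [[H11 H22 H33] H21 H31 H32].
have H12 : H y1 y2 = 1 - al by rewrite HC H21 cal.
have H13 : H y1 y3 = al by rewrite HC H31 cjB cj1 cal; ring.
have H23 : H y2 y3 = -1 by rewrite HC H32 cjN cj1.
pose G := (H11, H22, H33, H12, H13, H23, H21, H31, H32).
case: t3; case: t2; case: t1 => // _.
- apply: (@frame true true true
    (- 1 - al) 1 al 0 1 1 (1 - al) al (- 1)
    al (al - 1) 0 0 0 0 (al - 1) (- 1) al y1 y2 y3); frame_tac G.
- apply: (@frame false true true
    (al - 2) (1 - al) 1 (- 1) 0 al (- 1) (1 - al) 1
    (- 1) 0 (al - 1) 0 (al - 1) (- 1) 1 al 0 y1 y2 y3); frame_tac G.
- apply: (@frame true false true
    0 1 0 (1 - al) al (al - 1) (al + 1) (- 1) (1 - al)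
    (- 1) (1 - al) (al - 1) 0 0 (- 1) 0 0 0 y1 y2 y3); frame_tac G.
- apply: (@frame false false true
    (al - 2) (1 - al) 2 (- 1) (1 - al) 0 1 0 0
    0 0 0 0 1 (al - 1) (1 - al) 1 (- 1) y1 y2 y3); frame_tac G.
- apply: (@frame true true false
    (- 1) 1 al (- 1) 1 1 (2 - al) al (- 1)
    (- 1) 0 (- 1) (al - 1) (- 1) 1 0 0 0 y1 y2 y3); frame_tac G.
- apply: (@frame false true false
    (- 1 - al) 2 al (al - 1) 0 1 0 0 1
    0 0 0 (- 1) (- 1) 0 1 (al - 1) (1 - al) y1 y2 y3); frame_tac G.
- apply: (@frame true false false
    (- al) 1 0 al (- 1) (1 - al) al (- al) (1 - al)
    al 0 1 (al - 1) (- 1) 1 0 1 0 y1 y2 y3); frame_tac G.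
Qed.

End Barnes.

(** Two vectors of F_2^3 span at most a plane, so a nonzero functional vanishes on both. *)
Lemma residue_choice (r1 r2 r3 s1 s2 s3 : bool) :
  exists t1 t2 t3 : bool, [/\ t1 || t2 || t3, ~~ odd (t1 * r1 + t2 * r2 + t3 * r3)
    & ~~ odd (t1 * s1 + t2 * s2 + t3 * s3)].
Proof.
by case: r1; case: r2; case: r3; case: s1; case: s2; case: s3;
  first [by exists true, false, false | by exists false, true, false
       | by exists false, false, true | by exists true, true, false
       | by exists true, false, true | by exists false, true, true
       | by exists true, true, true].
Qed.

Lemma norm2_solutions (a b : int) : (2 * a + b) ^+ 2 + 7 * b ^+ 2 = 8 ->
  (a = 0 /\ b = 1) \/ (a = 1 /\ b = -1) \/ (a = 0 /\ b = -1) \/ (a = -1 /\ b = 1).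
Proof.
rewrite !expr2 => h.
have hb : -1 <= b <= 1 by nia.
have ha : -1 <= a <= 1 by nia.
nia.
Qed.

(** * Unimodular ternary lattices for m = 7 *)

Section Ternary7.
Local Notation E := (QsqrtN 7).
Local Notation O := (ring_of_integers 7).
Local Notation cj := (@Qconj 7).
Local Notation al := (omega 7).
Variable V : hermSpace 7.
Local Notation H := (hform V).

Let al2 : al * al = al - 2. Proof. by rewrite omega_sqr. Qed.
Let cal : cj al = 1 - al. Proof. exact: cj_omega. Qed.
Let alO : al \in O. Proof. exact: omegaO. Qed.
Let al0 : al != 0.
Proof. by apply: contra_eq_neq al2 => ->; rewrite mul0r sub0r eq_sym oppr_eq0 two_neq0. Qed.

Lemma norm2_O7 (x : E) : x \in O -> nrm x = 2 ->
  (x = al \/ x = 1 - al) \/ (x = - al \/ x = - (1 - al)).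
Proof.
move=> xO nx; have [a [b [Dx Dn]]] := O_omega squarefree7 (erefl _) xO.
have {Dn} : (2 * a + b) ^+ 2 + 7 * b ^+ 2 = 8.
  by apply/eqP; rewrite -(eqr_int rat) -Dn nx.
move/norm2_solutions => [[ea eb]|[[ea eb]|[[ea eb]|[ea eb]]]]; rewrite Dx.
- by left; left; rewrite ea eb; ring.
- by left; right; rewrite ea eb; ring.
- by right; left; rewrite ea eb; ring.
by right; right; rewrite ea eb; ring.
Qed.

Lemma residue2 (x : E) : x \in O -> exists b : bool, dvO al (x - b%:R).
Proof.
move=> xO; have [a [b [-> _]]] := O_omega squarefree7 (erefl _) xO.
exists (odd `|a|%N); rewrite /dvO.
have [k Dk] : exists k : int, a = (odd `|a|%N : nat)%:Z + 2 * k.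
  by exists ((a - (odd `|a|%N : nat)%:Z) %/ 2)%Z; lia.
set o := odd `|a|%N in Dk *.
have -> : (a%:~R + b%:~R * al - o%:R) / al = k%:~R * (1 - al) + b%:~R.
  apply: (mulIf al0); rewrite divfK //.
  have -> : a%:~R = o%:R + 2 * k%:~R :> E by rewrite {1}Dk rmorphD rmorphM /= -pmulrn.
  move: al2; move: (k%:~R : E) (b%:~R : E) (o%:R : E) => K B C; generalize al; intros y y2.
  have -> : (K * (1 - y) + B) * y = K * y - K * (y * y) + B * y by ring.
  by rewrite y2; ring.
by rewrite rpredD ?rpredM ?rpredB ?rpred1 ?int_O.
Qed.

Lemma half_notO (x : E) : x \in O -> 1 / 2 + x \notin O.
Proof.
move=> xO; apply/negP=> /(rpredB)/(_ xO); rewrite addrK.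
have -> : 1 / 2 = rQ 7 (1 / 2) by rewrite fmorph_div rmorph1 rmorph_nat.
rewrite rQ_O.
by rewrite Qint_def.
Qed.

Lemma refines_neg2 (y1 y2 y3 : V) : refines y1 (- y2) y3 y1 y2 y3.
Proof.
split; [exact: span3_1| |exact: span3_3].
exists 0, (-1), 0; split; rewrite ?rpred0 ?rpredN ?rpred1 //.
by rewrite /cb3 !scale0r add0r addr0 scaleN1r opprK.
Qed.

Lemma refines_neg3 (y1 y2 y3 : V) : refines y1 y2 (- y3) y1 y2 y3.
Proof.
split; [exact: span3_1|exact: span3_2|].
exists 0, 0, (-1); split; rewrite ?rpred0 ?rpredN ?rpred1 //.
by rewrite /cb3 !scale0r !add0r scaleN1r opprK.
Qed.

(** What the reduction leaves: it controls the norms of the products, not the products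
    themselves. *)
Definition barnes_like (y1 y2 y3 : V) :=
  [/\ [/\ H y1 y1 = 2, H y2 y2 = 2 & H y3 y3 = 2], H y2 y1 \in O /\ H y3 y1 \in O,
   H y3 y2 \in O, nrm (H y2 y1) = 2 /\ nrm (H y3 y1) = 2 & nrm (proj_form y1 y3 y2) = 2].

(** With h = H(y3, y2), [proj_form] is 2 h - (1 - al)^2 = 2 h + 1 + al and must be one of +-al, +-(1
    - al). Divisibility by 2 leaves h = -1, the Barnes lattice itself, and h = -al, which a change
    of basis brings to it. *)
Lemma barnes_like_main (y1 y2 y3 : V) : barnes_like y1 y2 y3 ->
    H y2 y1 = al -> H y3 y1 = 1 - al ->
  exists z1 z2 z3, barnes z1 z2 z3 /\ refines z1 z2 z3 y1 y2 y3.
Proof.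
move=> [[H11 H22 H33] _ O32 _ np] H21 H31.
have H12 : H y1 y2 = 1 - al by rewrite HC H21 cal.
have H13 : H y1 y3 = al by rewrite HC H31 cjB cj1 cal; ring.
have O1 : 1 - al \in O by rewrite rpredB ?rpred1.
have pO : proj_form y1 y3 y2 \in O.
  by rewrite /proj_form H11 H31 H12; rewrite rpredB // rpredM // nat_O.
have := norm2_O7 pO np; rewrite /proj_form H11 H31 H12.
have h2 := two_neq0 7; move: O32; set h := H y3 y2 => O32.
have sq : (1 - al) * (1 - al) = - 1 - al.
  by have -> : (1 - al) * (1 - al) = 1 - 2 * al + al * al; [ring | rewrite al2; ring].
rewrite sq.
have bad (x : E) : x \in O -> 2 * h = 1 + 2 * x -> False.
  move=> xO e; have /negP := half_notO xO; apply.
  suff -> : 1 / 2 + x = h by [].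
  by apply: (mulfI h2); rewrite e; field.
case=> [[e|e]|[e|e]].
- case: (bad (-1)); rewrite ?rpredN ?rpred1 //.
  by rewrite -(subrK (-1 - al) (2 * h)) e; ring.
- have Dh : h = - al.
    by apply: (mulfI h2); rewrite -(subrK (-1 - al) (2 * h)) e; ring.
  have H32 : H y3 y2 = - al by [].
  have H23 : H y2 y3 = al - 1 by rewrite HC H32 cjN cal; ring.
  exists y2, (y3 + al *: y2), y1; split.
    rewrite /barnes !(HDl, HDr, HZl, HZr) cal H11 H22 H33 H32 H23 H13 H12.
    move: al2; generalize al; intros a a2.
    by split; [split|..]; ring: a2.
  split; [exact: span3_3 | exact: span3_1 |].
  exists (- al), 1, 0; split; rewrite ?rpredN ?rpred1 ?rpred0 //.
  by rewrite /cb3 scale1r scale0r addr0 scaleNr addrC addrK.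
- case: (bad (- 1 - al)); rewrite ?rpredB ?rpredN ?rpred1 //.
  by rewrite -(subrK (-1 - al) (2 * h)) e; ring.
exists y1, y2, y3; split; last exact: refines_refl.
split=> //; apply: (mulfI h2).
by rewrite -/h -(subrK (-1 - al) (2 * h)) e; ring.
Qed.

Lemma barnes_like_swap (y1 y2 y3 : V) : barnes_like y1 y2 y3 -> barnes_like y1 y3 y2.
Proof.
move=> [[? ? ?] [? ?] h [? ?] ?]; split=> //; first by rewrite HC cjO.
by rewrite -proj_formC nrm_cj.
Qed.

Lemma barnes_like_neg2 (y1 y2 y3 : V) : barnes_like y1 y2 y3 -> barnes_like y1 (- y2) y3.
Proof.
move=> [[? ? ?] [? ?] h [? ?] hp]; split; rewrite /proj_form !(HNl, HNr) ?opprK ?nrmN ?rpredN //.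
by rewrite -hp -nrmN /proj_form; congr nrm; ring.
Qed.

(** H(y2, y1) and H(y3, y1) cannot be equal: [proj_form] would be 2 (H(y3, y2) - 1), of norm
    divisible by 4. So they are conjugate, in one order or the other. *)
Lemma barnes_like_pos (y1 y2 y3 : V) : barnes_like y1 y2 y3 ->
    (H y2 y1 = al \/ H y2 y1 = 1 - al) -> (H y3 y1 = al \/ H y3 y1 = 1 - al) ->
  exists z1 z2 z3, barnes z1 z2 z3 /\ refines z1 z2 z3 y1 y2 y3.
Proof.
move=> hb; have [[H11 _ _] _ O32 _ np] := hb.
have bad : H y3 y1 * H y1 y2 = 2 -> False.
  move=> e; move: np; rewrite /proj_form H11 e.
  have -> : 2 * H y3 y2 - 2 = 2 * (H y3 y2 - 1) by ring.
  have Oh : H y3 y2 - 1 \in O by rewrite rpredB ?rpred1.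
  have [n Dn] := nrm_nat Oh; rewrite nrmM nrmn Dn -natrX -natrM => /eqP.
  by rewrite (eqr_nat rat _ 2) => /eqP; case: n {Dn} => [|n] //; rewrite mulnS.
case=> [e2|e2]; case=> [e3|e3].
- case: bad; rewrite (HC y1) e2 e3 cal mulrBr al2; ring.
- exact: barnes_like_main.
- have [z1 [z2 [z3 [bz rz]]]] := barnes_like_main (barnes_like_swap hb) e3 e2.
  exists z1, z2, z3; split=> //; apply: refines_trans rz _; exact: refines_swap23.
case: bad; rewrite (HC y1) e2 e3 cjB cj1 cal.
by have -> : (1 - al) * (1 - (1 - al)) = al - al * al; [ring | rewrite al2; ring].
Qed.

(** Elements of norm 2 are [al] and its conjugate up to sign, and the signs are absorbed into [y2]
    and [y3]. *)
Lemma barnes_like_barnes (y1 y2 y3 : V) : barnes_like y1 y2 y3 ->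
  exists z1 z2 z3, barnes z1 z2 z3 /\ refines z1 z2 z3 y1 y2 y3.
Proof.
have step2 : forall z1 z2 z3 : V, barnes_like z1 z2 z3 ->
    (H z3 z1 = al \/ H z3 z1 = 1 - al) ->
    exists x1 x2 x3, barnes x1 x2 x3 /\ refines x1 x2 x3 z1 z2 z3.
  move=> z1 z2 z3 hb e3; have [_ [O21 _] _ [n21 _] _] := hb.
  have [e2|e2] := norm2_O7 O21 n21; first exact: barnes_like_pos.
  have [|//|x1 [x2 [x3 [bx rx]]]] := barnes_like_pos (barnes_like_neg2 hb).
    by rewrite HNl; case: e2 => ->; rewrite opprK; [left | right].
  exists x1, x2, x3; split=> //; exact: refines_trans rx (refines_neg2 _ _ _).
move=> hb; have [_ [_ O31] _ [_ n31] _] := hb.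
have [e3|e3] := norm2_O7 O31 n31; first exact: step2.
have hb' := barnes_like_swap (barnes_like_neg2 (barnes_like_swap hb)).
have [|x1 [x2 [x3 [bx rx]]]] := step2 _ _ _ hb'.
  by rewrite HNl; case: e3 => ->; rewrite opprK; [left | right].
exists x1, x2, x3; split=> //; exact: refines_trans rx (refines_neg3 _ _ _).
Qed.

(* The Barnes lattice is in the genus of <1,1,1>; a binary sublattice lies in a
   sublattice of index 2, and each of the seven of these embeds in <1,1,1>. *)
Lemma barnes_binary (y1 y2 y3 x1 x2 : V) : barnes y1 y2 y3 ->
    span3 y1 y2 y3 x1 -> span3 y1 y2 y3 x2 ->
  exists z1 z2 z3, [/\ orthobasis 1 z1 z2 z3, span3 z1 z2 z3 x1 & span3 z1 z2 z3 x2].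
Proof.
move=> hb [a1 [a2 [a3 [a1O a2O a3O ->]]]] [b1 [b2 [b3 [b1O b2O b3O ->]]]].
have [[r1 h1] [r2 h2] [r3 h3]] := And3 (residue2 a1O) (residue2 a2O) (residue2 a3O).
have [[s1 k1] [s2 k2] [s3 k3]] := And3 (residue2 b1O) (residue2 b2O) (residue2 b3O).
have [t1 [t2 [t3 [tn tr ts]]]] := residue_choice r1 r2 r3 s1 s2 s3.
have [z1 [z2 [z3 [oz hz]]]] := barnes_frames hb tn.
have main (c1 c2 c3 : E) (p1 p2 p3 : bool) : dvO al (c1 - p1%:R) ->
    dvO al (c2 - p2%:R) -> dvO al (c3 - p3%:R) ->
    ~~ odd (t1 * p1 + t2 * p2 + t3 * p3) -> dvO al (residue t1 t2 t3 c1 c2 c3).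
  move=> e1 e2 e3 /even_halfK/esym Dk; set k := _./2 in Dk.
  have -> : residue t1 t2 t3 c1 c2 c3 = t1%:R * (c1 - p1%:R) + t2%:R * (c2 - p2%:R)
     + t3%:R * (c3 - p3%:R) + k%:R * 2.
    have -> : k%:R * 2 = t1%:R * p1%:R + t2%:R * p2%:R + t3%:R * p3%:R :> E.
      by rewrite -!natrM -!natrD Dk -muln2.
    by rewrite /residue; ring.
  apply: dvOD; last first.
    apply: dvOMl; first exact: nat_O.
    have -> : 2 = (1 - al) * al :> E by rewrite mulrBl mul1r al2; ring.
    by rewrite /dvO mulfK // rpredB ?rpred1.
  by apply: dvOD; [apply: dvOD|]; apply: dvOMl; rewrite ?nat_O.
exists z1, z2, z3; split=> //; apply: hz => //.
  exact: (main a1 a2 a3 r1 r2 r3).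
exact: (main b1 b2 b3 s1 s2 s3).
Qed.

Theorem binary_in_unimodular7 (x1 x2 x3 v1 v2 : V) :
    (forall v : V, v != 0 -> 0 < hn v) -> integral3 x1 x2 x3 ->
    gdet x1 x2 x3 = 1%:R -> span3 x1 x2 x3 v1 -> span3 x1 x2 x3 v2 ->
  exists z1 z2 z3, [/\ orthobasis 1 z1 z2 z3, span3 z1 z2 z3 v1 & span3 z1 z2 z3 v2].
Proof.
move=> posd ix gx s1 s2.
have [y1 [y2 [y3 [[iy ry gy] red]]]] := reduced_triple posd euclid7 ix gx isT.
have [r0 r1 r2 r3] : [/\ 0 <= 4 / 7 :> rat, 4 / 7 <= 4 / 7 :> rat, 4 / 7 < 1 :> rat
   & 1%:R < 4 * (1 - 4 / 7) :> rat] by split; lra.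
have [e|[[e1 e2 e3] n21 n31 n32]] := reduced_unimodular posd r0 r1 iy red.
  have [_ h21 h31 h32 [p0 p23 gd]] := red.
  have oy := @reduced_diag _ _ posd (4 / 7) 1 _ _ _ r0 r2 isT r3 iy e h21 h31 h32 p0 p23 gd.
  exists y1, y2, y3; split; [exact: oy | exact: span3_trans ry s1 | exact: span3_trans ry s2].
have {r0 r1 r2 r3 red} hb : barnes_like y1 y2 y3.
  have [[_ _ _] [O21 _ _] [O31 O32 _]] := iy.
  split; [|exact: conj O21 O31|exact: O32|exact: conj n21 n31|exact: n32].
  split; rewrite hnE.
  - by rewrite e1 rmorph_nat.
  - by rewrite e2 rmorph_nat.
  - by rewrite e3 rmorph_nat.
have [z1 [z2 [z3 [bz rz]]]] := barnes_like_barnes hb.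
have r := refines_trans rz ry.
exact: barnes_binary bz (span3_trans r s1) (span3_trans r s2).
Qed.

End Ternary7.

(** * Spaces and lattices with given Gram matrices *)

Section GramSpace.
Variables (m n : nat) (G : 'M[QsqrtN m]_n).
Hypothesis hG : forall i j, G i j = Qconj (G j i).
Local Notation E := (QsqrtN m).

(** The proof of symmetry is an argument, so that the Hermitian structure can be attached to the
    term [gform hG]. *)
Definition gform of (forall i j, G i j = Qconj (G j i)) : 'rV[E]_n -> 'rV[E]_n -> E :=
  form (@Qconj m) G.

Fact gform_bilinear : bilinear_for
  (GRing.Scale.Law.clone _ _ ( *%R ) _)
  (GRing.Scale.Law.clone _ _ (@Qconj m \; *%R) _) (gform hG).
Proof.
by split=> [u'|u] a x y; rewrite /gform /= ?formDl ?formZl ?formDr ?formZr.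
Qed.

HB.instance Definition _ := bilinear_isBilinear.Build _ _ _ _ _ _ (gform hG) gform_bilinear.

Fact gform_hermitian (x y : 'rV[E]_n) :
  gform hG x y = (-1) ^+ false * Qconj (gform hG y x).
Proof.
have GH : G \is (false, @Qconj m : {rmorphism E -> E}).-sesqui%R.
  by rewrite sesquiE expr0 scale1r; apply/eqP/matrixP=> i j; rewrite !mxE.
by rewrite /gform (formC (@QconjK m) GH).
Qed.

HB.instance Definition _ := isHermitianSesquilinear.Build _ _ _ _ (gform hG) gform_hermitian.

Definition gram_space : hermSpace m := HermSpace (gform hG).

End GramSpace.

Section LatticeTheory.
Variables (m : nat) (V : hermSpace m).
Local Notation E := (QsqrtN m).
Local Notation O := (ring_of_integers m).
Local Notation cj := (@Qconj m).
Local Notation H := (hform V).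

Lemma Ospan0 n (v : 'I_n -> V) : Ospan v 0.
Proof.
exists (fun=> 0); first by move=> i; apply: rpred0.
by rewrite big1 // => i _; rewrite scale0r.
Qed.

Lemma OspanD n (v : 'I_n -> V) x y : Ospan v x -> Ospan v y -> Ospan v (x + y).
Proof.
move=> [c cO ->] [d dO ->]; exists (fun i => c i + d i); first by move=> i; rewrite rpredD.
by rewrite -big_split; apply: eq_bigr => i _; rewrite scalerDl.
Qed.

Lemma OspanZ n (v : 'I_n -> V) a x : a \in O -> Ospan v x -> Ospan v (a *: x).
Proof.
move=> aO [c cO ->]; exists (fun i => a * c i); first by move=> i; rewrite rpredM.
by rewrite scaler_sumr; apply: eq_bigr => i _; rewrite scalerA.
Qed.

Lemma Ospan_gen n (v : 'I_n -> V) i : Ospan v (v i).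
Proof.
exists (fun j => (j == i)%:R); first by move=> j; apply: nat_O.
rewrite (bigD1 i) //= eqxx scale1r big1 ?addr0 // => j /negPf->.
by rewrite scale0r.
Qed.

Lemma Ospan_ind n (v : 'I_n -> V) (P : V -> Prop) : P 0 ->
    (forall x y, P x -> P y -> P (x + y)) ->
    (forall a x, a \in O -> P x -> P (a *: x)) -> (forall i, P (v i)) ->
  forall x, Ospan v x -> P x.
Proof.
move=> P0 PD PZ Pv x [c cO ->]; elim/big_ind: _ => // i _; exact: PZ.
Qed.

Section Closure.
Variable L : hermLattice V.

Lemma lat0 : L 0.
Proof. by have [n [v Lv]] := lattice_fg L; apply/Lv; apply: Ospan0. Qed.

Lemma latD x y : L x -> L y -> L (x + y).
Proof. by have [n [v Lv]] := lattice_fg L; move=> /Lv ? /Lv ?; apply/Lv; apply: OspanD. Qed.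

Lemma latZ a x : a \in O -> L x -> L (a *: x).
Proof. by have [n [v Lv]] := lattice_fg L; move=> ? /Lv ?; apply/Lv; apply: OspanZ. Qed.

Lemma latN x : L x -> L (- x).
Proof. by move=> Lx; rewrite -scaleN1r; apply: latZ; rewrite // rpredN rpred1. Qed.

Lemma latB x y : L x -> L y -> L (x - y).
Proof. by move=> Lx Ly; apply: latD => //; apply: latN. Qed.

Lemma lat_cb3 x1 x2 x3 a b c : a \in O -> b \in O -> c \in O ->
  L x1 -> L x2 -> L x3 -> L (cb3 x1 x2 x3 a b c).
Proof. by move=> *; rewrite /cb3; do ?[apply: latD | apply: latZ]. Qed.

Lemma lat_hn_gt0 x : L x -> x != 0 -> 0 < hn x.
Proof. by move=> Lx x0; rewrite -val_hn; apply: lattice_pos Lx x0. Qed.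

Lemma lat_hn_nat x : L x -> exists n : nat, hn x = n%:R.
Proof.
move=> Lx; have h := lattice_integral Lx Lx; rewrite hnE rQ_O in h.
apply/natrP; rewrite -intrEge0 //.
have [->|/(lat_hn_gt0 Lx)/ltW//] := eqVneq x 0.
by rewrite (@hn_uniq _ _ _ 0) // H0l rmorph0.
Qed.

Lemma lat_hn_eq0 x : L x -> hn x = 0 -> x = 0.
Proof.
by move=> Lx h; have [//|/(lat_hn_gt0 Lx)] := eqVneq x 0; rewrite h ltxx.
Qed.

Lemma lat_ospan n (v : 'I_n -> V) x : (forall i, L (v i)) -> Ospan v x -> L x.
Proof.
move=> Lv; apply: Ospan_ind => //; [exact: lat0 | exact: latD | move=> *; exact: latZ].
Qed.

Lemma sublattice_span n (v : 'I_n -> V) : (forall i, L (v i)) ->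
  exists M : hermLattice V, forall x, M x <-> Ospan v x.
Proof.
move=> Lv.
have fg : exists k (w : 'I_k -> V), forall x, Ospan v x <-> Ospan w x by exists n, v.
have int x y : Ospan v x -> Ospan v y -> H x y \in O.
  by move=> hx hy; apply: lattice_integral; apply: lat_ospan Lv _.
have pos x : Ospan v x -> x != 0 -> 0 < val (H x x).
  by move=> hx; apply: lattice_pos; apply: lat_ospan Lv _; exact: hx.
by exists (HermLattice fg int pos).
Qed.

End Closure.

Lemma has_rank_free (L : hermLattice V) (s : seq V) : free s ->
    (forall x, x \in s -> L x) -> (forall x, L x -> x \in <<s>>%VS) ->
  has_rank L (size s).
Proof.
move=> fs sL Ls; exists <<s>>%VS; split=> //; last exact/eqP.
by move=> W LW; apply/span_subvP => x /sL; apply: LW.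
Qed.

Lemma posdef_lattice n (v : 'I_n -> V) : (forall x : V, x != 0 -> 0 < hn x) ->
    (forall i j, H (v i) (v j) \in O) ->
  exists M : hermLattice V, forall x, M x <-> Ospan v x.
Proof.
move=> posd int.
have fg : exists k (w : 'I_k -> V), forall x, Ospan v x <-> Ospan w x by exists n, v.
have inte x y : Ospan v x -> Ospan v y -> H x y \in O.
  move=> hx hy; move: x hx; apply: Ospan_ind; rewrite ?H0l ?rpred0 //.
  - by move=> x z hx hz; rewrite HDl rpredD.
  - by move=> a x aO hx; rewrite HZl rpredM.
  move=> i; move: y hy; apply: Ospan_ind; rewrite ?H0r ?rpred0 //.
  - by move=> x z hx hz; rewrite HDr rpredD.
  by move=> a x aO hx; rewrite HZr rpredM ?cjO.
have pos x : Ospan v x -> x != 0 -> 0 < val (H x x) by move=> _ x0; rewrite val_hn posd.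
by exists (HermLattice fg inte pos).
Qed.

Lemma free2 (x y : V) : H x x * H y y - H x y * H y x != 0 -> free [:: x; y].
Proof.
move=> d; apply/(@freeP _ _ _ (in_tuple [:: x; y])) => k.
rewrite /= !big_ord_recl big_ord0 /= addr0 => e i.
have e1 : k ord0 * H x x + k (lift ord0 ord0) * H y x = 0.
  by rewrite -!HZl -HDl e H0l.
have e2 : k ord0 * H x y + k (lift ord0 ord0) * H y y = 0.
  by rewrite -!HZl -HDl e H0l.
have k0 : k ord0 = 0.
  apply: (mulIf d); rewrite mul0r.
  have -> : k ord0 * (H x x * H y y - H x y * H y x) =
    (k ord0 * H x x + k (lift ord0 ord0) * H y x) * H y y -
    (k ord0 * H x y + k (lift ord0 ord0) * H y y) * H y x by ring.
  by rewrite e1 e2 !mul0r subr0.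
have k1 : k (lift ord0 ord0) = 0.
  apply: (mulIf d); rewrite mul0r.
  have -> : k (lift ord0 ord0) * (H x x * H y y - H x y * H y x) =
    (k ord0 * H x y + k (lift ord0 ord0) * H y y) * H x x -
    (k ord0 * H x x + k (lift ord0 ord0) * H y x) * H x y by ring.
  by rewrite e1 e2 !mul0r subr0.
case: (unliftP ord0 i) => [j ->|->] //.
by rewrite (ord1 j).
Qed.

Lemma nonisotropic_orthogonal_free (s : seq V) : (forall i, (i < size s)%N -> H s`_i s`_i != 0) ->
  (forall i j, (i < size s)%N -> (j < size s)%N -> i != j -> H s`_i s`_j = 0) -> free s.
Proof.
move=> h1 h2; apply/(@freeP _ _ _ (in_tuple s)) => k e i.
have : H (\sum_(i < size s) k i *: s`_i) s`_i = 0 by rewrite [X in H X]e H0l.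
rewrite linear_sumlz (bigD1 i) //= big1 ?addr0; last first.
  by move=> j ji; rewrite linearZl_LR /= h2 ?mulr0.
by rewrite linearZl_LR /= => /eqP; rewrite mulf_eq0 (negPf (h1 _ (ltn_ord i))) orbF => /eqP.
Qed.

End LatticeTheory.

(** * Bases of binary lattices over a Euclidean ring *)

Section BinaryBasis.
Variables (m : nat) (V : hermSpace m).
Local Notation E := (QsqrtN m).
Local Notation O := (ring_of_integers m).
Local Notation cj := (@Qconj m).
Local Notation H := (hform V).
Hypothesis euc : forall a : E, exists2 q, q \in O & nrm (a - q) < 1.

Lemma proj_norm_comb (x y : V) (a k : E) :
  proj_norm x (a *: x + k *: y) = nrm k * proj_norm x y.
Proof.
apply: (@rQ_inj m); rewrite rmorphM /= !proj_normE nrmE /proj_form !HE; ring.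
Qed.

Lemma proj_normC (x y : V) : proj_norm x y = proj_norm y x.
Proof. rewrite /proj_norm (HC y x) nrm_cj mulrC. by []. Qed.

(** Positivity is known only for vectors of [L], so the component of [y] orthogonal to [x] is
    multiplied by H(x, x) to lie in [L]. *)
Lemma proj_norm_indep (L : hermLattice V) (x y : V) : L x -> L y -> x != 0 ->
  y \notin <[x]>%VS -> 0 < proj_norm x y.
Proof.
move=> Lx Ly x0 yx; have hx := lat_hn_gt0 Lx x0.
have Hx : H x x != 0 by rewrite hnE fmorph_eq0 gt_eqF.
pose u := H x x *: y - H y x *: x.
have Lu : L u by apply: latB; apply: latZ => //; apply: (lattice_integral (h := L)).
have u0 : u != 0.
  apply: contra yx; rewrite subr_eq0 => /eqP e; apply/vlineP.
  by exists ((H x x)^-1 * H y x); rewrite -scalerA -e scalerA mulVf // scale1r.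
have := lat_hn_gt0 Lu u0; have -> : hn u = hn x * proj_norm x y.
  apply: (@rQ_inj m); rewrite rmorphM /= proj_normE -!hnE /proj_form /u.
  by rewrite !HE -!HC; ring.
by rewrite pmulr_rgt0.
Qed.

(** A pair of least positive Gram determinant is a basis: if k u + l v is in the lattice and l is
    not integral, replacing v by k u + (l - q) v with q near l multiplies the determinant by N(l -
    q) < 1. So all binary lattices over a Euclidean O are free. *)
Lemma binary_basis (L : hermLattice V) : has_rank L 2 ->
  exists x y, [/\ L x, L y, 0 < proj_norm x y &
    forall z, L z -> exists a b, [/\ a \in O, b \in O & z = a *: x + b *: y]].
Proof.
move=> [U [LU Umin dU]].
have line_bad (v : V) : ~ (forall x, L x -> x \in <[v]>%VS).
  by move=> /Umin/dimvS; rewrite dU dim_vline; case: (v != 0).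
have [x [Lx x0]] : exists x, L x /\ x != 0.
  apply: NNPP => no; apply: (line_bad 0) => x Lx.
  have [->|x0] := eqVneq x 0; first exact: mem0v.
  by case: no; exists x.
have [y [Ly yx]] : exists y, L y /\ y \notin <[x]>%VS.
  apply: NNPP => no; apply: (line_bad x) => y Ly; apply: NNPP => /negP h.
  by apply: no; exists y.
pose P (p : V * V) := [/\ L p.1, L p.2 & 0 < proj_norm p.1 p.2].
have [||[x1 y1] [[/= Lx1 Ly1 p1] min1]] := @exists_min _ P (fun p : V * V => proj_norm p.1 p.2).
- move=> [u v] [/= Lu Lv pos]; rewrite -intrEge0 ?ltW //.
  have int (s t : V) : L s -> L t -> H s t \in O by apply: lattice_integral.
  by rewrite -(@rQ_O m) proj_normE /proj_form rpredB ?rpredM // int.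
- by exists (x, y); split=> //; apply: (proj_norm_indep Lx).
exists x1, y1; split=> // z Lz.
have fr : free [:: x1; y1].
  apply: free2; have -> : H x1 x1 * H y1 y1 - H x1 y1 * H y1 x1 = rQ m (proj_norm x1 y1).
    by rewrite proj_normE /proj_form [X in _ - X]mulrC.
  by rewrite fmorph_eq0 gt_eqF.
have zU : z \in <<[:: x1; y1]>>%VS.
  have : (<<[:: x1; y1]>> <= U)%VS.
    by apply/span_subvP => t; rewrite !inE => /orP[/eqP->|/eqP->]; apply: LU.
  move=> sub; have := eqEdim <<[:: x1; y1]>>%VS U.
  by rewrite sub dU (eqP fr) /= => /eqP->; apply: LU.
have [a [b Dz]] : exists a b, z = a *: x1 + b *: y1.
  move: zU; rewrite span_cons span_seq1 => /memv_addP[u /vlineP[a ->] [v /vlineP[b ->] ->]].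
  by exists a, b.
have main (u v : V) (k l : E) : P (u, v) -> (forall w, L w -> 0 < proj_norm u w -> proj_norm u v <= proj_norm u w) ->
    L (k *: u + l *: v) -> l \in O.
  move=> [/= Lu Lv puv] mn Lw; have [q qO hq] := euc l.
  have [/eqP|nz] := eqVneq (l - q) 0; first by rewrite subr_eq0 => /eqP->.
  have Lw' : L (k *: u + (l - q) *: v).
    by rewrite scalerBl addrA; apply: latB => //; apply: latZ.
  have pw := proj_norm_comb u v k (l - q).
  have : 0 < proj_norm u (k *: u + (l - q) *: v) by rewrite pw mulr_gt0 ?nrm_gt0.
  by move=> /(mn _ Lw'); rewrite pw leNgt gtr_pMl // hq.
exists a, b; split=> //.
- apply: (main y1 x1 b a).
  + by split=> //=; rewrite proj_normC.
  + by move=> w Lw pw; rewrite proj_normC; apply: (min1 (y1, w)).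
  by rewrite addrC -Dz.
apply: (main x1 y1 a b) => //; last by rewrite -Dz.
by move=> w Lw pw; apply: (min1 (x1, w)).
Qed.

End BinaryBasis.

Section Gram3.
Variable m : nat.
Local Notation E := (QsqrtN m).
Local Notation O := (ring_of_integers m).
Local Notation cj := (@Qconj m).

Definition gram3_mx (a d k : rat) (b : E) : 'M[E]_3 := \matrix_(i, j)
  match val i, val j with
  | 0%N, 0%N => rQ m a | 1%N, 1%N => rQ m d | 2%N, 2%N => rQ m k
  | 0%N, 1%N => b | 1%N, 0%N => cj b | _, _ => 0
  end.

Fact gram3_herm a d k b (i j : 'I_3) : gram3_mx a d k b i j = cj (gram3_mx a d k b j i).
Proof.
rewrite !mxE; case: i => [[|[|[|//]]] ?]; case: j => [[|[|[|//]]] ?] /=;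
  by rewrite ?cj_rQ ?QconjK ?cj0.
Qed.

Lemma gram3_space (a d k : rat) (b : E) : 0 < a -> nrm b < a * d -> 0 < k ->
  exists (S : hermSpace m) (x1 x2 x3 : S),
   [/\ [/\ hform S x1 x1 = rQ m a, hform S x2 x2 = rQ m d & hform S x3 x3 = rQ m k],
     hform S x1 x2 = b, hform S x3 x1 = 0, hform S x3 x2 = 0 &
     forall v : S, v != 0 -> 0 < hn v].
Proof.
move=> a0 hb k0; pose S := gram_space (gram3_herm a d k b).
pose e (i : 'I_3) : S := ('e_i : 'rV[E]_3).
have He i j : hform S (e i) (e j) = gram3_mx a d k b i j by exact: formee.
pose i0 : 'I_3 := ord0; pose i1 : 'I_3 := lift ord0 ord0; pose i2 : 'I_3 := lift ord0 (lift ord0 ord0).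
exists S, (e i0), (e i1), (e i2); split; try by rewrite !He !mxE.
move=> v v0; have [p [q [r Dv]]] : exists p q r, v = cb3 (e i0) (e i1) (e i2) p q r.
  exists ((v : 'rV[E]_3) 0 i0), ((v : 'rV[E]_3) 0 i1), ((v : 'rV[E]_3) 0 i2).
  have := row_sum_delta (v : 'rV[E]_3).
  rewrite !big_ord_recl big_ord0 addr0 addrA; exact.
(* Completing the square; the coefficients are positive. *)
have E0 : a * hn v = nrm (rQ m a * p + q * cj b) + (a * d - nrm b) * nrm q + a * k * nrm r.
  apply: (@rQ_inj m); rewrite !(rmorphD, rmorphM, rmorphN) /= !nrmE -hnE Dv.
  rewrite Hcb3l !Hcb3r !He !mxE /= ?(cjD, cjM, QconjK, cj_rQ).
  by ring.
suff : 0 < a * hn v by rewrite pmulr_rgt0.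
rewrite E0; have [q0|q0] := eqVneq q 0; last first.
  have h1 : 0 < (a * d - nrm b) * nrm q by rewrite mulr_gt0 ?nrm_gt0 ?subr_gt0.
  have := nrm_ge0 (rQ m a * p + q * cj b); have h2 : 0 <= a * k * nrm r.
    by rewrite !mulr_ge0 ?nrm_ge0 // ltW.
  lra.
rewrite q0 nrm0 mulr0 mul0r !addr0.
have [r0|r0] := eqVneq r 0.
  rewrite r0 nrm0 mulr0 addr0 nrm_gt0 mulf_neq0 //; first by rewrite fmorph_eq0 gt_eqF.
  apply: contra v0 => /eqP p0; rewrite Dv p0 q0 r0 /cb3 !scale0r !addr0; exact: eqxx.
by rewrite ltr_wpDl ?nrm_ge0 // !mulr_gt0 // nrm_gt0.
Qed.

End Gram3.

(** * 2-universal ternary lattices *)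

Section TernaryUniversal.
Variables (m c : nat).
Local Notation E := (QsqrtN m).
Local Notation O := (ring_of_integers m).
Local Notation cj := (@Qconj m).
Hypothesis euc : forall a : E, exists2 q, q \in O & nrm (a - q) < 1.
Hypotheses (sqf : squarefree m) (m0 : (0 < m)%N) (c0 : (0 < c)%N).

Hypothesis binary_embeds : forall (S : hermSpace m) (x1 x2 x3 v1 v2 : S),
  (forall v : S, v != 0 -> 0 < hn v) -> integral3 x1 x2 x3 ->
  gdet x1 x2 x3 = c%:R -> span3 x1 x2 x3 v1 -> span3 x1 x2 x3 v2 ->
  exists z1 z2 z3, [/\ orthobasis c z1 z2 z3, span3 z1 z2 z3 v1 & span3 z1 z2 z3 v2].

(** The added vector has norm c D with D = a d - N(b), whence the determinant c D^2 = c N(D). The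
    conclusion is stated in coordinates, to be transferred to any space containing a copy of <1, 1,
    c>. *)
Lemma binary_gram_embeds (a d : rat) (b : E) : rQ m a \in O -> rQ m d \in O -> b \in O ->
    0 < a -> nrm b < a * d ->
  exists p1 p2 p3 q1 q2 q3 : E,
   [/\ [/\ p1 \in O, p2 \in O & p3 \in O], [/\ q1 \in O, q2 \in O & q3 \in O],
    p1 * cj p1 + p2 * cj p2 + c%:R * (p3 * cj p3) = rQ m a,
    q1 * cj q1 + q2 * cj q2 + c%:R * (q3 * cj q3) = rQ m d &
    p1 * cj q1 + p2 * cj q2 + c%:R * (p3 * cj q3) = b].
Proof.
move=> aO dO bO a0 hb; pose D : E := rQ m (a * d - nrm b).
have Dpos : 0 < a * d - nrm b by rewrite subr_gt0.
have D0 : D != 0 by rewrite fmorph_eq0 gt_eqF.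
have DO : D \in O.
  by rewrite /D rmorphB rmorphM /= nrmE; apply: rpredB; apply: rpredM; rewrite ?cjO.
have cr0 : 0 < c%:R :> rat by rewrite ltr0n.
have [S [x1 [x2 [x3 [[H11 H22 H33] H12 H31 H32 posd]]]]] :=
  gram3_space a0 hb (mulr_gt0 cr0 Dpos).
have H21 : hform S x2 x1 = cj b by rewrite HC H12.
have H13 : hform S x1 x3 = 0 by rewrite HC H31 cj0.
have H23 : hform S x2 x3 = 0 by rewrite HC H32 cj0.
have H33' : hform S x3 x3 = c%:R * D by rewrite H33 rmorphM /= rmorph_nat.
have ix : integral3 x1 x2 x3.
  rewrite /integral3 H11 H12 H13 H21 H22 H23 H31 H32 H33'.
  by split; split; rewrite ?rpred0 ?cjO //; apply: rpredM; rewrite ?nat_O.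
have gx : gdet x1 x2 x3 = c%:R * (D * cj D).
  rewrite /gdet /det3 H11 H12 H13 H21 H22 H23 H31 H32 H33' cj_rQ /D.
  by rewrite rmorphB rmorphM /= nrmE; ring.
have [y1 [y2 [y3 [iy ry gy]]]] := descent euc sqf m0 DO D0 ix gx.
have [s1 s2 _] := ry.
have [z1 [z2 [z3 [oz [p1 [p2 [p3 [p1O p2O p3O D1]]]] [q1 [q2 [q3 [q1O q2O q3O D2]]]]]]]] :=
  binary_embeds posd iy gy s1 s2.
exists p1, p2, p3, q1, q2, q3.
have [[K11 K22 K33] K21 K31 K32] := oz.
have K12 : hform S z1 z2 = 0 by rewrite HC K21 cj0.
have K13 : hform S z1 z3 = 0 by rewrite HC K31 cj0.
have K23 : hform S z2 z3 = 0 by rewrite HC K32 cj0.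
have HH a1 a2 a3 b1 b2 b3 : hform S (cb3 z1 z2 z3 a1 a2 a3) (cb3 z1 z2 z3 b1 b2 b3)
    = a1 * cj b1 + a2 * cj b2 + c%:R * (a3 * cj b3).
  by rewrite Hcb3l !Hcb3r K11 K22 K33 K12 K13 K23 K21 K31 K32; ring.
by split=> //; rewrite -HH -?D1 -?D2.
Qed.

(* [f x] is computed from the coordinates of [x] in a basis of the binary lattice. *)
Theorem ternary_two_universal (V : hermSpace m) (L : hermLattice V) (e1 e2 e3 : V) :
    L e1 -> L e2 -> L e3 -> orthobasis c e1 e2 e3 ->
  exists M : hermLattice V, [/\ sublattice M L, has_rank M 3 & two_universal M].
Proof.
move=> Le1 Le2 Le3 [[K11 K22 K33] K21 K31 K32].
have K12 : hform V e1 e2 = 0 by rewrite HC K21 cj0.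
have K13 : hform V e1 e3 = 0 by rewrite HC K31 cj0.
have K23 : hform V e2 e3 = 0 by rewrite HC K32 cj0.
have HH a1 a2 a3 b1 b2 b3 : hform V (cb3 e1 e2 e3 a1 a2 a3) (cb3 e1 e2 e3 b1 b2 b3)
    = a1 * cj b1 + a2 * cj b2 + c%:R * (a3 * cj b3).
  by rewrite Hcb3l !Hcb3r K11 K22 K33 K12 K13 K23 K21 K31 K32; ring.
pose ev (i : 'I_3) := [:: e1; e2; e3]`_i.
have Lev i : L (ev i) by rewrite /ev; case: i => [[|[|[|//]]] ?].
have [M DM] := sublattice_span Lev.
have cE : c%:R != 0 :> E by case: (c) c0 => // ? _; apply: natE_neq0.
have Me i : M (ev i) by apply/DM; apply: Ospan_gen.
have [M1 M2 M3] : [/\ M e1, M e2 & M e3].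
  by split; [exact: (Me ord0) | exact: (Me (lift ord0 ord0)) | exact: (Me ord_max)].
exists M; split.
- by move=> x /DM; apply: lat_ospan.
- apply: (has_rank_free (s := [:: e1; e2; e3])).
  + apply: nonisotropic_orthogonal_free => /=.
      by case=> [|[|[|//]]] _ /=; rewrite ?K11 ?K22 ?K33 ?oner_neq0.
    by case=> [|[|[|//]]] [|[|[|//]]] //= _ _ _.
  + by move=> x; rewrite !inE => /or3P[] /eqP->.
  move=> x /DM [a _ ->]; apply: memv_suml => i _; apply: memvZ; apply: memv_span.
  by rewrite /ev; apply: mem_nth.
move=> W N rN; have [w1 [w2 [Nw1 Nw2 pd bas]]] := binary_basis euc rN.
have O11 : hform W w1 w1 \in O by exact: (lattice_integral Nw1 Nw1).
have O12 : hform W w1 w2 \in O by exact: (lattice_integral Nw1 Nw2).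
have O22 : hform W w2 w2 \in O by exact: (lattice_integral Nw2 Nw2).
have a0 : 0 < hn w1.
  apply: (lat_hn_gt0 Nw1); apply: contraTneq pd => ->.
  by rewrite /proj_norm (@hn_uniq _ _ 0 0) ?H0l ?rmorph0 // mul0r H0r nrm0 subr0 ltxx.
have hb : nrm (hform W w1 w2) < hn w1 * hn w2.
  by move: pd; rewrite /proj_norm subr_gt0 HC nrm_cj.
rewrite !hnE in O11 O22.
have [p1 [p2 [p3 [q1 [q2 [q3 [[p1O p2O p3O] [q1O q2O q3O] Epp Eqq Epq]]]]]]] :=
  binary_gram_embeds O11 O22 O12 a0 hb.
rewrite -!hnE in Epp Eqq; rewrite -!hnE in O11 O22.
set f1 := cb3 e1 e2 e3 p1 p2 p3; set f2 := cb3 e1 e2 e3 q1 q2 q3.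
have F11 : hform V f1 f1 = hform W w1 w1 by rewrite HH.
have F22 : hform V f2 f2 = hform W w2 w2 by rewrite HH.
have F12 : hform V f1 f2 = hform W w1 w2 by rewrite HH.
have F21 : hform V f2 f1 = hform W w2 w1 by rewrite HC F12 -HC.
have Mf1 : M f1 by apply: lat_cb3.
have Mf2 : M f2 by apply: lat_cb3.
clearbody f1 f2.
pose D : E := hform W w1 w1 * hform W w2 w2 - hform W w1 w2 * hform W w2 w1.
have D0 : D != 0.
  have -> : D = rQ m (proj_norm w1 w2) by rewrite proj_normE /D /proj_form [X in _ - X]mulrC.
  by rewrite fmorph_eq0 gt_eqF.
(* Cramer's rule for the coordinates in w1, w2, written with the form so that [A] and [B] are
   defined on all of [W]. *)
pose A x := (hform W x w1 * hform W w2 w2 - hform W x w2 * hform W w2 w1) / D.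
pose B x := (hform W x w2 * hform W w1 w1 - hform W x w1 * hform W w1 w2) / D.
have AB a b : A (a *: w1 + b *: w2) = a /\ B (a *: w1 + b *: w2) = b.
  by split; rewrite /A /B !HDl !HZl; apply: (mulIf D0); rewrite divfK // /D; ring.
pose f x := A x *: f1 + B x *: f2.
have fE a b : f (a *: w1 + b *: w2) = a *: f1 + b *: f2.
  by rewrite /f; have [-> ->] := AB a b.
exists f; split.
- by move=> x /bas[a [b [aO bO ->]]]; rewrite fE; apply: latD; apply: latZ.
- move=> x y /bas[a [b [_ _ ->]]] /bas[a' [b' [_ _ ->]]].
  have -> : a *: w1 + b *: w2 + (a' *: w1 + b' *: w2) = (a + a') *: w1 + (b + b') *: w2.
    by rewrite !scalerDl addrACA.
  by rewrite !fE !scalerDl addrACA.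
- move=> k x _ /bas[a [b [_ _ ->]]].
  by rewrite scalerDr !scalerA !fE scalerDr !scalerA.
move=> x y /bas[a [b [_ _ ->]]] /bas[a' [b' [_ _ ->]]]; rewrite !fE.
by rewrite !HDl !HDr !HZl !HZr F11 F12 F21 F22.
Qed.

End TernaryUniversal.

(** * Quaternary lattices containing <1,1> *)

Section Tests.
Variables (m : nat) (V : hermSpace m) (L : hermLattice V).
Local Notation E := (QsqrtN m).
Local Notation O := (ring_of_integers m).
Local Notation cj := (@Qconj m).
Local Notation H := (hform V).
Hypothesis univ : two_universal L.

Lemma nrm_lt_det (a d : rat) (b : E) (S : hermSpace m) (x1 x2 : S) :
  nrm b < a * d -> hform S x1 x1 = rQ m a -> hform S x2 x2 = rQ m d -> hform S x1 x2 = b ->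
  hform S x1 x1 * hform S x2 x2 - hform S x1 x2 * hform S x2 x1 != 0.
Proof.
move=> hb H11 H22 H12; rewrite (HC x2 x1) H11 H22 H12 -nrmE -rmorphM -rmorphB /=.
by rewrite fmorph_eq0 gt_eqF // subr_gt0.
Qed.

Lemma represents_binary (a d : nat) (b : E) : b \in O -> (0 < a)%N -> nrm b < (a * d)%:R ->
  exists y1 y2, [/\ L y1, L y2, H y1 y1 = a%:R, H y2 y2 = d%:R & H y1 y2 = b].
Proof.
move=> bO a0; rewrite natrM => hb.
have a0' : 0 < a%:R :> rat by rewrite ltr0n.
have [S [x1 [x2 [_ [[H11 H22 _] H12 _ _ posd]]]]] := gram3_space a0' hb ltr01.
pose v (i : 'I_2) := if i == ord0 then x1 else x2.
have vint i j : hform S (v i) (v j) \in O.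
  rewrite /v; case: ifP => _; case: ifP => _.
  - by rewrite H11 rQ_O natr_int.
  - by rewrite H12.
  - by rewrite HC cjO H12.
  by rewrite H22 rQ_O natr_int.
have [M DM] := posdef_lattice posd vint.
have Mv i : M (v i) by apply/DM; apply: Ospan_gen.
have [M1 M2] : M x1 /\ M x2 by split; [exact: (Mv ord0) | exact: (Mv ord_max)].
have rM : has_rank M 2.
  apply: (has_rank_free (s := [:: x1; x2])).
  - exact/free2/(nrm_lt_det hb).
  - by move=> x; rewrite !inE => /orP[]/eqP->.
  move=> x /DM[c _ ->]; apply: memv_suml => i _; apply: memvZ; apply: memv_span.
  by rewrite /v !inE; case: ifP; rewrite eqxx ?orbT.
have [f [fL _ _ fH]] := univ rM.
exists (f x1), (f x2); split; rewrite ?fH ?H11 ?H22 ?H12 ?rmorph_nat //; exact: fL.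
Qed.

(** The lattice is I x1 + I x2 for the fractional ideal I = O + O (w / 2), with x1, x2 orthogonal of
    norm 2. It is integral because (w / 2) x1 has norm N(w) / 2. *)
Lemma represents_nonfree (w : E) : w \in O -> (1 / 2 * (w * cj w)) \in O ->
  exists u1 u2, [/\ L u1, L u2, L ((w / 2) *: u1), L ((w / 2) *: u2) &
    [/\ H u1 u1 = 2, H u2 u2 = 2 & H u1 u2 = 0]].
Proof.
move=> wO nwO; have h2 := two_neq0 m.
have hb : nrm (0 : E) < 2 * 2 by rewrite nrm0.
have [S [x1 [x2 [_ [[H11 H22 _] H12 _ _ posd]]]]] := gram3_space (ltr0n _ 2) hb ltr01.
have H21 : hform S x2 x1 = 0 by rewrite HC H12 cj0.
rewrite rmorph_nat in H11 H22.
pose g (i : 'I_4) : S := [:: x1; x2; (w / 2) *: x1; (w / 2) *: x2]`_i.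
have e2 : w / 2 * 2 = w by rewrite divfK.
have e3 : cj (w / 2) * 2 = cj w by rewrite cjM cjV cjn divfK.
have e4 : w / 2 * (cj (w / 2) * 2) = 1 / 2 * (w * cj w) by rewrite e3; field.
have gint i j : hform S (g i) (g j) \in O.
  rewrite /g; case: i => [[|[|[|[|//]]]] ?]; case: j => [[|[|[|[|//]]]] ?] /=;
  by rewrite ?HZl ?HZr ?H11 ?H22 ?H12 ?H21 ?mulr0 ?e4 ?e2 ?e3 ?rpred0 ?nat_O ?cjO.
have [M DM] := posdef_lattice posd gint.
have Mg i : M (g i) by apply/DM; apply: Ospan_gen.
have M1 : M x1 := Mg (@Ordinal 4 0 isT).
have M2 : M x2 := Mg (@Ordinal 4 1 isT).
have M3 : M ((w / 2) *: x1) := Mg (@Ordinal 4 2 isT).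
have M4 : M ((w / 2) *: x2) := Mg (@Ordinal 4 3 isT).
have rM : has_rank M 2.
  apply: (has_rank_free (s := [:: x1; x2])).
  - by apply: free2; rewrite H11 H22 H12 mul0r subr0 mulf_neq0.
  - by move=> x; rewrite !inE => /orP[]/eqP->.
  have S1 : x1 \in <<[:: x1; x2]>>%VS by rewrite memv_span // !inE eqxx.
  have S2 : x2 \in <<[:: x1; x2]>>%VS by rewrite memv_span // !inE eqxx orbT.
  move=> x /DM[c _ ->]; apply: memv_suml => i _; apply: memvZ; rewrite /g.
  by case: i => [[|[|[|[|//]]]] ?] /=; rewrite ?memvZ.
have [f [fL _ fZ fH]] := univ rM.
(* [f] is linear over O only and w / 2 need not be integral; both sides are compared after
   multiplication by 2. *)
have fw x : M x -> M ((w / 2) *: x) -> f ((w / 2) *: x) = (w / 2) *: f x.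
  move=> Mx Mwx; apply: (scalerI h2); rewrite -(fZ 2 _ (nat_O _ _) Mwx) !scalerA.
  by rewrite mulrC divfK // fZ.
exists (f x1), (f x2); rewrite -!fw // !fH //.
by split=> //; exact: fL.
Qed.

End Tests.

(** * Splitting off orthonormal vectors e1, e2 *)

Section Rank4.
Variables (m : nat) (V : hermSpace m) (L : hermLattice V).
Local Notation E := (QsqrtN m).
Local Notation O := (ring_of_integers m).
Local Notation cj := (@Qconj m).
Local Notation H := (hform V).
Implicit Types x y z : V.

Lemma has_rank_span (s : seq V) : has_rank L (size s) -> free s ->
  (forall x, x \in s -> L x) -> forall x, L x -> x \in <<s>>%VS.
Proof.
move=> [U [LU _ dU]] fs sL x Lx.
have sub : (<<s>> <= U)%VS by apply/span_subvP => y /sL; apply: LU.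
by have := eqEdim <<s>>%VS U; rewrite sub dU (eqP fs) leqnn => /eqP->; apply: LU.
Qed.

Lemma free4 (e1 e2 x1 x2 : V) : H e1 e1 = 1 -> H e2 e2 = 1 -> H e1 e2 = 0 ->
    H x1 e1 = 0 -> H x1 e2 = 0 -> H x2 e1 = 0 -> H x2 e2 = 0 ->
    H x1 x1 * H x2 x2 - H x1 x2 * H x2 x1 != 0 -> free [:: e1; e2; x1; x2].
Proof.
move=> h11 h22 h12 h1 h2 h3 h4 d.
have h21 : H e2 e1 = 0 by rewrite HC h12 cj0.
apply/(@freeP _ _ _ (in_tuple [:: e1; e2; x1; x2])) => k.
rewrite /= !big_ord_recl big_ord0 /= addr0.
set k1 := k ord0; set k2 := k (lift _ _); set k3 := k (lift _ _); set k4 := k (lift _ _).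
rewrite !addrA => e.
have e1' y : k1 * H e1 y + k2 * H e2 y + k3 * H x1 y + k4 * H x2 y = 0.
  by rewrite -!HZl -!HDl e H0l.
have k10 : k1 = 0.
  by have := e1' e1; rewrite h11 h21 h1 h3 !mulr0 !addr0 mulr1.
have k20 : k2 = 0.
  by have := e1' e2; rewrite h12 h22 h2 h4 !mulr0 !addr0 add0r mulr1.
move: e; rewrite k10 k20 !scale0r !add0r => e34.
have /(@freeP _ _ _ (in_tuple [:: x1; x2]))/(_ (fun i => if i == ord0 then k3 else k4)) := free2 d.
rewrite /= !big_ord_recl big_ord0 /= addr0 => /(_ e34) h.
have k30 : k3 = 0 := h ord0.
have k40 : k4 = 0 := h (lift ord0 ord0).
move=> i; case: (unliftP ord0 i) => [j ->|-> //].
case: (unliftP ord0 j) => [{}j ->|-> //].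
case: (unliftP ord0 j) => [{}j ->|-> //].
by rewrite (ord1 j).
Qed.

Hypothesis rL : has_rank L 4.
Variables (e1 e2 : V).
Hypotheses (Le1 : L e1) (Le2 : L e2) (he1 : H e1 e1 = 1) (he2 : H e2 e2 = 1) (he12 : H e1 e2 = 0).

Let he21 : H e2 e1 = 0. Proof. by rewrite HC he12 cj0. Qed.

Lemma lat_form x y : L x -> L y -> H x y \in O.
Proof. exact: lattice_integral. Qed.

(** The projection onto the complement of e1, e2; it maps L to itself because e1 and e2 are
    orthonormal vectors of L. *)
Definition perp x : V := x - (H x e1 *: e1 + H x e2 *: e2).

Lemma perpE x : x = H x e1 *: e1 + H x e2 *: e2 + perp x.
Proof. by rewrite /perp addrC subrK. Qed.

Lemma perp_lat x : L x -> L (perp x).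
Proof. by move=> Lx; apply: latB => //; apply: latD; apply: latZ => //; apply: lat_form. Qed.

Lemma perp_e1 x : H (perp x) e1 = 0.
Proof. by rewrite /perp HBl HDl !HZl he1 he21; ring. Qed.

Lemma perp_e2 x : H (perp x) e2 = 0.
Proof. by rewrite /perp HBl HDl !HZl he2 he12; ring. Qed.

Lemma form_perp x y : H x y = H x e1 * cj (H y e1) + H x e2 * cj (H y e2) + H (perp x) (perp y).
Proof.
rewrite /perp !(HBl, HBr, HDl, HDr, HZl, HZr) he1 he2 he12 he21 (HC e1 y) (HC e2 y); ring.
Qed.

Lemma hn_perp x : hn x = nrm (H x e1) + nrm (H x e2) + hn (perp x).
Proof.
by apply: (@rQ_inj m); rewrite !rmorphD /= !nrmE -!hnE form_perp.
Qed.

(** By rank, e1, e2, x1, x2 span L over E, so [c1] and [c2] are only in E; the two equations are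
    what integrality is later derived from. *)
Lemma lat_coords x1 x2 (a d b : E) : L x1 -> L x2 ->
    H x1 e1 = 0 -> H x1 e2 = 0 -> H x2 e1 = 0 -> H x2 e2 = 0 ->
    H x1 x1 = a -> H x2 x2 = d -> H x1 x2 = b -> a * d - b * cj b != 0 ->
  forall z, L z -> exists c1 c2, [/\ perp z = c1 *: x1 + c2 *: x2,
    c1 * a + c2 * cj b = H z x1 & c1 * b + c2 * d = H z x2].
Proof.
move=> L1 L2 h1 h2 h3 h4 Ha Hd Hb D z Lz.
have H21 : H x2 x1 = cj b by rewrite HC Hb.
have fr : free [:: e1; e2; x1; x2] by apply: free4; rewrite ?Ha ?Hd ?Hb ?H21.
have sL x : x \in [:: e1; e2; x1; x2] -> L x by rewrite !inE => /or4P[]/eqP->.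
have := has_rank_span (rL : has_rank L (size [:: e1; e2; x1; x2])) fr sL Lz.
rewrite !span_cons span_nil addv0 => /memv_addP[_ /vlineP[k1 ->] [w1 + Dz]].
move=> /memv_addP[_ /vlineP[k2 ->] [w2 + Dw1]].
move=> /memv_addP[_ /vlineP[c1 ->] [_ /vlineP[c2 ->] Dw2]].
have Dz' : z = k1 *: e1 + (k2 *: e2 + (c1 *: x1 + c2 *: x2)) by rewrite Dz Dw1 Dw2.
have hz y : H z y = k1 * H e1 y + (k2 * H e2 y + (c1 * H x1 y + c2 * H x2 y)).
  by rewrite Dz' !HDl !HZl.
have k1E : H z e1 = k1 by rewrite hz he1 he21 h1 h3; ring.
have k2E : H z e2 = k2 by rewrite hz he2 he12 h2 h4; ring.
have g1 : H e1 x1 = 0 by rewrite HC h1 cj0.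
have g2 : H e1 x2 = 0 by rewrite HC h3 cj0.
have g3 : H e2 x1 = 0 by rewrite HC h2 cj0.
have g4 : H e2 x2 = 0 by rewrite HC h4 cj0.
exists c1, c2; split.
- by rewrite /perp k1E k2E {1}Dz' addrA addrC addrK.
- by rewrite hz g1 g3 Ha H21; ring.
by rewrite hz g2 g4 Hb Hd; ring.
Qed.

(** Completing the square; for determinant 1, a times the norm is a sum of two norms from O. *)
Lemma hn_comb2 x1 x2 (a d : nat) (b c1 c2 : E) :
    H x1 x1 = a%:R -> H x2 x2 = d%:R -> H x1 x2 = b ->
  a%:R * hn (c1 *: x1 + c2 *: x2) = nrm (a%:R * c1 + c2 * cj b) + (a%:R * d%:R - nrm b) * nrm c2.
Proof.
move=> Ha Hd Hb; have H21 : H x2 x1 = cj b by rewrite HC Hb.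
apply: (@rQ_inj m); rewrite !(rmorphD, rmorphM, rmorphN) /= !nrmE -hnE !rmorph_nat.
rewrite !(HDl, HDr, HZl, HZr) Ha Hd Hb H21 ?(cjD, cjM, QconjK, cjn); ring.
Qed.

Theorem isometric_gram4 x1 x2 (a b b' d : E) : L x1 -> L x2 ->
    H x1 e1 = 0 -> H x1 e2 = 0 -> H x2 e1 = 0 -> H x2 e2 = 0 ->
    H x1 x1 = a -> H x2 x2 = d -> H x1 x2 = b -> H x2 x1 = b' -> a * d - b * b' != 0 ->
    (forall z, L z -> exists c1 c2, [/\ c1 \in O, c2 \in O & perp z = c1 *: x1 + c2 *: x2]) ->
  isometric_gram L (orthosum_gram (diag_gram [:: 1; 1]) (binary_gram a b b' d)).
Proof.
move=> L1 L2 h1 h2 h3 h4 Ha Hd Hb Hb' D span.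
have refl : isometric L L.
  suff r : represents L L by split.
  by exists id; split.
exists V, L; split=> //.
have g1 : H e1 x1 = 0 by rewrite HC h1 cj0.
have g2 : H e1 x2 = 0 by rewrite HC h3 cj0.
have g3 : H e2 x1 = 0 by rewrite HC h2 cj0.
have g4 : H e2 x2 = 0 by rewrite HC h4 cj0.
have fr : free [:: e1; e2; x1; x2] by apply: free4; rewrite ?Ha ?Hd ?Hb ?Hb'.
pose v (i : 'I_(2 + 2)) : V := [:: e1; e2; x1; x2]`_i.
have Lv i : L (v i) by rewrite /v; case: i => [[|[|[|[|//]]]] ?].
exists v; split.
- move=> z; split; last by apply: lat_ospan.
  move=> Lz; have [c1 [c2 [c1O c2O Dz]]] := span z Lz.
  rewrite (perpE z) Dz.
  have o1 : Ospan v e1 := Ospan_gen v (@Ordinal 4 0 isT).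
  have o2 : Ospan v e2 := Ospan_gen v (@Ordinal 4 1 isT).
  have o3 : Ospan v x1 := Ospan_gen v (@Ordinal 4 2 isT).
  have o4 : Ospan v x2 := Ospan_gen v (@Ordinal 4 3 isT).
  by do ?[apply: OspanD | apply: OspanZ]; rewrite // lat_form.
- move=> c _ e i; move/(@freeP _ _ _ (in_tuple [:: e1; e2; x1; x2])): fr => /(_ c); exact.
move=> i j; rewrite /orthosum_gram -[i]splitK -[j]splitK.
case: (split i) => i'; case: (split j) => j' /=.
- rewrite block_mxEul !mxE; case: i' => [[|[|//]] ?]; case: j' => [[|[|//]] ?] //=;
  by rewrite ?he1 ?he2 ?he12 ?he21.
- rewrite block_mxEur mxE; case: i' => [[|[|//]] ?]; case: j' => [[|[|//]] ?] //=.
- rewrite block_mxEdl mxE; case: i' => [[|[|//]] ?]; case: j' => [[|[|//]] ?] //=.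
by rewrite block_mxEdr mxE; case: i' => [[|[|//]] ?]; case: j' => [[|[|//]] ?] //=.
Qed.

End Rank4.

(** The doubled norm of a vector with coordinates k1, k2 along e1, e2 and perpendicular part c1 x1 +
    c x2 in a unimodular [2, b; b^, *], where X = 2 c1 + c b^. Since X^2 + c^2 = 2 is excluded (no
    norm 1 in that part), the solutions are (+-1, +-1, 0, 0), (0, 0, +-2, 0) and (0, 0, 0, +-2), and
    their doubled products are multiples of 4. *)
Lemma even_products (k1 k2 X c l1 l2 Y d : int) :
    2 * k1 ^+ 2 + 2 * k2 ^+ 2 + X ^+ 2 + c ^+ 2 = 4 -> X ^+ 2 + c ^+ 2 <> 2 ->
    2 * l1 ^+ 2 + 2 * l2 ^+ 2 + Y ^+ 2 + d ^+ 2 = 4 -> Y ^+ 2 + d ^+ 2 <> 2 ->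
  2 * (k1 * l1) + 2 * (k2 * l2) + X * Y + c * d <> 2.
Proof.
have key (u v x y : int) : 2 * u ^+ 2 + 2 * v ^+ 2 + x ^+ 2 + y ^+ 2 = 4 -> x ^+ 2 + y ^+ 2 <> 2 ->
    [/\ (u = 1 \/ u = -1), (v = 1 \/ v = -1), x = 0 & y = 0] \/
    [/\ u = 0, v = 0 & ((x = 2 \/ x = -2) /\ y = 0) \/ (x = 0 /\ (y = 2 \/ y = -2))].
  rewrite !expr2 => h1 h2.
  have hu : -1 <= u <= 1 by nia.
  have hv : -1 <= v <= 1 by nia.
  have s0 (p q : int) : p * p + q * q = 0 -> p = 0 /\ q = 0.
    by move=> e; split; apply/eqP; rewrite -[_ == 0]orbb -mulf_eq0; apply/eqP; nia.
  have n3 (q : int) : q * q <> 3.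
    move=> e; have := divz_eq q 2; have := modz_ge0 q (d := 2) isT.
    have := ltz_pmod q (d := 2) isT; set k := (q %/ 2)%Z; set r := (q %% 2)%Z => r1 r2 Dq.
    have [er|er] : r = 0 \/ r = 1 by lia.
      clearbody k r; subst r; have e4 : 4 * (k * k) = 3 by rewrite -e Dq; ring.
      by move: (k * k) e4 => kk; lia.
    clearbody k r; subst r; have e4 : 4 * (k * k + k) + 1 = 3 by rewrite -e Dq; ring.
    by move: (k * k + k) e4 => kk; lia.
  have s4 (p q : int) : p * p + q * q = 4 ->
      ((p = 2 \/ p = -2) /\ q = 0) \/ (p = 0 /\ (q = 2 \/ q = -2)).
    move=> e; have hp : -2 <= p <= 2 by nia.
    have [ep|[ep|[ep|[ep|ep]]]] : p = -2 \/ p = -1 \/ p = 0 \/ p = 1 \/ p = 2 by lia.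
    - subst p; left; split; [by right|].
      by apply/eqP; rewrite -[_ == 0]orbb -mulf_eq0; apply/eqP; lia.
    - by subst p; case: (n3 q); lia.
    - subst p; right; split=> //; have : (q - 2) * (q + 2) = 0 by lia.
      by move/eqP; rewrite mulf_eq0 => /orP[]/eqP; lia.
    - by subst p; case: (n3 q); lia.
    - subst p; left; split; [by left|].
      by apply/eqP; rewrite -[_ == 0]orbb -mulf_eq0; apply/eqP; lia.
  have [eu|[eu|eu]] : u = -1 \/ u = 0 \/ u = 1 by lia.
  - subst u; have [ev|[ev|ev]] : v = -1 \/ v = 0 \/ v = 1 by lia.
    + by subst v; left; have [|-> ->] := s0 x y; [lia | split; [right|right| |]].
    + by subst v; lia.
    + by subst v; left; have [|-> ->] := s0 x y; [lia | split; [right|left| |]].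
  - subst u; have [ev|[ev|ev]] : v = -1 \/ v = 0 \/ v = 1 by lia.
    + by subst v; lia.
    + by subst v; right; split=> //; apply: s4; lia.
    + by subst v; lia.
  subst u; have [ev|[ev|ev]] : v = -1 \/ v = 0 \/ v = 1 by lia.
  + by subst v; left; have [|-> ->] := s0 x y; [lia | split; [left|right| |]].
  + by subst v; lia.
  + by subst v; left; have [|-> ->] := s0 x y; [lia | split; [left|left| |]].
move=> h1 h2 h3 h4; move: (key _ _ _ _ h1 h2) (key _ _ _ _ h3 h4) => {h1 h2 h3 h4 key}.
case=> [[hu hv -> ->]|[-> -> hxy]]; case=> [[hu' hv' -> ->]|[-> -> hxy']].
- by case: hu => ->; case: hv => ->; case: hu' => ->; case: hv' => ->.
- by rewrite !mulr0 !mul0r.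
- by rewrite !mul0r !mulr0.
by case: hxy => [[[->|->] ->]|[-> [->|->]]]; case: hxy' => [[[->|->] ->]|[-> [->|->]]].
Qed.

(** * Unimodular binary sublattices without vectors of norm 1 *)

Section Cases.
Variables (m : nat) (V : hermSpace m) (L : hermLattice V).
Local Notation E := (QsqrtN m).
Local Notation O := (ring_of_integers m).
Local Notation cj := (@Qconj m).
Local Notation H := (hform V).
Hypothesis univ : two_universal L.
Hypothesis rL : has_rank L 4.
Variables (e1 e2 : V).
Hypotheses (Le1 : L e1) (Le2 : L e2) (he1 : H e1 e1 = 1) (he2 : H e2 e2 = 1) (he12 : H e1 e2 = 0).

Section Unimodular.
Variables (x1 x2 : V) (a d : nat) (b : E).
Hypotheses (L1 : L x1) (L2 : L x2) (Ha : H x1 x1 = a%:R) (Hd : H x2 x2 = d%:R) (Hb : H x1 x2 = b).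
Hypothesis det1 : (a * d)%:R = nrm b + 1.
Hypothesis no_norm1 : forall c1 c2, c1 \in O -> c2 \in O -> hn (c1 *: x1 + c2 *: x2) <> 1.

Let bO : b \in O. Proof. by rewrite -Hb; apply: lat_form L1 L2. Qed.
Let det1E : a%:R * d%:R - b * cj b = 1 :> E.
Proof.
by rewrite -natrM -(rmorph_nat (rQ m)) det1 rmorphD /= nrmE rmorph1 addrC addKr.
Qed.
Let H21 : H x2 x1 = cj b. Proof. by rewrite HC Hb. Qed.

(** By determinant 1 the projection [be] of [e] onto the span of x1, x2 lies in L, so 1 = hn e is
    the sum of the natural numbers hn be and hn (e - be). The first is not 1, hence it is 0. *)
Lemma unimodular_orth e : L e -> hn e = 1 -> H e x1 = 0 /\ H e x2 = 0.
Proof.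
move=> Le ne; set t1 := H e x1; set t2 := H e x2.
have t1O : t1 \in O by exact: (lat_form Le L1).
have t2O : t2 \in O by exact: (lat_form Le L2).
pose c1 := t1 * d%:R - t2 * cj b; pose c2 := t2 * a%:R - t1 * b.
have c1O : c1 \in O by rewrite rpredB ?rpredM ?nat_O ?cjO.
have c2O : c2 \in O by rewrite rpredB ?rpredM ?nat_O ?cjO.
pose be := c1 *: x1 + c2 *: x2.
have Lbe : L be by apply: latD; apply: latZ.
have h1 : H be x1 = t1.
  rewrite HDl !HZl Ha H21 -[RHS]mulr1 [X in _ = _ * X](esym det1E) /c1 /c2; ring.
have h2 : H be x2 = t2.
  rewrite HDl !HZl Hd Hb -[RHS]mulr1 [X in _ = _ * X](esym det1E) /c1 /c2; ring.
have h3 : H (e - be) be = 0.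
  by rewrite HBl {1}/be {2}/be !HDr !HZr h1 h2 subrr.
have h4 : H be (e - be) = 0 by rewrite HC h3 cj0.
have hs : hn e = hn be + hn (e - be).
  apply: (@rQ_inj m); rewrite rmorphD /= -!hnE.
  have -> : H e e = H ((e - be) + be) ((e - be) + be) by rewrite subrK.
  move: h3 h4; move: (e - be) => g h3 h4; clearbody be.
  by rewrite HDl !HDr h3 h4; ring.
have [n1 Dn1] := lat_hn_nat Lbe; have [n2 Dn2] := lat_hn_nat (latB Le Lbe).
have n10 : n1 = 0%N.
  have := no_norm1 c1O c2O; rewrite -/be Dn1.
  have : (n1 + n2 = 1)%N by apply/eqP; rewrite -(eqr_nat rat) natrD -Dn1 -Dn2 -hs ne.
  by case: n1 {Dn1} => [|[|n1]] //= _ [].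
have be0 : be = 0 by apply: (lat_hn_eq0 Lbe); rewrite Dn1 n10.
by rewrite -h1 -h2 be0 !H0l.
Qed.

Lemma hn_e1 : hn e1 = 1. Proof. by apply: hn_uniq; rewrite he1 rmorph1. Qed.
Lemma hn_e2 : hn e2 = 1. Proof. by apply: hn_uniq; rewrite he2 rmorph1. Qed.

Lemma unimodular_perp :
  [/\ H x1 e1 = 0, H x1 e2 = 0, H x2 e1 = 0 & H x2 e2 = 0].
Proof.
have [h1 h2] := unimodular_orth Le1 hn_e1; have [h3 h4] := unimodular_orth Le2 hn_e2.
by split; rewrite HC ?h1 ?h2 ?h3 ?h4 cj0.
Qed.

Lemma unimodular_coords z : L z -> exists c1 c2,
  [/\ c1 \in O, c2 \in O, perp e1 e2 z = c1 *: x1 + c2 *: x2 &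
    c1 * a%:R + c2 * cj b = H z x1].
Proof.
move=> Lz; have [h1 h2 h3 h4] := unimodular_perp.
have D0 : a%:R * d%:R - b * cj b != 0 by rewrite det1E oner_neq0.
have [c1 [c2 [Dp q1 q2]]] := lat_coords rL Le1 Le2 he1 he2 he12 L1 L2 h1 h2 h3 h4 Ha Hd Hb D0 Lz.
have t1O : H z x1 \in O by exact: (lat_form Lz L1).
have t2O : H z x2 \in O by exact: (lat_form Lz L2).
exists c1, c2; split=> //.
  have -> : c1 = H z x1 * d%:R - H z x2 * cj b.
    by rewrite -q1 -q2 -[LHS]mulr1 [X in _ * X = _](esym det1E); ring.
  by rewrite rpredB ?rpredM ?nat_O ?cjO.
have -> : c2 = H z x2 * a%:R - H z x1 * b.
  by rewrite -q1 -q2 -[LHS]mulr1 [X in _ * X = _](esym det1E); ring.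
by rewrite rpredB ?rpredM ?nat_O.
Qed.

Lemma unimodular_isometric : isometric_gram L
  (orthosum_gram (diag_gram [:: 1; 1]) (binary_gram a%:R b (cj b) d%:R)).
Proof.
have [h1 h2 h3 h4] := unimodular_perp.
apply: (isometric_gram4 Le1 Le2 he1 he2 he12 L1 L2 h1 h2 h3 h4 Ha Hd Hb H21).
  by rewrite det1E oner_neq0.
by move=> z /unimodular_coords[c1 [c2 [? ? ? _]]]; exists c1, c2.
Qed.

End Unimodular.

(** Twice the norm is N(X) + N(c2) with X = 2 c1 + c2 cj b. If this is 2, both X and c2 are rational
    integers, hence 1 or -1, and 2 cj c1 + c2 b = X makes b congruent to the integer c2 X modulo
    2. *)
Lemma no_norm1_small (x1 x2 : V) (d : nat) (b : E) :
    (forall c, c \in O -> nrm c <= 2 -> exists n : int, c = n%:~R) ->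
    (forall n : int, ~~ dvO 2 (b - n%:~R)) ->
    H x1 x1 = 2%:R -> H x2 x2 = d%:R -> H x1 x2 = b -> b \in O -> (2 * d)%:R = nrm b + 1 ->
  forall c1 c2, c1 \in O -> c2 \in O -> hn (c1 *: x1 + c2 *: x2) <> 1.
Proof.
move=> small nb Ha Hd Hb bO det1 c1 c2 c1O c2O h.
have := hn_comb2 c1 c2 Ha Hd Hb; rewrite h -natrM det1.
rewrite [nrm b + 1]addrC addrK mul1r mulr1 => hs.
have XO : 2%:R * c1 + c2 * cj b \in O by rewrite rpredD ?rpredM ?nat_O ?cjO.
have [X DX] := small _ XO (ltac:(have := nrm_ge0 c2; lra)).
have [c Dc] := small _ c2O (ltac:(have := nrm_ge0 (2%:R * c1 + c2 * cj b); lra)).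
move: hs; rewrite DX Dc !nrmz => hs.
have {}hs : X ^+ 2 + c ^+ 2 = 2.
  by apply/eqP; rewrite -(eqr_int rat) rmorphD !rmorphXn /= -hs.
have [hX hc] : (X = 1 \/ X = -1) /\ (c = 1 \/ c = -1).
  move: hs; rewrite !expr2 => hs; have hX : -1 <= X <= 1 by nia.
  have hc : -1 <= c <= 1 by nia.
  by split; [have : X <> 0 by nia | have : c <> 0 by nia]; lia.
have := nb (c * X); rewrite /dvO; case/negP.
have -> : (b - (c * X)%:~R) / 2 = - (c%:~R * cj c1).
  have DX' : 2%:R * cj c1 + cj c2 * b = X%:~R.
    by rewrite -(cjz m X) -DX cjD !cjM QconjK cjn.
  have h2 := two_neq0 m; apply: (mulIf h2); rewrite divfK // rmorphM /= -DX' Dc cjz.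
  have cc : c%:~R * c%:~R = 1 :> E.
    by rewrite -rmorphM /=; case: hc => ->.
  have -> : b - c%:~R * (2%:R * cj c1 + c%:~R * b) = b * (1 - c%:~R * c%:~R) - c%:~R * cj c1 * 2 by ring.
  by rewrite cc; ring.
by rewrite rpredN rpredM ?int_O ?cjO.
Qed.

(** A vector of norm 2 has products k1, k2 with e1, e2 and a perpendicular part given by X, c as in
    [even_products], with 2 N(k1) + 2 N(k2) + N(X) + N(c) = 4. All four are therefore rational
    integers, and the product 1 that A2 requires cannot occur. *)
Lemma no_quaternary_even_unimodular (d : nat) (b : E) :
    (forall c, c \in O -> nrm c <= 4 -> exists n : int, c = n%:~R) ->
    (forall n : int, ~~ dvO 2 (b - n%:~R)) -> b \in O -> (2 * d)%:R = nrm b + 1 -> False.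
Proof.
move=> small nb bO det1.
have small2 c : c \in O -> nrm c <= 2 -> exists n : int, c = n%:~R.
  by move=> cO h; apply: small => //; lra.
have [x1 [x2 [L1 L2 Ha Hd Hb]]] : exists y1 y2, [/\ L y1, L y2, H y1 y1 = 2%:R, H y2 y2 = d%:R & H y1 y2 = b].
  by apply: represents_binary => //; rewrite det1; lra.
have nn := no_norm1_small small2 nb Ha Hd Hb bO det1.
have [x [y [Lx Ly Hxx Hyy Hxy]]] : exists y1 y2, [/\ L y1, L y2, H y1 y1 = 2%:R, H y2 y2 = 2%:R & H y1 y2 = 1].
  by apply: represents_binary; rewrite ?rpred1 // nrm1; lra.
have H21 : H x2 x1 = cj b by rewrite HC Hb.
have coords z : L z -> H z z = 2%:R -> exists k1 k2 X c : int,
    [/\ H z e1 = k1%:~R, H z e2 = k2%:~R,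
     2 * k1 ^+ 2 + 2 * k2 ^+ 2 + X ^+ 2 + c ^+ 2 = 4, X ^+ 2 + c ^+ 2 <> 2 &
     exists c1, perp e1 e2 z = c1 *: x1 + c%:~R *: x2 /\ c1 * 2%:R + c%:~R * cj b = X%:~R].
  move=> Lz Hz; have hz : hn z = 2 by apply: hn_uniq; rewrite Hz rmorph_nat.
  have := hn_perp he1 he2 he12 z; rewrite hz.
  have [c1 [c2 [c1O c2O Dp DX]]] := unimodular_coords L1 L2 Ha Hd Hb det1 nn Lz.
  have := hn_comb2 c1 c2 Ha Hd Hb; rewrite -Dp -natrM det1 [nrm b + 1]addrC addrK mul1r.
  rewrite [2%:R * c1]mulrC DX => s1 s2.
  have XO : H z x1 \in O by exact: (lat_form Lz L1).
  have k1O : H z e1 \in O by exact: (lat_form Lz Le1).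
  have k2O : H z e2 \in O by exact: (lat_form Lz Le2).
  have g1 := nrm_ge0 (H z e1); have g2 := nrm_ge0 (H z e2).
  have g3 := nrm_ge0 (H z x1); have g4 := nrm_ge0 c2.
  have [k1 Dk1] := small _ k1O (ltac:(lra)).
  have [k2 Dk2] := small _ k2O (ltac:(lra)).
  have [X DX'] := small _ XO (ltac:(lra)).
  have [c Dc] := small _ c2O (ltac:(lra)).
  exists k1, k2, X, c; split=> //.
  - move: s1 s2; rewrite Dk1 Dk2 DX' Dc !nrmz => s1 s2.
    apply/eqP; rewrite -(eqr_int rat) !rmorphD !rmorphM /=; apply/eqP; lra.
  - move=> e; apply: (nn c1 c2 c1O c2O); rewrite -Dp.
    have e' : X%:~R ^+ 2 + c%:~R ^+ 2 = 2 :> rat.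
      by have := congr1 (fun t : int => t%:~R : rat) e; rewrite /= rmorphD /= !rmorphXn.
    move: s1; rewrite DX' Dc !nrmz; lra.
  by exists c1; rewrite -DX' -DX Dc in Dp *.
destruct (coords x Lx Hxx) as [k1 [k2 [X [c [Dk1 Dk2 s1 s2 [c1 [Dp DX]]]]]]].
destruct (coords y Ly Hyy) as [l1 [l2 [Y [c' [Dl1 Dl2 s3 s4 [c1' [Dp' DY]]]]]]].
apply: (even_products s1 s2 s3 s4); apply/eqP.
have h2 := two_neq0 m.
(* 2 d = N(b) + 1 makes the doubled form diagonal in the variables X = 2 c1 + c cj b and c. *)
have P : 2 * H (perp e1 e2 x) (perp e1 e2 y) = X%:~R * Y%:~R + c%:~R * c'%:~R.
  have DY' : cj c1' * 2%:R + c'%:~R * b = Y%:~R.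
    by rewrite -(cjz m Y) -DY cjD !cjM QconjK cjn cjz.
  rewrite Dp Dp' !(HDl, HDr, HZl, HZr) Ha Hd Hb H21 cjz -DX -DY'.
  have D2 : 2 * d%:R = b * cj b + 1 :> E.
    by rewrite -natrM -(rmorph_nat (rQ m)) det1 rmorphD /= nrmE rmorph1.
  transitivity (4 * (c1 * cj c1') + 2 * (c1 * (c'%:~R * b)) + 2 * (c%:~R * (cj c1' * cj b)) + c%:~R * c'%:~R * (2 * d%:R)).
    by ring.
  by rewrite D2; ring.
have := form_perp he1 he2 he12 x y; rewrite Hxy Dk1 Dk2 Dl1 Dl2 !cjz => F.
rewrite -(eqr_int rat) -(inj_eq (@rQ_inj m)) !rmorph_int !rmorphD !rmorphM /=.
apply/eqP; rewrite -[RHS]mulr1 [X in _ = _ * X]F mulrDr P; ring.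
Qed.

End Cases.

Lemma nat_sum3_eq2 (p q r : nat) : (p + q + r = 2)%N -> r <> 1%N ->
  [\/ [/\ p = 0, q = 0 & r = 2]%N, [/\ p = 1, q = 1 & r = 0]%N,
      [/\ p = 2, q = 0 & r = 0]%N | [/\ p = 0, q = 2 & r = 0]%N].
Proof.
case: p => [|[|[|p]]]; case: q => [|[|[|q]]]; case: r => [|[|[|r]]] //= _ _;
  by [constructor 1 | constructor 2 | constructor 3 | constructor 4].
Qed.

(** * A2 and the complement of e1, e2 *)

Section Cases.
Variables (m : nat) (V : hermSpace m) (L : hermLattice V).
Local Notation E := (QsqrtN m).
Local Notation O := (ring_of_integers m).
Local Notation cj := (@Qconj m).
Local Notation H := (hform V).
Hypothesis univ : two_universal L.
Hypothesis rL : has_rank L 4.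
Variables (e1 e2 : V).
Hypotheses (Le1 : L e1) (Le2 : L e2) (he1 : H e1 e1 = 1) (he2 : H e2 e2 = 1) (he12 : H e1 e2 = 0).

Lemma represents_A2 : exists x y,
  [/\ L x, L y, H x x = 2, H y y = 2 & H x y = 1].
Proof. by apply: (represents_binary univ); rewrite ?rpred1 // nrm1; lra. Qed.

Lemma hn2 (z : V) (q : nat) : H z z = q%:R -> hn z = q%:R.
Proof. by move=> h; apply: hn_uniq; rewrite h rmorph_nat. Qed.

Section PerpCases.
Hypothesis no_e3 : forall z, L z -> H z e1 = 0 -> H z e2 = 0 -> hn z <> 1.

Lemma norm2_split (z : V) : L z -> H z z = 2 ->
  [\/ H z e1 = 0 /\ H z e2 = 0,
    [/\ nrm (H z e1) = 1, nrm (H z e2) = 1 & perp e1 e2 z = 0],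
    [/\ nrm (H z e1) = 2, H z e2 = 0 & perp e1 e2 z = 0] |
    [/\ H z e1 = 0, nrm (H z e2) = 2 & perp e1 e2 z = 0]].
Proof.
move=> Lz Hz; have Lp := perp_lat Le1 Le2 Lz.
have [p Dp] := nrm_nat (lat_form Lz Le1); have [q Dq] := nrm_nat (lat_form Lz Le2).
have [r Dr] := lat_hn_nat Lp.
have s : (p + q + r = 2)%N.
  apply/eqP; rewrite -(eqr_nat rat) !natrD -Dp -Dq -Dr -hn_perp // (hn2 Hz) //.
have r1 : r <> 1%N.
  move=> e; apply: (no_e3 Lp); rewrite ?perp_e1 ?perp_e2 //.
  by rewrite Dr e.
have z0 (h : E) (n : nat) : nrm h = n%:R -> n = 0%N -> h = 0.
  by move=> Dh n0; apply/eqP; rewrite -nrm_eq0 Dh n0.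
have zp : r = 0%N -> perp e1 e2 z = 0.
  by move=> r0; apply: (lat_hn_eq0 Lp); rewrite Dr r0.
case: (nat_sum3_eq2 s r1) => [[p0 q0 _]|[p1 q1 /zp->]|[p2 q0 /zp->]|[p0 q2 /zp->]].
- by constructor 1; rewrite (z0 _ _ Dp p0) (z0 _ _ Dq q0).
- by constructor 2; rewrite Dp Dq p1 q1.
- by constructor 3; rewrite Dp p2 (z0 _ _ Dq q0).
- by constructor 4; rewrite Dq q2 (z0 _ _ Dp p0).
Qed.

(* Two units add up to 1 only if their trace is 1, so a sublattice A2 must lie in
   the orthogonal complement of <1,1>. *)
Lemma A2_perp (x y : V) :
    (forall u, u \in O -> nrm u = 1 -> u + cj u <> 1) ->
    L x -> L y -> H x x = 2 -> H y y = 2 -> H x y = 1 ->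
  [/\ H x e1 = 0, H x e2 = 0, H y e1 = 0 & H y e2 = 0].
Proof.
move=> nou Lx Ly Hx Hy Hxy.
have F := form_perp he1 he2 he12 x y; rewrite Hxy in F.
have nn (k l : E) (r : rat) : nrm k * nrm l = r -> r <> 1 -> 1 <> k * cj l.
  by move=> h r1 e; apply: r1; rewrite -h -(nrm_cj l) -nrmM -e nrm1.
have ne2 : (2 : rat) <> 1 by apply/eqP; rewrite (eqr_nat rat 2 1).
have ne4 : (2 * 2 : rat) <> 1 by rewrite -natrM; apply/eqP; rewrite (eqr_nat rat 4 1).
have one0 : (1 : E) <> 0 by apply/eqP/oner_neq0.
case: (norm2_split Lx Hx) => [[a1 a2]|[a1 a2 ap]|[a1 a2 ap]|[a1 a2 ap]];
case: (norm2_split Ly Hy) => [[b1 b2]|[b1 b2 bp]|[b1 b2 bp]|[b1 b2 bp]].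
- by [].
- by case: one0; rewrite F a1 a2 bp H0r; ring.
- by case: one0; rewrite F a1 a2 bp H0r; ring.
- by case: one0; rewrite F a1 a2 bp H0r; ring.
- by case: one0; rewrite F b1 b2 ap H0l cj0; ring.
- case: (nou (H x e1 * cj (H y e1))).
  + by rewrite rpredM ?cjO // (lat_form Lx Le1, lat_form Ly Le1).
  + by rewrite nrmM nrm_cj a1 b1 mulr1.
  set u := H x e1 * cj (H y e1) in F *; set v := H x e2 * cj (H y e2) in F.
  have nu : u * cj u = 1 by rewrite -nrmE /u nrmM nrm_cj a1 b1 mulr1 rmorph1.
  have nv : v * cj v = 1 by rewrite -nrmE /v nrmM nrm_cj a2 b2 mulr1 rmorph1.
  have Dv : v = 1 - u by rewrite F ap H0l; ring.
  move: nv; rewrite Dv cjB cj1 => nv.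
  have -> : u + cj u = 1 + u * cj u - (1 - u) * (1 - cj u) by ring.
  by rewrite nu nv; ring.
- case: (nn (H x e1) (H y e1) 2 _ ne2); first by rewrite a1 b1 ?mul1r ?mulr1.
  by rewrite F ap b2 H0l cj0; ring.
- case: (nn (H x e2) (H y e2) 2 _ ne2); first by rewrite a2 b2 ?mul1r ?mulr1.
  by rewrite F ap b1 H0l cj0; ring.
- by case: one0; rewrite F b1 b2 ap H0l cj0; ring.
- case: (nn (H x e1) (H y e1) 2 _ ne2); first by rewrite a1 b1 ?mul1r ?mulr1.
  by rewrite F ap a2 H0l; ring.
- case: (nn (H x e1) (H y e1) _ _ ne4); first by rewrite a1 b1.
  by rewrite F ap a2 H0l; ring.
- by case: one0; rewrite F a2 b1 ap H0l cj0; ring.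
- by case: one0; rewrite F b1 b2 ap H0l cj0; ring.
- case: (nn (H x e2) (H y e2) 2 _ ne2); first by rewrite a2 b2 ?mul1r ?mulr1.
  by rewrite F ap a1 H0l; ring.
- by case: one0; rewrite F a1 b2 ap H0l cj0; ring.
case: (nn (H x e2) (H y e2) _ _ ne4); first by rewrite a2 b2.
by rewrite F ap a1 H0l; ring.
Qed.

(* If 3 is inert, A2 is a maximal lattice. *)
Lemma A2_coords (x y : V) :
    (forall g, g \in O -> dvO 3 (rQ m (nrm g)) -> dvO 3 g) ->
    L x -> L y -> H x x = 2 -> H y y = 2 -> H x y = 1 ->
    [/\ H x e1 = 0, H x e2 = 0, H y e1 = 0 & H y e2 = 0] ->
  forall z, L z -> exists c1 c2, [/\ c1 \in O, c2 \in O & perp e1 e2 z = c1 *: x + c2 *: y].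
Proof.
move=> inert3 Lx Ly Hx Hy Hxy [h1 h2 h3 h4] z Lz.
have D0 : 2 * 2 - 1 * cj 1 != 0 :> E.
  have -> : 2 * 2 - 1 * cj 1 = 3 :> E by rewrite cj1; ring.
  exact: (natE_neq0 m 2).
have three : 3 != 0 :> E := natE_neq0 m 2.
have [c1 [c2 [Dp q1 q2]]] := lat_coords rL Le1 Le2 he1 he2 he12 Lx Ly h1 h2 h3 h4 Hx Hy Hxy D0 Lz.
have t1O : H z x \in O by exact: (lat_form Lz Lx).
have t2O : H z y \in O by exact: (lat_form Lz Ly).
rewrite cj1 !mulr1 in q1 q2.
have d12 : c1 - c2 \in O.
  have -> : c1 - c2 = H z x - H z y by rewrite -q1 -q2; ring.
  exact: rpredB.
have g3 : 3 * c2 \in O.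
  have -> : 3 * c2 = 2 * H z y - H z x by rewrite -q1 -q2; ring.
  by rewrite rpredB ?rpredM ?nat_O.
have Lw : L (c2 *: (x + y)).
  have -> : c2 *: (x + y) = perp e1 e2 z - (c1 - c2) *: x.
    by rewrite Dp scalerDr scalerBl opprB [RHS]addrC addrA subrK.
  by apply: latB; [exact: perp_lat | exact: latZ].
(* H(x + y, x + y) = 6, so 6 N(c2) = 2 t is integral for t = N(3 c2) / 3; since 3 t is integral too,
   so is t, and inertness of 3 applies to 3 c2. *)
have c2O : c2 \in O.
  suff : dvO 3 (3 * c2) by rewrite /dvO mulrC mulKf.
  apply: inert3 => //; rewrite /dvO.
  have := lat_form Lw Lw.
  have -> : H (c2 *: (x + y)) (c2 *: (x + y)) = 2 * (rQ m (nrm (3 * c2)) / 3).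
    rewrite HZl HZr HDl !HDr Hx Hy Hxy (HC y x) Hxy cj1 nrmE cjM cjn.
    by move: (cj c2) => k; field.
  set t := rQ m _ / 3 => t2; have -> : t = rQ m (nrm (3 * c2)) - 2 * t.
    by rewrite /t; field.
  by rewrite rpredB // nrmE rpredM ?cjO.
by exists c1, c2; split=> //; rewrite -(subrK c2 c1) rpredD.
Qed.

End PerpCases.
End Cases.

Lemma natE_int m (n : int) : (n%:~R == 0 :> QsqrtN m) = (n == 0).
Proof. by rewrite -(rmorph_int (rQ m)) fmorph_eq0 intr_eq0. Qed.

Lemma intE_inj m (a b : int) : a%:~R = b%:~R :> QsqrtN m -> a = b.
Proof. by move/eqP; rewrite -subr_eq0 -rmorphB natE_int subr_eq0 => /eqP. Qed.

Lemma half_int m (a : int) : (1 - 2 * a%:~R) / 2 \notin ring_of_integers m.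
Proof.
apply/negP=> h; have [|k hk] := real_int h.
  by rewrite cjM cjV cjB cjM cj1 cjz cjn.
have : 1 - 2 * a%:~R = 2 * k%:~R :> QsqrtN m.
  by rewrite -hk mulrCA divff ?mulr1 // two_neq0.
move=> e; have : (1 - 2 * a)%:~R = (2 * k)%:~R :> QsqrtN m.
  by rewrite rmorphB !rmorphM /=.
by move/intE_inj; lia.
Qed.

Lemma int_sqr_ge1 (b : int) : b != 0 -> 1 <= b * b.
Proof. by nia. Qed.

Lemma int_sqr_ge0 (b : int) : 0 <= b * b.
Proof. by nia. Qed.

Lemma dvdz3_sum_squares (u v : int) : (3 %| u * u + v * v)%Z -> (3 %| u)%Z /\ (3 %| v)%Z.
Proof.
move=> /dvdzP[n h]; suff : (u %% 3)%Z = 0 /\ (v %% 3)%Z = 0.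
  by case=> hu hv; split; apply/dvdz_mod0P.
move: (divz_eq u 3) (divz_eq v 3) (modz_ge0 u (d := 3) isT) (modz_ge0 v (d := 3) isT).
move: (ltz_pmod u (d := 3) isT) (ltz_pmod v (d := 3) isT).
set a := (u %/ 3)%Z; set r := (u %% 3)%Z; set b := (v %/ 3)%Z; set t := (v %% 3)%Z.
clearbody a b r t => r3 t3 Du Dv r0 t0; subst u v.
have e : r * r + t * t = 3 * (n - 3 * (a * a) - 2 * (a * r) - 3 * (b * b) - 2 * (b * t)).
  by move: h => /(congr1 (fun x => x - 9 * (a * a) - 6 * (a * r) - 9 * (b * b) - 6 * (b * t))); lia.
move: (n - _ - _ - _ - _) e => k e.
have [er|[er|er]] : r = 0 \/ r = 1 \/ r = 2 by lia.
all: have [et|[et|et]] : t = 0 \/ t = 1 \/ t = 2 by lia.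
all: by subst r t; lia.
Qed.

(** * Integers of small norm and residues modulo 2 *)

Section Sqrt.
Variable m : nat.
Hypotheses (sqf : squarefree m) (m4 : (m %% 4 = 1 \/ m %% 4 = 2)%N).
Local Notation E := (QsqrtN m).
Local Notation O := (ring_of_integers m).
Local Notation s := (sqrtN m).

Lemma O_sqrt x : x \in O -> exists a b : int, x = a%:~R + b%:~R * s /\
  nrm x = (a ^+ 2 + m%:Z * b ^+ 2)%:~R.
Proof.
have m0 : (0 < m)%N by case: m4 => h; lia.
move=> xO; have [p [q [Dx h Dn]]] := Ocoord sqf m0 xO.
have [[a Da] [b Db]] : (exists a : int, p = 2 * a) /\ (exists b : int, q = 2 * b).
  suff [hp hq] : (p %% 2)%Z = 0 /\ (q %% 2)%Z = 0.
    by split; [exists (p %/ 2)%Z | exists (q %/ 2)%Z]; [have := divz_eq p 2 | have := divz_eq q 2]; lia.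
  move/dvdzP: h => [n]; rewrite (divn_eq m 4) PoszD PoszM.
  move: (divz_eq p 2) (divz_eq q 2) (modz_ge0 p (d := 2) isT) (modz_ge0 q (d := 2) isT).
  move: (ltz_pmod p (d := 2) isT) (ltz_pmod q (d := 2) isT).
  move: m4; set j := ((m %/ 4)%N : int); set i := (m %% 4)%N.
  set a := (p %/ 2)%Z; set r := (p %% 2)%Z; set b := (q %/ 2)%Z; set t := (q %% 2)%Z.
  clearbody i j a b r t => i12 r3 t3 Dp Dq r0 t0 h; subst p q.
  have e : r * r + i%:Z * (t * t) = 4 * (n - a * a - a * r - j * ((b * 2 + t) * (b * 2 + t)) - i%:Z * (b * b) - i%:Z * (b * t)).
    move: h => /(congr1 (fun x => x - 4 * (a * a) - 4 * (a * r) - 4 * j * ((b * 2 + t) * (b * 2 + t)) - 4 * (i%:Z * (b * b)) - 4 * (i%:Z * (b * t)))).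
    by move=> h; rewrite [LHS](_ : _ = (a * 2 + r) * (a * 2 + r) + (j * 4 + i%:Z) * (b * 2 + t) * (b * 2 + t) - 4 * (a * a) - 4 * (a * r) - 4 * j * ((b * 2 + t) * (b * 2 + t)) - 4 * (i%:Z * (b * b)) - 4 * (i%:Z * (b * t))); [rewrite h; ring | ring].
  move: (n - _ - _ - _ - _ - _) e => k e.
  have [er|er] : r = 0 \/ r = 1 by lia.
  1-2: have [et|et] : t = 0 \/ t = 1 by lia.
  1-4: rewrite er et; split=> //; move: e; rewrite er et; case: i12 => ->; lia.
exists a, b; split.
  rewrite Dx Da Db -(rmorph_int (rQ m) a) -(rmorph_int (rQ m) b).
  by congr (rQ m _ + rQ m _ * _); rewrite rmorphM /=; field.
by rewrite Dn Da Db !(rmorphD, rmorphM) /=; field.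
Qed.

Lemma small4_sqrt c : (5 <= m)%N -> c \in O -> nrm c <= 4 -> exists n : int, c = n%:~R.
Proof.
move=> m5 cO; have [a [b [-> ->]]] := O_sqrt cO; move=> h.
have {h} : a ^+ 2 + m%:Z * b ^+ 2 <= 4 by rewrite -(ler_int rat).
rewrite !expr2 => h; have b0 : b = 0.
  have [//|bn] := eqVneq b 0; have := int_sqr_ge1 bn.
  have : 5 <= m%:Z by lia.
  move: (m%:Z) h => M h; have := int_sqr_ge0 a; move: (a * a) (b * b) h => A B h.
  by nia.
by exists a; rewrite b0; ring.
Qed.

(** If it were 2 (a + b s), subtracting the conjugate would give 2 s = 4 b s. *)
Lemma sqrt_not_int (k n : int) : ~~ dvO 2 (k%:~R + s - n%:~R).
Proof.
apply/negP=> h; have [a [b [Dx _]]] := O_sqrt h.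
have e : k%:~R + s - n%:~R = 2 * (a%:~R + b%:~R * s) by rewrite -Dx mulrCA divff ?mulr1 // two_neq0.
have e' := congr1 (@Qconj m) e; move: e'.
rewrite !(cjB, cjD, cjM, cj_s, cjz, cjn) => e'.
have : s * (2 - 4 * b%:~R) = 0.
  have -> : s * (2 - 4 * b%:~R) = (k%:~R + s - n%:~R) - (k%:~R + - s - n%:~R)
     - 2 * (a%:~R + b%:~R * s) + 2 * (a%:~R + b%:~R * - s) by ring.
  by rewrite e e'; ring.
have s0 : s != 0.
  apply/eqP=> s0; have := s_sqr m; rewrite s0 mul0r => /esym/eqP; rewrite oppr_eq0.
  by case: (m) m4 => [|k' _]; [case | rewrite (negPf (natE_neq0 _ _))].
move/eqP; rewrite mulf_eq0 (negPf s0) /=.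
rewrite [X in X == 0](_ : _ = (2 - 4 * b)%:~R); last by rewrite rmorphB rmorphM.
by rewrite natE_int; lia.
Qed.

End Sqrt.

Section OmegaFacts.
Variable m : nat.
Hypotheses (sqf : squarefree m) (m4 : (m %% 4 = 3)%N).
Local Notation E := (QsqrtN m).
Local Notation O := (ring_of_integers m).
Local Notation w := (omega m).

Lemma small_omega (B : nat) c : (4 * B < m)%N -> c \in O -> nrm c <= B%:R -> exists n : int, c = n%:~R.
Proof.
move=> mB cO; have [a [b [-> Dn]]] := O_omega sqf m4 cO; move=> h.
have {h} : (2 * a + b) ^+ 2 + m%:Z * b ^+ 2 <= (4 * B)%N.
  rewrite -(ler_int rat) -Dn -[X in _ <= X]/((4 * B)%:R) natrM.
  by rewrite ler_pM2l.
rewrite !expr2 => h'; have b0 : b = 0.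
  have [//|bn] := eqVneq b 0; have h1 := int_sqr_ge1 bn.
  have h0 : 0 <= m%:Z by [].
  have h2 : (4 * B)%N%:Z < m%:Z by lia.
  move: (m%:Z) ((4 * B)%N%:Z) h' h0 h2 => M N h' h0 h2.
  have h3 := int_sqr_ge0 (2 * a + b).
  move: ((2 * a + b) * _) (b * b) h' h1 h3 => A B' h' h1 h3.
  by nia.
by exists a; rewrite b0; ring.
Qed.

(** The trace of (w - n) / 2 is (1 - 2 n) / 2, not an integer. *)
Lemma omega_not_int (n : int) : ~~ dvO 2 (w - n%:~R).
Proof.
apply/negP=> h; have := half_int m n; apply/negP; rewrite negbK.
have -> : (1 - 2 * n%:~R) / 2 = (w - n%:~R) / 2 + Qconj ((w - n%:~R) / 2).
  by rewrite cjM cjV cjB cj_omega cjz cjn; have := two_neq0 m; move=> h2; field.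
by rewrite rpredD ?cjO.
Qed.

Lemma nrm_omega (a b : int) :
  4 * nrm (a%:~R + b%:~R * w) = ((2 * a + b) ^+ 2 + m%:Z * b ^+ 2)%:~R.
Proof.
rewrite (@nrm_coord _ (a%:~R + b%:~R / 2) (b%:~R / 2)); last first.
  rewrite omega_coord !rmorphD !rmorphM /= !rmorph_int; ring.
by rewrite !(rmorphD, rmorphM, rmorphXn) /=; field.
Qed.

End OmegaFacts.

Lemma int_sqr_neq2 (n : int) : n ^+ 2 <> 2.
Proof.
rewrite expr2 => e; have h : -1 <= n <= 1 by nia.
have [n0|[n0|n0]] : n = -1 \/ n = 0 \/ n = 1 by lia.
all: by subst n; lia.
Qed.

Lemma int_sqr_eq1 (n : int) : n ^+ 2 = 1 -> n = 1 \/ n = -1.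
Proof. by move/eqP; rewrite sqrf_eq1 => /orP[]/eqP->; [left | right]. Qed.

(** * m = 7 modulo 8, m > 8 *)

Section Nonfree.
Variables (m : nat) (V : hermSpace m) (L : hermLattice V).
Local Notation E := (QsqrtN m).
Local Notation O := (ring_of_integers m).
Local Notation cj := (@Qconj m).
Local Notation H := (hform V).
Local Notation w := (omega m).
Hypotheses (univ : two_universal L) (rL : has_rank L 4).
Hypotheses (sqf : squarefree m) (m8 : (m %% 8 = 7)%N).
Variables (e1 e2 : V).
Hypotheses (Le1 : L e1) (Le2 : L e2) (he1 : H e1 e1 = 1) (he2 : H e2 e2 = 1) (he12 : H e1 e2 = 0).

Let m4 : (m %% 4 = 3)%N. Proof. lia. Qed.

Lemma mul_omega_cj : w * cj w = ((m + 1) %/ 4)%N%:R.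
Proof. by rewrite cj_omega mulrBr mulr1 omega_sqr //; ring. Qed.

Lemma half_mul_omega_cj : w * cj w / 2 \in O.
Proof.
have [k Dk] : exists k, ((m + 1) %/ 4 = 2 * k)%N by exists ((m + 1) %/ 8)%N; lia.
by rewrite mul_omega_cj Dk natrM mulrAC divff ?mul1r ?nat_O // two_neq0.
Qed.

(* O w/2 + O is the inverse of the prime (2, cj w) above 2. *)
Lemma nonfree_proj u z : L u -> L ((w / 2) *: u) -> L z -> L ((H z u / 2) *: u).
Proof.
move=> Lu Lwu Lz; have h2 := two_neq0 m.
have [a [b [Dp _]]] := O_omega sqf m4 (lat_form Lz Lu).
have := lat_form Lz Lwu; rewrite HZr cjM cjV cjn Dp => h.
have acO : a%:~R * cj w / 2 \in O.
  have -> : a%:~R * cj w / 2 = cj w / 2 * (a%:~R + b%:~R * w) - b%:~R * (w * cj w / 2) by field.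
  by rewrite rpredB // rpredM ?int_O ?half_mul_omega_cj.
have aO : a%:~R / 2 \in O.
  have -> : a%:~R / 2 = a%:~R * cj w / 2 + cj (a%:~R * cj w / 2).
    by rewrite cj_omega; move: (cj_omega m); move: (w) => t ht; rewrite !(cjM, cjB, cjV, cjz, cjn, cj1) ht; field.
  by rewrite rpredD // cjO.
have -> : (a%:~R + b%:~R * w) / 2 *: u = (a%:~R / 2) *: u + b%:~R *: ((w / 2) *: u).
  by rewrite scalerA -scalerDl; congr (_ *: _); field.
by apply: latD; apply: latZ; rewrite ?int_O.
Qed.

Lemma hn_nonfree_proj u z : H u u = 2 -> hn ((H z u / 2) *: u) = nrm (H z u) / 2.
Proof.
move=> hu; rewrite hnZ nrmM nrmV (nrmn m 2) (hn_uniq (q := 2)) ?hu ?rmorph_nat //.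
by field.
Qed.

Lemma no_norm2 (c : E) : (8 < m)%N -> c \in O -> nrm c <> 2.
Proof.
move=> m8' cO nc; have [|n Dn] := @small_omega m sqf m4 2 c m8' cO; first by rewrite nc.
move: nc; rewrite Dn nrmz => nc; have : n ^+ 2 = 2.
  by apply/eqP; rewrite -(eqr_int rat) rmorphXn /= nc.
exact: int_sqr_neq2.
Qed.

Lemma nat_sum4_eq2 (p q r t : nat) : (p + q + r + t = 2)%N ->
  p <> 2%N -> q <> 2%N -> r <> 1%N -> t <> 1%N ->
  [\/ [/\ p = 1, q = 1, r = 0 & t = 0]%N, [/\ p = 0, q = 0, r = 2 & t = 0]%N |
      [/\ p = 0, q = 0, r = 0 & t = 2]%N].
Proof.
case: p => [|[|[|p]]]; case: q => [|[|[|q]]]; case: r => [|[|[|r]]]; case: t => [|[|[|t]]] //= _ _;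
  by [constructor 1 | constructor 2 | constructor 3].
Qed.

(** For I = O + O (w / 2), the lattice I u_i is unimodular, as N(I) = 1/2 and H(u_i, u_i) = 2, so L
    projects into it. The projection of z has norm N(H(z, u_i)) / 2, never 1 because no integer has
    norm 2. Hence vectors of norm 1 are orthogonal to u1 and u2, and a vector of norm 2 is either
    +-e1 +- e2 or on one of the lines of u1, u2. *)
Lemma no_quaternary_m7mod8 : (8 < m)%N -> False.
Proof.
move=> m9; have h2 := two_neq0 m.
have [||u1 [u2 [Lu1 Lu2 Lw1 Lw2 [hu1 hu2 hu12]]]] := @represents_nonfree _ _ _ univ w.
- exact: omegaO.
- by have := half_mul_omega_cj; rewrite mulrC div1r.
have noe e u : L e -> hn e = 1 -> L u -> L ((w / 2) *: u) -> H u u = 2 -> H e u = 0.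
  move=> Le he Lu Lw hu; set f := (H e u / 2) *: u.
  have Lf : L f by exact: nonfree_proj.
  have nf : hn f = nrm (H e u) / 2 := hn_nonfree_proj e hu.
  have h1 : H (e - f) f = 0.
    by rewrite /f HBl !HZr HZl hu !cjM cjV cjn; field.
  have hs : hn e = hn f + hn (e - f).
    apply: (@rQ_inj m); rewrite rmorphD /= -!hnE.
    have -> : H e e = H ((e - f) + f) ((e - f) + f) by rewrite subrK.
    have h3 : H f (e - f) = 0 by rewrite HC h1 cj0.
    move: h1 h3; move: (e - f) => g h1 h3; clearbody f.
    by rewrite HDl !HDr h1 h3; ring.
  have [p Dp] := lat_hn_nat Lf; have [q Dq] := lat_hn_nat (latB Le Lf).
  have : (p + q = 1)%N by apply/eqP; rewrite -(eqr_nat rat) natrD -Dp -Dq -hs he.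
  case: p Dp => [|[|p]] // Dp _.
    apply/eqP; rewrite -nrm_eq0; apply/eqP; move: nf; rewrite Dp => nf; lra.
  case: (no_norm2 m9 (lat_form Le Lu)); move: nf; rewrite Dp => nf; lra.
have hne1 := hn_e1 he1; have hne2 := hn_e2 he2.
have g11 : H u1 e1 = 0 by rewrite HC noe ?cj0.
have g12 : H u1 e2 = 0 by rewrite HC noe ?cj0.
have g21 : H u2 e1 = 0 by rewrite HC noe ?cj0.
have g22 : H u2 e2 = 0 by rewrite HC noe ?cj0.
have D0 : 2 * 2 - 0 * cj 0 != 0 :> E by rewrite mul0r subr0 mulf_neq0.
have sm (k : E) : k \in O -> nrm k = 1 -> exists2 n : int, k = n%:~R & n = 1 \/ n = -1.
  move=> kO nk; have [|n Dn] := @small_omega m sqf m4 2 k m9 kO; first by rewrite nk.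
  exists n => //; move: nk; rewrite Dn nrmz => nk.
  by apply: int_sqr_eq1; apply/eqP; rewrite -(eqr_int rat) rmorphXn /= nk.
have dec z : L z -> H z z = 2 -> perp e1 e2 z = (H z u1 / 2) *: u1 + (H z u2 / 2) *: u2 /\
   [\/ exists k1 k2 : int, [/\ H z e1 = k1%:~R, H z e2 = k2%:~R, (k1 = 1 \/ k1 = -1) /\ (k2 = 1 \/ k2 = -1),
         H z u1 = 0 & H z u2 = 0],
       [/\ H z e1 = 0, H z e2 = 0, nrm (H z u1) = 4 & H z u2 = 0] |
       [/\ H z e1 = 0, H z e2 = 0, H z u1 = 0 & nrm (H z u2) = 4]].
  move=> Lz Hz.
  have [c1 [c2 [Dp q1 q2]]] := lat_coords rL Le1 Le2 he1 he2 he12 Lu1 Lu2 g11 g12 g21 g22 hu1 hu2 hu12 D0 Lz.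
  rewrite cj0 !mulr0 ?addr0 ?add0r in q1 q2.
  have Dp' : perp e1 e2 z = (H z u1 / 2) *: u1 + (H z u2 / 2) *: u2.
    by rewrite Dp -q1 -q2 !mulfK.
  split=> //.
  have [n1 Dn1] := lat_hn_nat (nonfree_proj Lu1 Lw1 Lz); rewrite hn_nonfree_proj // in Dn1.
  have [n2 Dn2] := lat_hn_nat (nonfree_proj Lu2 Lw2 Lz); rewrite hn_nonfree_proj // in Dn2.
  have [p Dpp] := nrm_nat (lat_form Lz Le1); have [q Dq] := nrm_nat (lat_form Lz Le2).
  have hp : hn (perp e1 e2 z) = nrm (H z u1) / 2 + nrm (H z u2) / 2.
    rewrite Dp' -(hn_nonfree_proj z hu1) -(hn_nonfree_proj z hu2).
    apply: (@rQ_inj m); rewrite rmorphD /= -!hnE.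
    have hu21 : H u2 u1 = 0 by rewrite HC hu12 cj0.
    by rewrite !(HDl, HDr, HZl, HZr) hu12 hu21; ring.
  have s : (p + q + n1 + n2 = 2)%N.
    apply/eqP; rewrite -(eqr_nat rat) !natrD -Dpp -Dq -addrA -Dn1 -Dn2 -hp -hn_perp //.
    by rewrite (hn2 (q := 2) Hz).
  have z0 (h : E) : nrm h = 0 -> h = 0 by move/eqP; rewrite nrm_eq0 => /eqP.
  have [||||[p1 q1' n10 n20]|[p1 q1' n10 n20]|[p1 q1' n10 n20]] := nat_sum4_eq2 s.
  - by move=> e; apply: (no_norm2 m9 (lat_form Lz Le1)); rewrite Dpp e.
  - by move=> e; apply: (no_norm2 m9 (lat_form Lz Le2)); rewrite Dq e.
  - by move=> e; apply: (no_norm2 m9 (lat_form Lz Lu1)); move: Dn1; rewrite e => Dn1; lra.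
  - by move=> e; apply: (no_norm2 m9 (lat_form Lz Lu2)); move: Dn2; rewrite e => Dn2; lra.
  - rewrite p1 in Dpp; rewrite q1' in Dq; rewrite n10 in Dn1; rewrite n20 in Dn2.
    have [k1 Dk1 k1E] := sm _ (lat_form Lz Le1) Dpp.
    have [k2 Dk2 k2E] := sm _ (lat_form Lz Le2) Dq.
    by constructor 1; exists k1, k2; split=> //; apply: z0; lra.
  - rewrite p1 in Dpp; rewrite q1' in Dq; rewrite n10 in Dn1; rewrite n20 in Dn2.
    by constructor 2; split; [exact: z0 | exact: z0 | lra | apply: z0; lra].
  rewrite p1 in Dpp; rewrite q1' in Dq; rewrite n10 in Dn1; rewrite n20 in Dn2.
  by constructor 3; split; [exact: z0 | exact: z0 | apply: z0; lra | lra].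
have [x [y [Lx Ly Hx Hy Hxy]]] := represents_A2 univ.
have hu21 : H u2 u1 = 0 by rewrite HC hu12 cj0.
have [Px cx] := dec x Lx Hx; have [Py cy] := dec y Ly Hy.
have := form_perp he1 he2 he12 x y; rewrite Hxy Px Py.
rewrite !(HDl, HDr, HZl, HZr) hu1 hu2 hu12 hu21 !(cjM, cjV, cjn) => F.
have {F} F : 1 = H x e1 * cj (H y e1) + H x e2 * cj (H y e2)
   + H x u1 * cj (H y u1) / 2 + H x u2 * cj (H y u2) / 2 by rewrite {1}F; field.
(* On one line, the product of two such vectors has norm 4 * 4 / 4 = 4. *)
have n4 (k l : E) : nrm k = 4 -> nrm l = 4 -> 1 <> k * cj l / 2.
  move=> nk nl e; have := congr1 (@nrm m) e.
  rewrite nrm1 !nrmM nrmV nrm_cj nk nl (nrmn m 2) => /eqP.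
  by rewrite (_ : 4 * 4 / 2 ^+ 2 = 4%:R :> rat) ?(eqr_nat rat 1 4) //; field.
have one0 : (1 : E) <> 0 by apply/eqP/oner_neq0.
case: cx => [[k1 [k2 [a1 a2 [ka kb] a3 a4]]]|[a1 a2 a3 a4]|[a1 a2 a3 a4]];
case: cy => [[l1 [l2 [b1 b2 [la lb] b3 b4]]]|[b1 b2 b3 b4]|[b1 b2 b3 b4]].
- move: F; rewrite a1 a2 a3 a4 b1 b2 b3 b4 !cjz cj0 => F.
  have /intE_inj : 1%:~R = (k1 * l1 + k2 * l2)%:~R :> E.
    by rewrite rmorphD !rmorphM /= [LHS]F; ring.
  by case: ka => ->; case: kb => ->; case: la => ->; case: lb => ->.
- by case: one0; rewrite F a3 a4 b1 b2 b4 !cj0; ring.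
- by case: one0; rewrite F a3 a4 b1 b2 b3 !cj0; ring.
- by case: one0; rewrite F a1 a2 b3 b4 !cj0; ring.
- by case: (n4 _ _ a3 b3); rewrite [LHS]F a1 a2 a4; ring.
- by case: one0; rewrite F a1 a2 a4 b3 !cj0; ring.
- by case: one0; rewrite F a1 a2 b3 b4 !cj0; ring.
- by case: one0; rewrite F a1 a2 a3 b4 !cj0; ring.
by case: (n4 _ _ a4 b4); rewrite [LHS]F a1 a2 a3; ring.
Qed.

End Nonfree.

(** Since m = 1 modulo 3, 4 N(a + b w) = (2 a + b)^2 + m b^2 is congruent to a sum of two squares
    modulo 3, and -1 is not a square there. *)
Lemma inert3_omega m : squarefree m -> (m %% 12 = 7)%N -> forall g, g \in ring_of_integers m ->
  dvO 3 (rQ m (nrm g)) -> dvO 3 g.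
Proof.
move=> sqf m12 g gO; have m4 : (m %% 4 = 3)%N by lia.
have [a [b [-> Dn]]] := O_omega sqf m4 gO; rewrite /dvO => h.
have [k Dk] : exists k : int, 4 * nrm (a%:~R + b%:~R * omega m) = (3 * k)%:~R.
  have : rQ m (4 * nrm (a%:~R + b%:~R * omega m) / 3) \in ring_of_integers m.
    rewrite -mulrA !rmorphM /= fmorphV !rmorph_nat; apply: rpredM; [exact: nat_O | exact: h].
  rewrite rQ_O => /intrP[k Dk]; exists k.
  by rewrite rmorphM /= -Dk; field.
have [t Dt] : exists t : nat, m = (12 * t + 7)%N by exists (m %/ 12)%N; have := divn_eq m 12; lia.
have {Dk} Dk : (2 * a + b) * (2 * a + b) + m%:Z * (b * b) = 3 * k.
  by apply/eqP; rewrite -(eqr_int rat) -Dk Dn !expr2.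
have /dvdz3_sum_squares[/dvdzP[u Du] /dvdzP[v Dv]] : (3 %| (2 * a + b) * (2 * a + b) + b * b)%Z.
  apply/dvdzP; exists (k - (4 * t%:Z + 2) * (b * b)).
  have -> : (k - (4 * t%:Z + 2) * (b * b)) * 3 = 3 * k - (12 * t%:Z + 6) * (b * b) by ring.
  by rewrite -Dk Dt PoszD PoszM; ring.
have Da : a = 3 * (a + v - u) by lia.
have -> : (a%:~R + b%:~R * omega m) / 3 = (a + v - u)%:~R + v%:~R * omega m.
  have h3 := natE_neq0 m 2; rewrite {1}Da Dv !rmorphM /=.
  move: (omega m) (a + v - u)%:~R => w n; by field.
by apply: rpredD; [exact: int_O | apply: rpredM; [exact: int_O | exact: omegaO]].
Qed.

Lemma unit_trace_omega m : squarefree m -> (m %% 4 = 3)%N -> (4 < m)%N ->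
  forall u, u \in ring_of_integers m -> nrm u = 1 -> u + Qconj u <> 1.
Proof.
move=> sqf m4 m5 u uO nu; have [|n ->] := @small_omega m sqf m4 1 u m5 uO; first by rewrite nu.
by rewrite cjz -rmorphD /= -[1]/(1%:~R) => /intE_inj; lia.
Qed.

Lemma nat_sum3_eq3 (p q r : nat) : (p + q + r = 3)%N -> p <> 3%N -> q <> 3%N -> r <> 1%N -> r <> 3%N ->
  [\/ [/\ p = 1, q = 0 & r = 2]%N, [/\ p = 0, q = 1 & r = 2]%N,
      [/\ p = 1, q = 2 & r = 0]%N | [/\ p = 2, q = 1 & r = 0]%N].
Proof.
case: p => [|[|[|[|p]]]]; case: q => [|[|[|[|q]]]]; case: r => [|[|[|[|r]]]] //= _ _;
  by [constructor 1 | constructor 2 | constructor 3 | constructor 4].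
Qed.

(** * The case m = 7 *)

Section Seven.
Variables (V : hermSpace 7) (L : hermLattice V).
Local Notation E := (QsqrtN 7).
Local Notation O := (ring_of_integers 7).
Local Notation cj := (@Qconj 7).
Local Notation H := (hform V).
Local Notation al := (omega 7).
Hypotheses (univ : two_universal L) (rL : has_rank L 4).
Variables (e1 e2 : V).
Hypotheses (Le1 : L e1) (Le2 : L e2) (he1 : H e1 e1 = 1) (he2 : H e2 e2 = 1) (he12 : H e1 e2 = 0).
Hypothesis no_e3 : forall z, L z -> H z e1 = 0 -> H z e2 = 0 -> hn z <> 1.

Lemma norm1_O7 (c : E) : c \in O -> nrm c = 1 -> exists2 n : int, c = n%:~R & n = 1 \/ n = -1.
Proof.
move=> cO nc; have [|n Dn] := @small_omega 7 squarefree7 erefl 1 c isT cO; first by rewrite nc.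
exists n => //; apply: int_sqr_eq1; apply/eqP; rewrite -(eqr_int rat) rmorphXn /=.
by rewrite -(nrmz 7) -Dn nc.
Qed.

Lemma norm3_O7 (c : E) : c \in O -> nrm c <> 3.
Proof.
move=> cO nc; have [a [b [Dx Dn]]] := O_omega squarefree7 (erefl _) cO.
have {Dn} : (2 * a + b) ^+ 2 + 7 * b ^+ 2 = 12.
  by apply/eqP; rewrite -(eqr_int rat) -Dn nc.
rewrite !expr2 => e; have hb : -1 <= b <= 1 by nia.
have h : -3 <= 2 * a + b <= 3 by nia.
have [eb|[eb|eb]] : b = -1 \/ b = 0 \/ b = 1 by lia.
all: have [ea|[ea|[ea|[ea|ea]]]] : a = -2 \/ a = -1 \/ a = 0 \/ a = 1 \/ a = 2 by lia.
all: by subst a b; lia.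
Qed.

Lemma nrm_al (a b : int) (n : nat) : (2 * a + b) ^+ 2 + 7 * b ^+ 2 = 4 * n%:Z ->
  nrm (a%:~R + b%:~R * al) = n%:R.
Proof.
move=> e; have := @nrm_omega 7 a b; rewrite (_ : 7%:Z = 7) // e => h.
have {}h : 4 * nrm (a%:~R + b%:~R * al) = 4 * n%:R by rewrite h rmorphM.
lra.
Qed.

Lemma hn_A2 (x y : V) c1 c2 : H x x = 2 -> H y y = 2 -> H x y = 1 ->
  hn (c1 *: x + c2 *: y) = nrm c1 + nrm c2 + nrm (c1 + c2).
Proof.
move=> Hx Hy Hxy; apply: (@rQ_inj 7); rewrite !rmorphD /= !nrmE -hnE.
by rewrite !(HDl, HDr, HZl, HZr) Hx Hy Hxy (HC y x) Hxy cj1 cjD; ring.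
Qed.

(** If one of the three terms vanishes, the other two agree and the sum is even. If none does, all
    are 1, so c1, c2 and c1 + c2 are all 1 or -1, against parity. The value 2 thus comes from one
    zero and two units, which are rational. *)
Lemma A2_norm (c1 c2 : E) : c1 \in O -> c2 \in O -> nrm c1 + nrm c2 + nrm (c1 + c2) <= 3 ->
  nrm c1 + nrm c2 + nrm (c1 + c2) <> 3 /\
  (nrm c1 + nrm c2 + nrm (c1 + c2) = 2 -> exists i j : int, c1 = i%:~R /\ c2 = j%:~R).
Proof.
move=> c1O c2O; have cO : c1 + c2 \in O by rewrite rpredD.
have [n1 D1] := nrm_nat c1O; have [n2 D2] := nrm_nat c2O; have [n3 D3] := nrm_nat cO.
have z0 (h : E) n : nrm h = n%:R -> n = 0%N -> h = 0.
  by move=> Dh n0; apply/eqP; rewrite -nrm_eq0 Dh n0.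
have int0 : exists n : int, 0 = n%:~R :> E by exists 0.
have int1 (h : E) : h \in O -> nrm h = 1 -> exists n : int, h = n%:~R.
  by move=> hO nh; have [n -> _] := norm1_O7 hO nh; exists n.
have [d1|n10] := eqVneq n1 0%N.
  have c10 := z0 _ _ D1 d1; rewrite c10 add0r nrm0 add0r.
  rewrite D2 -natrD; split; first by apply/eqP; rewrite (eqr_nat rat _ 3); lia.
  move/eqP; rewrite (eqr_nat rat _ 2) => h.
  have [|j ->] := int1 _ c2O; first by rewrite D2 (_ : n2 = 1%N) //; lia.
  by exists 0, j.
have [d2|n20] := eqVneq n2 0%N.
  have c20 := z0 _ _ D2 d2; rewrite c20 !addr0 nrm0 addr0.
  rewrite D1 -natrD; split; first by apply/eqP; rewrite (eqr_nat rat _ 3); lia.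
  move/eqP; rewrite (eqr_nat rat _ 2) => h.
  have [|j ->] := int1 _ c1O; first by rewrite D1 (_ : n1 = 1%N) //; lia.
  by exists j, 0.
have [d3|n30] := eqVneq n3 0%N.
  have c30 := z0 _ _ D3 d3.
  have Dc2 : c2 = - c1 by apply/eqP; rewrite -addr_eq0 addrC c30.
  rewrite c30 nrm0 addr0 Dc2 nrmN D1 -natrD; split; first by apply/eqP; rewrite (eqr_nat rat _ 3); lia.
  move/eqP; rewrite (eqr_nat rat _ 2) => h.
  have [|j ->] := int1 _ c1O; first by rewrite D1 (_ : n1 = 1%N) //; lia.
  by exists j, (- j); rewrite rmorphN.
rewrite D1 D2 D3 -!natrD (ler_nat rat _ 3) => h; split=> [_|].
  have [e1' e2' e3'] : [/\ n1 = 1, n2 = 1 & n3 = 1]%N by split; lia.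
  have [i Di hi] := norm1_O7 c1O (etrans D1 (congr1 _ e1')).
  have [j Dj hj] := norm1_O7 c2O (etrans D2 (congr1 _ e2')).
  have [k Dk hk] := norm1_O7 cO (etrans D3 (congr1 _ e3')).
  move: Dk; rewrite Di Dj -rmorphD /= => /intE_inj; lia.
by move/eqP; rewrite (eqr_nat rat _ 2); lia.
Qed.

(** 3 is not a norm from O, and the complement, spanned by A2, has no vectors of norm 1 or 3. So a
    vector of norm 3 splits along e1, e2 and the complement either as 1, 0, 2 in some order of e1,
    e2, with rational coordinates throughout, or as 1, 2, 0. No pairing of these types yields the
    product b = al - 2 of norm 4. *)
Lemma no_quaternary_m7_A2 : False.
Proof.
have [x [y [Lx Ly Hx Hy Hxy]]] := represents_A2 univ.
have P := A2_perp Le1 Le2 he1 he2 he12 no_e3 (unit_trace_omega squarefree7 erefl isT) Lx Ly Hx Hy Hxy.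
have C := A2_coords rL Le1 Le2 he1 he2 he12 (inert3_omega squarefree7 erefl) Lx Ly Hx Hy Hxy P.
have [b Db] : exists b : E, b = al - 2 by exists (al - 2).
have nb : nrm b = 4.
  rewrite (_ : b = (-2)%:~R + 1%:~R * al); last by rewrite Db rmorphN mul1r addrC.
  exact: (@nrm_al _ _ 4).
have bO : b \in O by rewrite Db rpredB ?omegaO ?nat_O.
have [v1 [v2 [Lv1 Lv2 H1 H2 H12]]] : exists y1 y2, [/\ L y1, L y2, H y1 y1 = 3%:R, H y2 y2 = 3%:R & H y1 y2 = b].
  by apply: (represents_binary univ) => //; rewrite nb (ltr_nat rat 4 9).
have z0 (h : E) n : nrm h = n%:R -> n = 0%N -> h = 0.
  by move=> Dh n0; apply/eqP; rewrite -nrm_eq0 Dh n0.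
have dec v : L v -> H v v = 3%:R ->
   (exists k1 k2 i j : int, [/\ H v e1 = k1%:~R, H v e2 = k2%:~R, perp e1 e2 v = i%:~R *: x + j%:~R *: y
       & (nrm (H v e1) = 1 /\ H v e2 = 0) \/ (H v e1 = 0 /\ nrm (H v e2) = 1)]) \/
   (perp e1 e2 v = 0 /\ ((nrm (H v e1) = 1 /\ nrm (H v e2) = 2) \/ (nrm (H v e1) = 2 /\ nrm (H v e2) = 1))).
  move=> Lv Hv; have Lp := perp_lat Le1 Le2 Lv.
  have [c1 [c2 [c1O c2O Dp]]] := C v Lv.
  have [p Dpp] := nrm_nat (lat_form Lv Le1); have [q Dq] := nrm_nat (lat_form Lv Le2).
  have [r Dr] := lat_hn_nat Lp.
  have s : (p + q + r = 3)%N.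
    by apply/eqP; rewrite -(eqr_nat rat) !natrD -Dpp -Dq -Dr -hn_perp // (hn2 Hv).
  have r1 : r <> 1%N.
    by move=> e; apply: (no_e3 Lp); rewrite ?perp_e1 ?perp_e2 // Dr e.
  have hA := hn_A2 c1 c2 Hx Hy Hxy; rewrite -Dp Dr in hA.
  have [|A3 A2] := A2_norm c1O c2O; first by rewrite -hA (ler_nat rat _ 3); lia.
  rewrite -hA in A3 A2.
  have p3 : p <> 3%N by move=> e; apply: (norm3_O7 (lat_form Lv Le1)); rewrite Dpp e.
  have q3 : q <> 3%N by move=> e; apply: (norm3_O7 (lat_form Lv Le2)); rewrite Dq e.
  have r3 : r <> 3%N by move=> e; apply: A3; rewrite e.
  have [[p1 q1 r2]|[p1 q1 r2]|[p1 q1 r2]|[p1 q1 r2]] := nat_sum3_eq3 s p3 q3 r1 r3.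
  - rewrite p1 in Dpp; rewrite q1 in Dq; have [|i [j [Di Dj]]] := A2; first by rewrite r2.
    have [n Dn _] := norm1_O7 (lat_form Lv Le1) Dpp.
    left; exists n, 0, i, j; split; rewrite ?Dp ?Di ?Dj //; first exact: z0 Dq _.
    by left; rewrite (z0 _ _ Dq).
  - rewrite p1 in Dpp; rewrite q1 in Dq; have [|i [j [Di Dj]]] := A2; first by rewrite r2.
    have [n Dn _] := norm1_O7 (lat_form Lv Le2) Dq.
    left; exists 0, n, i, j; split; rewrite ?Dp ?Di ?Dj //; first exact: z0 Dpp _.
    by right; rewrite (z0 _ _ Dpp).
  - right; split; last by left; rewrite Dpp Dq p1 q1.
    by apply: (lat_hn_eq0 Lp); rewrite Dr r2.
  right; split; last by right; rewrite Dpp Dq p1 q1.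
  by apply: (lat_hn_eq0 Lp); rewrite Dr r2.
have F := form_perp he1 he2 he12 v1 v2; rewrite H12 in F.
have mixed (k1 k2 l1 l2 : E) : (nrm k1 = 1 /\ k2 = 0) \/ (k1 = 0 /\ nrm k2 = 1) ->
    (nrm l1 = 1 /\ nrm l2 = 2) \/ (nrm l1 = 2 /\ nrm l2 = 1) ->
  nrm (k1 * cj l1 + k2 * cj l2) <= 2.
  move=> [[n1 ->]|[-> n2]] [[m1 m2]|[m1 m2]];
    by rewrite ?mul0r ?addr0 ?add0r nrmM nrm_cj ?n1 ?n2 ?m1 ?m2 ?mul1r; lra.
have d1 := dec v1 Lv1 H1; have d2 := dec v2 Lv2 H2.
(* Two vectors with rational coordinates have a rational product, unlike b; a mixed pair has a
   product of norm at most 2 < 4. *)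
destruct d1 as [d1|[ap ac]]; destruct d2 as [d2|[bp bc]].
- destruct d1 as [k1 [k2 [i [j [a1 a2 ap _]]]]].
  destruct d2 as [l1 [l2 [i' [j' [b1 b2 bp _]]]]].
  have Hyx : H y x = 1 by rewrite HC Hxy cj1.
  have := @omega_not_int 7
    (2 + k1 * l1 + k2 * l2 + 2 * (i * i') + 2 * (j * j') + i * j' + j * i').
  rewrite /dvO; case/negP.
  suff -> : al = (2 + k1 * l1 + k2 * l2 + 2 * (i * i') + 2 * (j * j') + i * j' + j * i')%:~R.
    by rewrite subrr mul0r rpred0.
  have -> : al = b + 2 by rewrite Db subrK.
  rewrite F a1 a2 b1 b2 ap bp !(HDl, HDr, HZl, HZr) !cjz Hx Hy Hxy Hyx.
  by rewrite !rmorphD !rmorphM /=; ring.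
- destruct d1 as [? [? [? [? [_ _ _ ac]]]]]; have := mixed _ _ _ _ ac bc.
  by move: F; rewrite bp H0r addr0 => <-; rewrite nb (ler_nat rat 4 2).
- destruct d2 as [? [? [? [? [_ _ _ bc]]]]]; have := mixed _ _ _ _ bc ac.
  have -> : H v2 e1 * cj (H v1 e1) + H v2 e2 * cj (H v1 e2) = cj b.
    by rewrite F ap H0l addr0 !(cjD, cjM, QconjK) [_ * H v2 e1]mulrC [_ * H v2 e2]mulrC.
  by rewrite nrm_cj nb (ler_nat rat 4 2).
have {}F : b = H v1 e1 * cj (H v2 e1) + H v1 e2 * cj (H v2 e2).
  by rewrite F ap H0l addr0.
have k1O := lat_form Lv1 Le1; have k2O := lat_form Lv1 Le2.
have l1O := lat_form Lv2 Le1; have l2O := lat_form Lv2 Le2.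
(* k cj l is 1 or -1, and b minus it should have norm 4; but N(al - 3) = 8 and N(al - 1) = 2. *)
have aligned (k l k' l' : E) : k \in O -> l \in O -> nrm k = 1 -> nrm l = 1 ->
    nrm k' = 2 -> nrm l' = 2 -> b = k * cj l + k' * cj l' -> False.
  move=> kO lO nk nl nk' nl' e.
  have [p Dp hp] := norm1_O7 kO nk; have [q Dq hq] := norm1_O7 lO nl.
  have : nrm (b - k * cj l) = 4 by rewrite e [_ + k' * _]addrC addrK nrmM nrm_cj nk' nl'; lra.
  rewrite Dp Dq cjz -rmorphM /=.
  have -> : b - (p * q)%:~R = (- (2 + p * q))%:~R + 1%:~R * al.
    by rewrite Db rmorphN rmorphD; ring.
  have [->|->] : p * q = 1 \/ p * q = -1 by case: hp => ->; case: hq => ->; [left|right|right|left].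
    by rewrite (@nrm_al _ _ 8) // => /eqP; rewrite (eqr_nat rat 8 4).
  by rewrite (@nrm_al _ _ 2) // => /eqP; rewrite (eqr_nat rat 2 4).
(* k cj l is al, 1 - al, -al or al - 1, and b minus it has norm 4, 11, 8 or 1 instead of 2. *)
have crossed (k l k' l' : E) : k \in O -> l \in O -> k' \in O -> l' \in O ->
    nrm k = 1 -> nrm l' = 1 ->
    nrm k' = 2 -> nrm l = 2 -> b = k * cj l + k' * cj l' -> False.
  move=> kO lO k'O l'O nk nl nk' nl' e.
  have n2 : nrm (b - k * cj l) = 2.
    by rewrite e [_ + k' * _]addrC addrK nrmM nrm_cj nk' nl; lra.
  have gO : k * cj l \in O by rewrite rpredM ?cjO.
  have ng : nrm (k * cj l) = 2 by rewrite nrmM nrm_cj nk nl'; lra.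
  case: (norm2_O7 gO ng) => [[g|g]|[g|g]]; move: n2; rewrite g.
  - have -> : b - al = (-2)%:~R + 0%:~R * al by rewrite Db rmorphN mul0r; ring.
    by rewrite (@nrm_al _ _ 4) // => /eqP; rewrite (eqr_nat rat 4 2).
  - have -> : b - (1 - al) = (-3)%:~R + 2%:~R * al by rewrite Db rmorphN; ring.
    by rewrite (@nrm_al _ _ 11) // => /eqP; rewrite (eqr_nat rat 11 2).
  - have -> : b - - al = (-2)%:~R + 2%:~R * al by rewrite Db rmorphN; ring.
    by rewrite (@nrm_al _ _ 8) // => /eqP; rewrite (eqr_nat rat 8 2).
  have -> : b - - (1 - al) = (-1)%:~R + 0%:~R * al by rewrite Db rmorphN mul0r; ring.
  by rewrite (@nrm_al _ _ 1) // => /eqP; rewrite (eqr_nat rat 1 2).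
have F' : b = H v1 e2 * cj (H v2 e2) + H v1 e1 * cj (H v2 e1) by rewrite F addrC.
case: ac => [[a1 a2]|[a1 a2]]; case: bc => [[b1 b2]|[b1 b2]].
- exact: aligned k1O l1O a1 b1 a2 b2 F.
- exact: crossed k1O l1O k2O l2O a1 b2 a2 b1 F.
- exact: crossed k2O l2O k1O l1O a2 b1 a1 b2 F'.
exact: aligned k2O l2O a2 b2 a1 b1 F'.
Qed.

End Seven.

Lemma squarefree_mod4 (m : nat) : squarefree m -> (m %% 4 <> 0)%N.
Proof.
by move=> sqf h; have := sqf 2%N; rewrite (_ : 2 ^ 2 = 4)%N // /dvdn h => /(_ isT).
Qed.

Lemma squarefree_lt4 (n : nat) : (0 < n < 4)%N -> squarefree n.
Proof.
case/andP=> n0 n4 [|[|d]] //; first by rewrite dvd0n => /eqP n0'; rewrite n0' in n0.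
by move/(dvdn_leq n0); rewrite -mulnn; lia.
Qed.

Lemma unit_trace1 (u : QsqrtN 1) : u \in ring_of_integers 1 -> u + Qconj u <> 1.
Proof.
by move=> uO; have [k ->] := trace_even1 uO; rewrite -[1]/(1%:~R) => /intE_inj; lia.
Qed.

Lemma inert3_gauss (g : QsqrtN 1) : g \in ring_of_integers 1 ->
  dvO 3 (rQ 1 (nrm g)) -> dvO 3 g.
Proof.
move=> gO; have sqf1 := @squarefree_lt4 1 isT.
have [a [b [-> ->]]] := O_sqrt sqf1 (or_introl erefl) gO.
rewrite /dvO rmorph_int (dvd_nat_O 1 (t := 3)) // => h.
have /dvdz3_sum_squares[/dvdzP[u Du] /dvdzP[v Dv]] : (3 %| a * a + b * b)%Z.
  by rewrite -!expr2 -[b ^+ 2]mul1r; exact: h.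
have -> : (a%:~R + b%:~R * sqrtN 1) / 3 = u%:~R + v%:~R * sqrtN 1.
  by have h3 := natE_neq0 1 2; rewrite Du Dv !rmorphM /=; field.
by apply: rpredD; [exact: int_O | apply: rpredM; [exact: int_O | exact: sO]].
Qed.

Lemma norm2_O3 (c : QsqrtN 3) : c \in ring_of_integers 3 -> nrm c <> 2.
Proof.
move=> cO nc; have sqf3 := @squarefree_lt4 3 isT.
have [a [b [Dx Dn]]] := O_omega sqf3 (erefl _) cO.
have {Dn} : (2 * a + b) ^+ 2 + 3 * b ^+ 2 = 8.
  by apply/eqP; rewrite -(eqr_int rat) -Dn nc.
rewrite !expr2 => e; have hb : -1 <= b <= 1 by nia.
have h : -2 <= 2 * a + b <= 2 by nia.
have [eb|[eb|eb]] : b = -1 \/ b = 0 \/ b = 1 by lia.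
all: have [ea|[ea|ea]] : a = -1 \/ a = 0 \/ a = 1 by lia.
all: by subst a b; lia.
Qed.

(* The form [2, -1 + s; -1 - s, 2] over Z[sqrt(-2)] is even: twice its value is
   X^2 + 2 Y^2 + c^2 + 2 d^2 with X = c and Y = c + d mod 2. *)
Lemma even_form2 (a b c d : int) :
  let X := 2 * a - c + 2 * d in let Y := 2 * b - c - d in
  X ^+ 2 + 2 * Y ^+ 2 + (c ^+ 2 + 2 * d ^+ 2) <> 2.
Proof.
move=> X Y; rewrite !expr2 => e.
have hX : X + c = 2 * (a + d) by rewrite /X; ring.
have hY : Y + c + d = 2 * b by rewrite /Y; ring.
clearbody X Y.
have [h1 h2 h3 h4] : [/\ -1 <= X <= 1, -1 <= Y <= 1, -1 <= c <= 1 & -1 <= d <= 1].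
  by split; nia.
have [X0|[X0|X0]] : X = -1 \/ X = 0 \/ X = 1 by lia.
all: have [Y0|[Y0|Y0]] : Y = -1 \/ Y = 0 \/ Y = 1 by lia.
all: have [c0|[c0|c0]] : c = -1 \/ c = 0 \/ c = 1 by lia.
all: have [d0|[d0|d0]] : d = -1 \/ d = 0 \/ d = 1 by lia.
all: by subst X Y c d; lia.
Qed.

(** sqrt(-2) has norm 2, so small coordinates need not be rational as [no_norm1_small] demands; the
    evenness of the form takes the place of that argument. *)
Lemma no_norm1_two (V : hermSpace 2) (x1 x2 : V) :
    hform V x1 x1 = 2%:R -> hform V x2 x2 = 2%:R -> hform V x1 x2 = -1 + sqrtN 2 ->
  forall c1 c2, c1 \in ring_of_integers 2 -> c2 \in ring_of_integers 2 ->
  hn (c1 *: x1 + c2 *: x2) <> 1.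
Proof.
move=> Ha Hd Hb c1 c2 c1O c2O h.
have sqf2 := @squarefree_lt4 2 isT.
have [a [b [D1 _]]] := O_sqrt sqf2 (or_intror erefl) c1O.
have [c [d [D2 N2]]] := O_sqrt sqf2 (or_intror erefl) c2O.
have := hn_comb2 c1 c2 Ha Hd Hb; rewrite h N2.
have -> : 2%:R * c1 + c2 * Qconj (-1 + sqrtN 2) =
    rQ 2 (2 * a - c + 2 * d)%:~R + rQ 2 (2 * b - c - d)%:~R * sqrtN 2.
  have s2 := s_sqr 2.
  rewrite D1 D2 cjD cjN cj1 cj_s !rmorph_int.
  transitivity ((2 * a%:~R - c%:~R) + (2 * b%:~R - c%:~R - d%:~R) * sqrtN 2 - d%:~R * (sqrtN 2 * sqrtN 2) : QsqrtN 2).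
    by ring.
  by rewrite s2 !(rmorphB, rmorphD, rmorphM) /=; ring.
rewrite (nrm_coord (erefl _)).
have -> : nrm (-1 + sqrtN 2) = 3.
  rewrite (@nrm_coord _ (-1) 1); first by ring.
  by rewrite rmorphN /= rmorph1 mul1r.
move=> e; apply: (@even_form2 a b c d); apply/eqP; rewrite -(eqr_int rat); apply/eqP.
by move: e; rewrite /= !expr2 !(rmorphB, rmorphD, rmorphM) /=; lra.
Qed.

Lemma nrm_omega1 m : 4 * nrm (omega m) = m.+1%:R.
Proof.
have := @nrm_omega m 0 1; rewrite add0r mul1r => ->.
have -> : (2 * 0 + 1) ^+ 2 + m%:Z * 1 ^+ 2 = m.+1%:Z by rewrite !expr2; lia.
by rewrite -pmulrn.
Qed.

(** * The possible values of m *)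

Section FourDim.
Variables (m : nat) (V : hermSpace m) (L : hermLattice V).
Local Notation E := (QsqrtN m).
Local Notation O := (ring_of_integers m).
Local Notation cj := (@Qconj m).
Local Notation H := (hform V).
Hypotheses (m_gt0 : (0 < m)%N) (m_sqf : squarefree m).
Hypotheses (L_rank : has_rank L 4) (L_univ : two_universal L)
  (L_min : ~ exists M : hermLattice V, [/\ sublattice M L, has_rank M 3 & two_universal M]).
Variables (e1 e2 : V).
Hypotheses (Le1 : L e1) (Le2 : L e2) (he1 : H e1 e1 = 1) (he2 : H e2 e2 = 1) (he12 : H e1 e2 = 0).

(** With e1 and e2, such a vector would span a 2-universal sublattice <1, 1, c>, against [L_min]. *)
Lemma no_orthogonal_norm (c : nat) (rho : rat) : rho < 1 -> (0 < c)%N ->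
    (forall x : E, exists2 q, q \in O & nrm (x - q) <= rho) ->
    (forall (S : hermSpace m) (x1 x2 x3 v1 v2 : S), (forall v : S, v != 0 -> 0 < hn v) ->
       integral3 x1 x2 x3 -> gdet x1 x2 x3 = c%:R -> span3 x1 x2 x3 v1 -> span3 x1 x2 x3 v2 ->
     exists z1 z2 z3 : S, [/\ orthobasis c z1 z2 z3, span3 z1 z2 z3 v1 & span3 z1 z2 z3 v2]) ->
  forall z, L z -> H z e1 = 0 -> H z e2 = 0 -> hn z <> c%:R.
Proof.
move=> r1 c0 euc emb z Lz h1 h2 hz; apply: L_min.
have euc' (x : E) : exists2 q, q \in O & nrm (x - q) < 1.
  by have [q qO hq] := euc x; exists q => //; apply: le_lt_trans hq r1.
apply: (ternary_two_universal euc' m_sqf m_gt0 c0 emb Le1 Le2 Lz).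
split; [split=> // | by rewrite HC he12 cj0 | by [] | by []].
by rewrite hnE hz rmorph_nat.
Qed.

Lemma no_quaternary_m12mod4 : (m %% 4 = 1)%N \/ (m %% 4 = 2)%N -> (5 <= m)%N -> False.
Proof.
(* b is sqrt(-m) for odd m and -1 + sqrt(-m) for even m, so that N(b) + 1 = 2 d is even. *)
move=> m12 m5; pose k : int := - (~~ odd m)%:Z.
have nb : nrm (k%:~R + sqrtN m) = (~~ odd m + m)%:R.
  rewrite (@nrm_coord _ k%:~R 1); last by rewrite rmorph1 mul1r rmorph_int.
  have -> : k%:~R = - (~~ odd m)%:R :> rat by rewrite /k; case: (odd m).
  by rewrite natrD; case: (odd m) => /=; ring.
apply: (no_quaternary_even_unimodular L_univ L_rank Le1 Le2 he1 he2 he12 (d := ((~~ odd m + m + 1) %/ 2)%N) (b := k%:~R + sqrtN m)).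
- by move=> c; apply: small4_sqrt.
- by move=> n; apply: sqrt_not_int.
- by apply: rpredD; [exact: int_O | exact: sO].
rewrite nb natr1; congr (_%:R).
have -> : odd m = (m %% 2 == 1)%N by rewrite modn2; case: (odd m).
by case: m12 => h; case: eqP => h'; lia.
Qed.

(** N(omega) + 1 = (m + 5) / 4 is even for m = 3 modulo 8. The bound 19 makes all integers of norm
    at most 4 rational; for m = 11, omega itself has norm 3. *)
Lemma no_quaternary_m3mod8 : (m %% 8 = 3)%N -> (19 <= m)%N -> False.
Proof.
move=> m8 m19; have m4 : (m %% 4 = 3)%N by lia.
apply: (no_quaternary_even_unimodular L_univ L_rank Le1 Le2 he1 he2 he12 (d := ((m + 5) %/ 8)%N) (b := omega m)).
- by move=> c; apply: (@small_omega m m_sqf m4 4); lia.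
- by move=> n; apply: omega_not_int.
- exact: omegaO.
have : 4 * (2 * ((m + 5) %/ 8))%:R = 4 * (nrm (omega m) + 1) :> rat.
  rewrite mulrDr nrm_omega1 -[LHS](natrM _ 4) mulr1 -[RHS]natrD; congr (_%:R); lia.
by apply: mulfI.
Qed.

End FourDim.

Lemma quaternary_m1 (V : hermSpace 1) (L : hermLattice V) (e1 e2 : V) :
    has_rank L 4 -> two_universal L ->
    ~ (exists M : hermLattice V, [/\ sublattice M L, has_rank M 3 & two_universal M]) ->
    L e1 -> L e2 -> hform V e1 e1 = 1 -> hform V e2 e2 = 1 -> hform V e1 e2 = 0 ->
  isometric_gram L (orthosum_gram (diag_gram [:: 1; 1]) (binary_gram 2 1 1 2)).
Proof.
move=> rL univ Lmin Le1 Le2 he1 he2 he12.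
have no_e3 z : L z -> hform V z e1 = 0 -> hform V z e2 = 0 -> hn z <> 1.
  apply: (no_orthogonal_norm (m := 1%N) isT (@squarefree_lt4 1 isT) Lmin Le1 Le2 he1 he2 he12 (c := 1%N)
    _ isT euclid1) => [|S x1 x2 x3 v1 v2 pd i3 gd s1 s2]; first by lra.
  have [y1 [y2 [y3 [oy ry]]]] := unimodular_ternary1 pd i3 gd.
  by exists y1, y2, y3; split=> //; [exact: span3_trans ry s1 | exact: span3_trans ry s2].
have [x [y [Lx Ly Hx Hy Hxy]]] := represents_A2 univ.
have P := A2_perp Le1 Le2 he1 he2 he12 no_e3 (fun u uO _ => @unit_trace1 u uO) Lx Ly Hx Hy Hxy.
have C := A2_coords rL Le1 Le2 he1 he2 he12 inert3_gauss Lx Ly Hx Hy Hxy P.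
have [h1 h2 h3 h4] := P.
have Hyx : hform V y x = 1 by rewrite HC Hxy cj1.
apply: (isometric_gram4 Le1 Le2 he1 he2 he12 Lx Ly h1 h2 h3 h4 Hx Hy Hxy Hyx _ C).
have -> : 2 * 2 - 1 * 1 = 3 :> QsqrtN 1 by ring.
exact: (natE_neq0 1 2).
Qed.

Lemma quaternary_m2 (V : hermSpace 2) (L : hermLattice V) (e1 e2 : V) :
    has_rank L 4 -> two_universal L ->
    L e1 -> L e2 -> hform V e1 e1 = 1 -> hform V e2 e2 = 1 -> hform V e1 e2 = 0 ->
  isometric_gram L (orthosum_gram (diag_gram [:: 1; 1])
    (binary_gram 2 (- 1 + sqrtN 2) (- 1 + Qconj (sqrtN 2)) 2)).
Proof.
move=> rL univ Le1 Le2 he1 he2 he12.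
have nb : nrm (-1 + sqrtN 2) = 3.
  rewrite (@nrm_coord _ (-1) 1); first by ring.
  by rewrite rmorphN /= rmorph1 mul1r.
have bO : -1 + sqrtN 2 \in ring_of_integers 2.
  by apply: rpredD; [rewrite rpredN rpred1 | exact: sO].
have [x1 [x2 [L1 L2 H1 H2 H12]]] : exists y1 y2, [/\ L y1, L y2,
    hform V y1 y1 = 2%:R, hform V y2 y2 = 2%:R & hform V y1 y2 = -1 + sqrtN 2].
  by apply: (represents_binary univ) => //; rewrite nb (ltr_nat rat 3 4).
have det1 : (2 * 2)%:R = nrm (-1 + sqrtN 2) + 1 :> rat by rewrite nb -[RHS](natrD _ 3 1).
have := unimodular_isometric rL Le1 Le2 he1 he2 he12 L1 L2 H1 H2 H12 det1 (no_norm1_two H1 H2 H12).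
by rewrite cjD cjN cj1.
Qed.

Lemma quaternary_m11 (V : hermSpace 11) (L : hermLattice V) (e1 e2 : V) :
    squarefree 11 -> has_rank L 4 -> two_universal L ->
    L e1 -> L e2 -> hform V e1 e1 = 1 -> hform V e2 e2 = 1 -> hform V e1 e2 = 0 ->
  isometric_gram L (orthosum_gram (diag_gram [:: 1; 1])
    (binary_gram 2 (omega 11) (Qconj (omega 11)) 2)).
Proof.
move=> sqf rL univ Le1 Le2 he1 he2 he12.
have nb : nrm (omega 11) = 3.
  by have := nrm_omega1 11; rewrite (natrM _ 4 3) => /(mulfI (isT : 4 != 0 :> rat)).
have bO : omega 11 \in ring_of_integers 11 by exact: omegaO.
have [x1 [x2 [L1 L2 H1 H2 H12]]] : exists y1 y2, [/\ L y1, L y2,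
    hform V y1 y1 = 2%:R, hform V y2 y2 = 2%:R & hform V y1 y2 = omega 11].
  by apply: (represents_binary univ) => //; rewrite nb (ltr_nat rat 3 4).
have det1 : (2 * 2)%:R = nrm (omega 11) + 1 :> rat by rewrite nb -[RHS](natrD _ 3 1).
apply: (unimodular_isometric rL Le1 Le2 he1 he2 he12 L1 L2 H1 H2 H12 det1).
apply: (no_norm1_small _ _ H1 H2 H12 bO det1).
  by move=> c; apply: (@small_omega 11 sqf erefl 2).
exact: omega_not_int.
Qed.

(** In a copy of <1, 2>, the vector of norm 1 is a unit multiple of e1 or e2. The vector of norm 2
    is not in the complement, and no integer has norm 2, so its coordinates along e1 and e2 are both
    units and the two vectors are not orthogonal. *)
Lemma no_quaternary_m3 (V : hermSpace 3) (L : hermLattice V) (e1 e2 : V) :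
    two_universal L ->
    ~ (exists M : hermLattice V, [/\ sublattice M L, has_rank M 3 & two_universal M]) ->
    L e1 -> L e2 -> hform V e1 e1 = 1 -> hform V e2 e2 = 1 -> hform V e1 e2 = 0 -> False.
Proof.
move=> univ Lmin Le1 Le2 he1 he2 he12.
have no_e3 c : (0 < c <= 2)%N -> forall z, L z -> hform V z e1 = 0 -> hform V z e2 = 0 -> hn z <> c%:R.
  move=> c12; have c0 : (0 < c)%N by case/andP: c12.
  apply: (no_orthogonal_norm (m := 3%N) isT (@squarefree_lt4 3 isT) Lmin Le1 Le2 he1 he2 he12 _ c0 euclid3)
    => [|S x1 x2 x3 v1 v2 pd i3 gd s1 s2]; first by lra.
  have [y1 [y2 [y3 [oy ry]]]] := ternary3 pd c12 i3 gd.
  by exists y1, y2, y3; split=> //; [exact: span3_trans ry s1 | exact: span3_trans ry s2].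
have [y1 [y2 [L1 L2 H1 H2 H12]]] : exists y1 y2, [/\ L y1, L y2,
    hform V y1 y1 = 1%:R, hform V y2 y2 = 2%:R & hform V y1 y2 = 0].
  by apply: (represents_binary univ); rewrite ?rpred0 // nrm0 (ltr_nat rat 0 2).
have no1 := no_e3 1%N isT; have no2 := no_e3 2%N isT.
have Lp := perp_lat Le1 Le2 L1.
have [p Dp] := nrm_nat (lat_form L1 Le1); have [q Dq] := nrm_nat (lat_form L1 Le2).
have [r Dr] := lat_hn_nat Lp.
have s : (p + q + r = 1)%N.
  by apply/eqP; rewrite -(eqr_nat rat) !natrD -Dp -Dq -Dr -hn_perp // (hn2 H1).
have r0 : r = 0%N.
  case: r s Dr => [//|[|r]] s Dr; last by lia.
  by case: (no1 _ Lp); rewrite ?perp_e1 ?perp_e2.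
have p0 : perp e1 e2 y1 = 0 by apply: (lat_hn_eq0 Lp); rewrite Dr r0.
have F := form_perp he1 he2 he12 y1 y2; rewrite H12 p0 H0l addr0 in F.
have z0 (h : QsqrtN 3) : nrm h = 0 -> h = 0 by move/eqP; rewrite nrm_eq0 => /eqP.
case: (norm2_split Le1 Le2 he1 he2 he12 no1 L2 H2) => [[a1 a2]|[a1 a2 _]|[a1 _ _]|[_ a2 _]].
- by apply: (no2 _ L2 a1 a2); rewrite (hn2 H2).
- have [[p1 q1]|[p1 q1]] : (p = 1%N /\ q = 0%N) \/ (p = 0%N /\ q = 1%N) by lia.
    move: F; rewrite [hform V y1 e2]z0 ?Dq ?q1 // mul0r addr0 => /(congr1 (@nrm 3)).
    by rewrite nrm0 nrmM nrm_cj Dp a1 p1 mulr1 => /eqP.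
  move: F; rewrite [hform V y1 e1]z0 ?Dp ?p1 // mul0r add0r => /(congr1 (@nrm 3)).
  by rewrite nrm0 nrmM nrm_cj Dq a2 q1 mulr1 => /eqP.
- exact: norm2_O3 (lat_form L2 Le1) a1.
exact: norm2_O3 (lat_form L2 Le2) a2.
Qed.

Lemma no_quaternary_m7 (V : hermSpace 7) (L : hermLattice V) (e1 e2 : V) :
    has_rank L 4 -> two_universal L ->
    ~ (exists M : hermLattice V, [/\ sublattice M L, has_rank M 3 & two_universal M]) ->
    L e1 -> L e2 -> hform V e1 e1 = 1 -> hform V e2 e2 = 1 -> hform V e1 e2 = 0 -> False.
Proof.
move=> rL univ Lmin Le1 Le2 he1 he2 he12.
apply: (no_quaternary_m7_A2 univ rL Le1 Le2 he1 he2 he12).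
apply: (no_orthogonal_norm (m := 7%N) isT squarefree7 Lmin Le1 Le2 he1 he2 he12 (c := 1%N) _ isT euclid7).
  by lra.
exact: binary_in_unimodular7.
Qed.

Theorem mainTheorem6 (m : nat) (m_gt0 : (0 < m)%N) (m_sqf : squarefree m)
    (V : hermSpace m) (L : hermLattice V)
    (L_rank : has_rank L 4) (L_univ : two_universal L)
    (L_min : ~ exists M : hermLattice V,
       [/\ sublattice M L, has_rank M 3 & two_universal M]) :
  [\/ m = 1%N /\
      isometric_gram L
        (orthosum_gram (diag_gram [:: 1; 1]) (binary_gram 2 1 1 2)),
      m = 2%N /\
      (let omega := sqrtN m in
       isometric_gram L
         (orthosum_gram (diag_gram [:: 1; 1])
            (binary_gram 2 (- 1 + omega) (- 1 + Qconj omega) 2)))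
    | m = 11%N /\
      (let omega := (1 + sqrtN m) / 2 in
       isometric_gram L
         (orthosum_gram (diag_gram [:: 1; 1])
            (binary_gram 2 omega (Qconj omega) 2)))].
Proof.
have [e1 [e2 [Le1 Le2 he1 he2 he12]]] : exists y1 y2, [/\ L y1, L y2,
    hform V y1 y1 = 1%:R, hform V y2 y2 = 1%:R & hform V y1 y2 = 0].
  by apply: (represents_binary L_univ); rewrite ?rpred0 // nrm0 (ltr_nat rat 0 1).
have := squarefree_mod4 m_sqf.
have [m1|m1] := eqVneq m 1%N.
  by move=> _; constructor 1; subst m; split=> //; apply: (quaternary_m1 L_rank L_univ L_min Le1 Le2).
have [m2|m2] := eqVneq m 2%N.
  by move=> _; constructor 2; subst m; split=> //; apply: (quaternary_m2 L_rank L_univ Le1 Le2).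
have [m3|m3] := eqVneq m 3%N.
  by subst m; case: (no_quaternary_m3 L_univ L_min Le1 Le2 he1 he2 he12).
have [m7|m7] := eqVneq m 7%N.
  by subst m; case: (no_quaternary_m7 L_rank L_univ L_min Le1 Le2 he1 he2 he12).
have [m11|m11] := eqVneq m 11%N.
  by move=> _; constructor 3; subst m; split=> //; apply: (quaternary_m11 m_sqf L_rank L_univ Le1 Le2).
move=> m4; exfalso.
(* Without 1, 2, 3, 7, 11 these classes start at 5, 19 and 15, within the bounds of the three
   lemmas. *)
have [h|[h|h]] : ((m %% 4 = 1 \/ m %% 4 = 2) \/ (m %% 8 = 3) \/ (m %% 8 = 7))%N by lia.
- by apply: (no_quaternary_m12mod4 m_gt0 m_sqf L_rank L_univ Le1 Le2 he1 he2 he12 h); lia.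
- by apply: (no_quaternary_m3mod8 m_gt0 m_sqf L_rank L_univ Le1 Le2 he1 he2 he12 h); lia.
by apply: (no_quaternary_m7mod8 L_univ L_rank m_sqf h Le1 Le2 he1 he2 he12); lia.
Qed.
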